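(* Let $X=\{1,\dots,n\}$, let $T$ be a rooted binary phylogenetic tree on $X$ and $N$ a rooted binary phylogenetic network on $X$. Then $d_{\mathrm{SNPR}}(T,N)=m(T,N)$.
   Context: A rooted binary phylogenetic network on $X$ is a rooted directed acyclic graph (parallel edges allowed) whose vertices are: a unique root $\rho$ of in-degree 0 and out-degree 1; leaves of in-degree 1 and out-degree 0, bijectively labelled by $X$; inner tree vertices of in-degree 1 and out-degree 2; and reticulations of in-degree 2 and out-degree 1. Tree vertices are the inner tree vertices, leaves and the root. A rooted binary phylogenetic tree is such a network with no reticulations. A directed graph $G$ has an embedding into $N$ if some subdivision of $G$ is a subgraph of $N$, with labelled vertices mapped to vertices of the same label; the embedding covers an edge of $N$ if an edge of the subdivision is mapped to it. SNPR operations on an edge $e=(u,v)$: (SNPR$^0$) if $u$ is a tree vertex, $u\ne\rho$: delete $e$, suppress $u$, subdivide an edge not a descendant of $v$ with a new vertex $u'$, add $(u',v)$; (SNPR$^+$) subdivide $(u,v)$ with a new vertex $v'$, subdivide an edge of the resulting network not a descendant of $v'$ with a new vertex $u'$, add $(u',v')$; (SNPR$^-$) if $u$ is a tree vertex and $v$ a reticulation: delete $e$, suppress $u$ and $v$. $d_{\mathrm{SNPR}}(N,N')$ is the minimum number of SNPR operations transforming $N$ into $N'$ through phylogenetic networks on $X$. Agreement forests: for a tree $T$ and network $N$ on $X$ with $r$ reticulations, regard the root $\rho$ as an element of the label sets. An agreement forest for $T$ and $N$ is a collection $\{T_\rho,T_1,\dots,T_k,E_1,\dots,E_r\}$ where $T_\rho$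 is an isolated vertex labelled $\rho$ or a phylogenetic tree whose label set includes $\rho$, each $T_i$ is a phylogenetic tree, and each $E_j$ is a graph consisting of a single directed edge (a disagreement edge), such that: (i) $L(T_\rho),L(T_1),\dots,L(T_k)$ partition $X\cup\{\rho\}$; (ii) there are simultaneous edge-disjoint embeddings of $T_\rho,T_1,\dots,T_k$ into $T$ covering all edges of $T$; (iii) there are simultaneous edge-disjoint embeddings of $T_\rho,T_1,\dots,T_k,E_1,\dots,E_r$ into $N$ covering all edges of $N$. $m(T,N)=k+r$ where $k$ is the minimum possible number of components $T_1,\dots,T_k$ over all agreement forests for $T$ and $N$. *)

(* Defs.v *)
From mathcomp Require Import all_boot.

Set Implicit Arguments.
Unset Strict Implicit.
Unset Printing Implicit Defensive.

Section Digraphs.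

Variable L : Type.

(* Finite directed multigraphs (parallel edges are distinct elements of
   [edge]) in which some vertices carry a label in L. *)
Record lgraph := LGraph {
  vertex : finType;
  edge : finType;
  src : edge -> vertex;
  tgt : edge -> vertex;
  lab : vertex -> option L
}.

Definition has_label (G : lgraph) (l : L) : Prop :=
  exists v : vertex G, lab v = Some l.

Definition adj (G : lgraph) : rel (vertex G) :=
  fun x y => [exists e : edge G, (src e == x) && (tgt e == y)].

Definition indeg (G : lgraph) (v : vertex G) : nat :=
  #|[set e : edge G | tgt e == v]|.

Definition outdeg (G : lgraph) (v : vertex G) : nat :=
  #|[set e : edge G | src e == v]|.

Definition acyclic (G : lgraph) : Prop :=
  forall e : edge G, ~~ connect (@adj G) (tgt e) (src e).

(* An edge is a descendant of v when its tail is v or is reachable from v;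
   its head alone does not matter, so that an edge into v is not one. *)
Definition edge_descendant (G : lgraph) (v : vertex G) (f : edge G) : bool :=
  connect (@adj G) v (src f).

Definition isomorphic (G H : lgraph) : Prop :=
  exists (fV : vertex G -> vertex H) (fE : edge G -> edge H),
    [/\ bijective fV, bijective fE,
        forall e, src (fE e) = fV (src e),
        forall e, tgt (fE e) = fV (tgt e)
      & forall v, lab (fV v) = lab v].

Definition add_edge (G : lgraph) (x y : vertex G) : lgraph :=
  @LGraph (vertex G) (option (edge G))
    (fun o => if o is Some e then src e else x)
    (fun o => if o is Some e then tgt e else y)
    (@lab G).

Definition del_edge (G : lgraph) (e : edge G) : lgraph :=
  @LGraph (vertex G) {x : edge G | x != e}
    (fun x => src (val x)) (fun x => tgt (val x)) (@lab G).

(* The new vertex is None; f becomes its incoming edge [Some f], and the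
   edge [None] leads from the new vertex to the old head of f. *)
Definition subdivide (G : lgraph) (f : edge G) : lgraph :=
  @LGraph (option (vertex G)) (option (edge G))
    (fun o => if o is Some e then Some (src e) else None)
    (fun o => if o is Some e then if e == f then None else Some (tgt e)
              else Some (tgt f))
    (fun o => if o is Some v then lab v else None).

Definition del_vertex (G : lgraph) (u : vertex G) : lgraph :=
  @LGraph {x : vertex G | x != u}
    {e : edge G | (src e != u) && (tgt e != u)}
    (fun e => Sub (src (val e)) (proj1 (andP (valP e))))
    (fun e => Sub (tgt (val e)) (proj2 (andP (valP e))))
    (fun x => lab (val x)).

Definition suppressible (G : lgraph) (u : vertex G)
    (p c : vertex (del_vertex u)) : Prop :=
  [/\ indeg u = 1, outdeg u = 1, adj (val p) u & adj u (val c)].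

(* Only meaningful under [suppressible p c]. *)
Definition suppress (G : lgraph) (u : vertex G)
    (p c : vertex (del_vertex u)) : lgraph :=
  add_edge p c.

Inductive is_subdivision (G : lgraph) : lgraph -> Prop :=
| subdivision_refl : is_subdivision G G
| subdivision_step (H : lgraph) (f : edge H) :
    is_subdivision G H -> is_subdivision G (subdivide f).

(* The subgraphs of G isomorphic to S, label-preservingly on the labelled
   vertices of S, are the images of the following morphisms. *)
Record subgraph_emb (S G : lgraph) := SubgraphEmb {
  embV : vertex S -> vertex G;
  embE : edge S -> edge G;
  embV_inj : injective embV;
  embE_inj : injective embE;
  emb_src : forall e, src (embE e) = embV (src e);
  emb_tgt : forall e, tgt (embE e) = embV (tgt e);
  emb_lab : forall v l, lab v = Some l -> lab (embV v) = Some l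
}.

(* Simultaneous edge-disjoint embeddings of the graphs F i into G covering
   all edges of G; different components may share vertices of G. *)
Definition covering_embeddings (I : Type) (F : I -> lgraph) (G : lgraph) :
    Prop :=
  exists (S : I -> lgraph) (h : forall i, subgraph_emb (S i) G),
    [/\ forall i, is_subdivision (F i) (S i),
        forall i j (e : edge (S i)) (f : edge (S j)),
          embE (h i) e = embE (h j) f -> i = j
      & forall e : edge G, exists i (f : edge (S i)), embE (h i) f = e].

Definition single_edge : lgraph :=
  @LGraph bool unit (fun=> false) (fun=> true) (fun=> None).

Definition is_root (G : lgraph) (v : vertex G) : bool :=
  (indeg v == 0) && (outdeg v == 1).

Definition is_leaf (G : lgraph) (v : vertex G) : bool :=
  (indeg v == 1) && (outdeg v == 0).

Definition is_inner (G : lgraph) (v : vertex G) : bool :=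
  (indeg v == 1) && (outdeg v == 2).

Definition is_reticulation (G : lgraph) (v : vertex G) : bool :=
  (indeg v == 2) && (outdeg v == 1).

Definition is_tree_vertex (G : lgraph) (v : vertex G) : bool :=
  [|| is_inner v, is_leaf v | is_root v].

Definition nret (G : lgraph) : nat := #|[set v : vertex G | is_reticulation v]|.

(* e = (u,v): delete e, suppress u, regraft v. *)
Definition snpr0 (N N' : lgraph) : Prop :=
  exists e : edge N,
    [/\ is_tree_vertex (src e), ~~ is_root (src e)
      & exists p c : vertex (@del_vertex (del_edge e) (src e)),
        suppressible p c /\
        exists (v : vertex (suppress p c)) (f : edge (suppress p c)),
          [/\ val v = tgt e, ~~ edge_descendant v f
            & isomorphic (@add_edge (subdivide f) None (Some v)) N']].

(* In [subdivide e] the new vertex v' is None; after the second subdivision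
   it is [Some None] and the newer vertex u' is None. *)
Definition snpr_plus (N N' : lgraph) : Prop :=
  exists (e : edge N) (f : edge (subdivide e)),
    ~~ @edge_descendant (subdivide e) None f /\
    isomorphic (@add_edge (subdivide f) None (Some None)) N'.

(* e = (u,v): delete e, suppress u, then suppress v. *)
Definition snpr_minus (N N' : lgraph) : Prop :=
  exists e : edge N,
    [/\ is_tree_vertex (src e), is_reticulation (tgt e)
      & exists p c : vertex (@del_vertex (del_edge e) (src e)),
        suppressible p c /\
        exists v : vertex (suppress p c),
          val v = tgt e /\
          exists q d : vertex (@del_vertex (suppress p c) v),
            suppressible q d /\ isomorphic (suppress q d) N'].

Definition snpr (N N' : lgraph) : Prop :=
  [\/ snpr0 N N', snpr_plus N N' | snpr_minus N N'].

End Digraphs.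

(* The label set {1,...,n} with rho added. *)
Inductive label (n : nat) := Rho | Taxon of 'I_n.
Arguments Rho {n}.

(* Rooted binary phylogenetic networks on an arbitrary set of taxa, namely
   those labelling its leaves.  The root carries the label rho or none: in an
   agreement forest only the root of T_rho is labelled. *)
Definition phylo_network (n : nat) (G : lgraph (label n)) : Prop :=
  [/\ acyclic G,
      exists! r : vertex G, is_root r,
      forall v : vertex G,
        [|| is_root v, is_leaf v, is_inner v | is_reticulation v],
      forall v : vertex G,
        [/\ is_root v -> lab v = Some Rho \/ lab v = None,
            is_leaf v -> exists i, lab v = Some (Taxon i)
          & is_inner v || is_reticulation v -> lab v = None]
    & forall (v w : vertex G) i,
        lab v = Some (Taxon i) -> lab w = Some (Taxon i) -> v = w].

Definition phylo_tree (n : nat) (G : lgraph (label n)) : Prop :=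
  phylo_network G /\ forall v : vertex G, ~~ is_reticulation v.

(* On the whole set X = {1,...,n}, with root labelled rho. *)
Definition network_on_X (n : nat) (G : lgraph (label n)) : Prop :=
  phylo_network G /\ forall l : label n, has_label G l.

Definition tree_on_X (n : nat) (G : lgraph (label n)) : Prop :=
  phylo_tree G /\ forall l : label n, has_label G l.

Definition is_minimum (P : nat -> Prop) (d : nat) : Prop :=
  P d /\ forall j, P j -> d <= j.

(* [snpr_path d N N']: d SNPR operations lead from N to N' through networks
   on X. Networks are considered up to isomorphism. *)
Inductive snpr_path (n : nat) : nat -> lgraph (label n) -> lgraph (label n) -> Prop :=
| snpr_path0 N N' : isomorphic N N' -> snpr_path 0 N N'
| snpr_pathS d N M N' :
    snpr N M -> network_on_X M -> snpr_path d M N' -> snpr_path d.+1 N N'.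

Definition is_d_SNPR (n : nat) (N N' : lgraph (label n)) (d : nat) : Prop :=
  is_minimum (fun j => snpr_path j N N') d.

Definition isolated_rho (n : nat) (G : lgraph (label n)) : Prop :=
  [/\ #|vertex G| = 1, #|edge G| = 0 & forall v : vertex G, lab v = Some Rho].

(* F None is T_rho and F (Some i) is T_(i+1); the r = nret N disagreement
   edges are copies of [single_edge].  The blocks of the partition of
   X + {rho} are nonempty since every component has a label. *)
Definition agreement_forest (n : nat) (T N : lgraph (label n)) (k : nat)
    (F : option 'I_k -> lgraph (label n)) : Prop :=
  [/\ isolated_rho (F None) \/ phylo_tree (F None) /\ has_label (F None) Rho,
      forall i, phylo_tree (F (Some i)),
      forall l : label n, exists! i, has_label (F i) l,
      covering_embeddings F T
    & covering_embeddings
        (fun c : option 'I_k + 'I_(nret N) =>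
           if c is inl i then F i else single_edge (label n)) N].

Definition is_m (n : nat) (T N : lgraph (label n)) (m : nat) : Prop :=
  exists k : nat,
    is_minimum
      (fun j => exists F : option 'I_j -> lgraph (label n),
                  agreement_forest T N F) k /\
    m = k + nret N.

(* Main.v *)
(* An embedded forest is recorded by local data on edges: the term of the part
   of a component that hangs below the edge, and flags telling where components
   start and where disagreement edges stop.  An agreement forest for T and N then
   is a pair of such decorations with the same multiset of component terms.

   Lower bound: T agrees with itself without extra components.  One SNPR
   operation on N first turns the pruned edge into the start of a component,
   which costs at most one new component (cut a component at a branching vertex,
   or exchange the two components meeting at a non-branching one); such an edge
   can then be moved or deleted, and a new edge is a new disagreement edge.

   Upper bound: the stop edge at a topmost reticulation can be made a
   single-edge component and is then removable by the inverse of an SNPR+.  Once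
   N is a tree, a component starting lowest in T is regrafted onto the place
   where it hangs in N, which merges two components.  Trees that agree without
   extra components are isomorphic. *)

From HB Require Import structures.
From Stdlib Require Import ClassicalEpsilon.
Require Import Defs.
From mathcomp Require Import all_boot zify.

Set Implicit Arguments.
Unset Strict Implicit.
Unset Printing Implicit Defensive.

(** * Terms and decorations *)

(* Terms stand for phylogenetic trees; the order of the two children of a vertex
   is not determined, see the flag of [bnode]. *)
Inductive bt (n : nat) := BLeaf of 'I_n | BNode of bt n & bt n.

Fixpoint bt_eqb n (s t : bt n) : bool :=
  match s, t with
  | BLeaf i, BLeaf j => i == j
  | BNode s1 s2, BNode t1 t2 => bt_eqb s1 t1 && bt_eqb s2 t2
  | _, _ => false
  end.

Lemma bt_eqP n : Equality.axiom (@bt_eqb n).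
Proof.
elim=> [i|s1 IH1 s2 IH2] [j|t1 t2] /=; try by constructor.
  by apply: (iffP eqP) => [->|[]].
apply: (iffP andP) => [[/IH1 -> /IH2 ->] // | [<- <-]].
by split; [apply/IH1|apply/IH2].
Qed.

HB.instance Definition _ n := hasDecEq.Build (bt n) (@bt_eqP n).

Fixpoint bt_size n (t : bt n) : nat :=
  if t is BNode s1 s2 then (bt_size s1 + bt_size s2).+1 else 0.

Definition bnode n (dir : bool) (x y : bt n) := if dir then BNode y x else BNode x y.

Lemma bnode_neq n dir (x y : bt n) : bnode dir x y <> x.
Proof. by move/(congr1 (@bt_size n)); case: dir => /=; lia. Qed.

Fixpoint sub n (p : seq bool) (s : bt n) : option (bt n) :=
  match p, s with
  | [::], _ => Some s
  | dir :: p', BNode l r => sub p' (if dir then r else l)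
  | _, _ => None
  end.

Fixpoint rep n (p : seq bool) (s y : bt n) : bt n :=
  match p, s with
  | [::], _ => y
  | dir :: p', BNode l r => if dir then BNode l (rep p' r y) else BNode (rep p' l y) r
  | _, _ => s
  end.

Lemma sub_rcons n p dir (s x y : bt n) :
  sub p s = Some (bnode dir x y) -> sub (rcons p dir) s = Some x.
Proof.
elim: p s => [|d p IH] /= s; first by case=> ->; case: dir.
by case: s => [//|l r] /IH.
Qed.

Lemma sub_rcons_inv n p dir (s x : bt n) :
  sub (rcons p dir) s = Some x -> exists y, sub p s = Some (bnode dir x y).
Proof.
elim: p s => [|d p IH] /= s.
  by case: s => // l r; case: dir => [[->]|[->]]; [exists l|exists r].
by case: s => [//|l r] /IH.
Qed.

Lemma rep_rcons n p dir (s x y z : bt n) :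
  sub p s = Some (bnode dir x y) -> rep (rcons p dir) s z = rep p s (bnode dir z y).
Proof.
elim: p s => [|d p IH] /= s; first by case=> ->; case: dir.
by case: s => [//|l r]; case: d => /IH ->.
Qed.

Definition osub n p (s : option (bt n)) := if p is [::] then s else obind (sub p) s.
Definition orep n p (s y : option (bt n)) : option (bt n) :=
  if p is [::] then y else
  match s, y with Some s, Some y => Some (rep p s y) | _, _ => None end.

Lemma osub_Some n p (s : bt n) : osub p (Some s) = sub p s.
Proof. by case: p. Qed.

Lemma orep_Some n p (s y : bt n) : orep p (Some s) (Some y) = Some (rep p s y).
Proof. by case: p. Qed.

Section Local.
Variable n : nat.
Local Notation lgr := (lgraph (label n)).
Local Notation bt := (bt n).

Definition ine (G : lgr) (v : vertex G) := [seq e <- enum (edge G) | tgt e == v].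
Definition oute (G : lgr) (v : vertex G) := [seq e <- enum (edge G) | src e == v].

Lemma mem_ine (G : lgr) (v : vertex G) e : (e \in ine v) = (tgt e == v).
Proof. by rewrite mem_filter mem_enum andbT. Qed.
Lemma mem_oute (G : lgr) (v : vertex G) e : (e \in oute v) = (src e == v).
Proof. by rewrite mem_filter mem_enum andbT. Qed.
Lemma uniq_ine (G : lgr) (v : vertex G) : uniq (ine v).
Proof. by rewrite filter_uniq ?enum_uniq. Qed.
Lemma uniq_oute (G : lgr) (v : vertex G) : uniq (oute v).
Proof. by rewrite filter_uniq ?enum_uniq. Qed.
Hint Resolve uniq_ine uniq_oute : core.

Lemma indegE (G : lgr) (v : vertex G) : indeg v = size (ine v).
Proof.
rewrite /indeg cardE; apply/perm_size/uniq_perm; rewrite ?enum_uniq //.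
by move=> e; rewrite mem_enum mem_ine inE.
Qed.
Lemma outdegE (G : lgr) (v : vertex G) : outdeg v = size (oute v).
Proof.
rewrite /outdeg cardE; apply/perm_size/uniq_perm; rewrite ?enum_uniq //.
by move=> e; rewrite mem_enum mem_oute inE.
Qed.

(* [tm e] is the term of the part below e of the component containing e (None on
   disagreement edges), [st e] says that e starts a component, and [sp e] that a
   disagreement edge stops at the head of e. *)
Record deco (G : lgr) := Deco {
  tm : edge G -> option bt;
  st : edge G -> bool;
  sp : edge G -> bool
}.

Definition ins G (d : deco G) v := [seq (tm d e, sp d e) | e <- ine v].
Definition outs G (d : deco G) v := [seq (tm d e, st d e) | e <- oute v].

(* Conditions at a vertex labelled l whose in-edges carry the terms and stop
   flags i and whose out-edges carry the terms and start flags o; r0 is the term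
   of T_rho, None if T_rho is isolated.  The root edge is a start edge exactly
   when T_rho is isolated. *)
Definition ok (r0 : option bt) (l : option (label n))
    (i o : seq (option bt * bool)) : Prop :=
  match i, o with
  | [::], [:: b] => if b.2 then r0 = None else b.1 = r0 /\ r0 <> None
  | [:: a], [::] =>
      (exists j, [/\ ~~ a.2, l = Some (Taxon j) & a.1 = Some (BLeaf j)]) \/
      [/\ a.2, l = None & a.1 = None]
  | [:: a], [:: c] => [/\ ~~ a.2, ~~ c.2 & c.1 = a.1]
  | [:: a], [:: b; c] => ~~ a.2 /\
      [\/ [/\ ~~ b.2, ~~ c.2 & exists dir x y,
             [/\ b.1 = Some x, c.1 = Some y & a.1 = Some (bnode dir x y)]],
          [/\ b.2, ~~ c.2 & c.1 = a.1] | [/\ c.2, ~~ b.2 & b.1 = a.1]]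
  | [:: a; b], [:: c] => ~~ c.2 /\
      ([/\ a.2, a.1 = None, ~~ b.2 & b.1 = c.1] \/
       [/\ b.2, b.1 = None, ~~ a.2 & a.1 = c.1])
  | _, _ => False
  end.

Lemma perm1 (T : eqType) (a : T) s : perm_eq [:: a] s -> s = [:: a].
Proof. by rewrite perm_sym => /perm_small_eq -> . Qed.

Lemma perm2 (T : eqType) (a b : T) s :
  perm_eq [:: a; b] s -> s = [:: a; b] \/ s = [:: b; a].
Proof.
move=> H; have := perm_size H; case: s H => [|x [|y []]] // H _.
have := perm_mem H x; rewrite !inE eqxx /=.
case/orP=> /eqP E; rewrite E in H *.
  by left; move: H; rewrite perm_cons => /perm1 [->].
right; have {H}: perm_eq [:: b; a] [:: b; y].
  by apply: perm_trans H; rewrite (perm_catC [:: b] [:: a]).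
by rewrite perm_cons => /perm1 [->].
Qed.

Lemma perm_swap (T : eqType) (x y : T) s : perm_eq (x :: y :: s) (y :: x :: s).
Proof. by rewrite (perm_catCA [:: x] [:: y] s). Qed.

Lemma ok_perm r0 l i o i' o' :
  perm_eq i i' -> perm_eq o o' -> ok r0 l i o -> ok r0 l i' o'.
Proof.
move=> Hi Ho; have si := perm_size Hi; have so := perm_size Ho.
case: i Hi si => [|a [|b [|//]]] /=.
- case: i' => // Hi _; case: o Ho so => [|x [|//]] //= /perm1 -> //.
- move=> /perm1 -> _; case: o Ho so => [|x [|y [|//]]] //=.
  + by case: o'.
  + by move=> /perm1 -> .
  + move=> /perm2 [] -> _ //= [-> H]; split=> //; case: H.
    * case=> ? ? [dir [u [v [? ? H]]]]; apply: Or31; split=> //.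
      by exists (~~ dir), v, u; split=> //; case: dir H.
    * by move=> ?; apply: Or33.
    * by move=> ?; apply: Or32.
- move=> /perm2 [] -> _; case: o Ho so => [|x [|//]] //= /perm1 -> //.
  by move=> _ [H [?|?]]; split=> //; [right|left].
Qed.

Definition okat r0 G (d : deco G) v := ok r0 (lab v) (ins d v) (outs d v).
Definition valid r0 G (d : deco G) := forall v, okat r0 d v.

(* The constructors of [vview] orient the two edges that [ok] lists in either
   order: [b] is the start edge in VPass and [a] the stop edge in VRet. *)
Inductive vview r0 G (d : deco G) (v : vertex G) : Prop :=
| VRoot b of ine v = [::] & oute v = [:: b]
    & if st d b then r0 = None else tm d b = r0 /\ r0 <> None
| VLeaf a j of ine v = [:: a] & oute v = [::] & ~~ sp d a
    & lab v = Some (Taxon j) & tm d a = Some (BLeaf j)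
| VSink a of ine v = [:: a] & oute v = [::] & sp d a
    & lab v = None & tm d a = None
| VSub a c of ine v = [:: a] & oute v = [:: c] & ~~ sp d a & ~~ st d c
    & tm d c = tm d a
| VBranch a b c dir x y of ine v = [:: a] & perm_eq (oute v) [:: b; c] & b != c
    & ~~ sp d a & ~~ st d b & ~~ st d c & tm d b = Some x & tm d c = Some y
    & tm d a = Some (bnode dir x y)
| VPass a b c of ine v = [:: a] & perm_eq (oute v) [:: b; c] & b != c
    & ~~ sp d a & st d b & ~~ st d c & tm d c = tm d a
| VRet a b c of perm_eq (ine v) [:: a; b] & oute v = [:: c] & a != b
    & sp d a & tm d a = None & ~~ sp d b & ~~ st d c & tm d b = tm d c.

Lemma okatP r0 G (d : deco G) v : okat r0 d v <-> vview r0 d v.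
Proof.
rewrite /okat /ins /outs; split.
- have := uniq_ine v; have := uniq_oute v.
  case Ei: (ine v) => [|a [|b [|//]]]; case Eo: (oute v) => [|x [|y [|//]]] //=.
  + by move=> _ _; apply: VRoot Ei Eo.
  + by move=> _ _ [[j [? ? ?]]|[? ? ?]]; [apply: (@VLeaf r0 G d v a j)|apply: (@VSink r0 G d v a)].
  + by move=> _ _ [? ? ?]; apply: (@VSub r0 G d v a x).
  + rewrite inE andbT => ne _ [sa]; case.
    * case=> ? ? [dir [u [w [? ? ?]]]].
      by apply: (@VBranch r0 G d v a x y dir u w); rewrite ?Eo.
    * by case=> ? ? ?; apply: (@VPass r0 G d v a x y); rewrite ?Eo.
    * case=> ? ? ?; apply: (@VPass r0 G d v a y x); rewrite ?Eo //.
        by rewrite (perm_catC [:: x] [:: y]).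
      by rewrite eq_sym.
  + rewrite inE andbT => _ ne [sx [[? ? ? ?]|[? ? ? ?]]].
      by apply: (@VRet _ _ _ _ a b x); rewrite ?Ei.
    apply: (@VRet _ _ _ _ b a x); rewrite ?Ei //.
      by rewrite (perm_catC [:: a] [:: b]).
    by rewrite eq_sym.
- case.
  + by move=> b -> -> /=.
  + by move=> a j -> -> *; left; exists j.
  + by move=> a -> -> *; right.
  + by move=> a c -> ->.
  + move=> a b c dir x y -> /(perm_map (fun e => (tm d e, st d e))) Po *.
    rewrite perm_sym in Po; apply: ok_perm Po _ => //=; split=> //.
    by apply: Or31; split=> //; exists dir, x, y.
  + move=> a b c -> /(perm_map (fun e => (tm d e, st d e))) Po *.
    rewrite perm_sym in Po; apply: ok_perm Po _ => //=; split=> //.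
    by apply: Or32.
  + move=> a b c /(perm_map (fun e => (tm d e, sp d e))) Po -> *.
    rewrite perm_sym in Po; apply: ok_perm Po _ _ => //=; split=> //.
    by left.
Qed.

(* The term on a start edge is irrelevant at its tail. *)
Lemma okat_eq r0 G (d d' : deco G) v :
  (forall e, tgt e = v -> tm d' e = tm d e /\ sp d' e = sp d e) ->
  (forall e, src e = v -> st d' e = st d e /\ (st d e \/ tm d' e = tm d e)) ->
  okat r0 d v -> okat r0 d' v.
Proof.
move=> Hi Ho; rewrite /okat.
have -> : ins d' v = ins d v.
  by apply/eq_in_map => e; rewrite mem_ine => /eqP /Hi [-> ->].
move: (ins d v) => i; rewrite /outs.
have {Ho}: forall e, e \in oute v -> st d' e = st d e /\ (st d e \/ tm d' e = tm d e).
  by move=> e; rewrite mem_oute => /eqP /Ho.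
case: (oute v) => [//|x [|y [|z w]]] Ho; last by case: i => [|? [|? []]].
- have [/= -> Hx] := Ho x (mem_head _ _).
  case: i => [|? [|? []]] //=.
  + by case: Hx => [->|->].
  + by move=> [? nx E]; case: Hx nx => [->//|->].
  + by move=> [nx E]; case: Hx nx E => [->//|->].
- have [/= -> Hx] := Ho x (mem_head _ _).
  have [/= -> Hy] : st d' y = st d y /\ (st d y \/ tm d' y = tm d y).
    by apply: Ho; rewrite !inE eqxx orbT.
  case: i => [|? [|? []]] //= [-> H]; split=> //; case: H => [[nx ny H]|[nx ny E]|[nx ny E]].
  + by apply: Or31; split=> //; case: Hx nx => [->//|->]; case: Hy ny => [->//|->].
  + by apply: Or32; split=> //; case: Hy ny => [->//|->].
  + by apply: Or33; split=> //; case: Hx ny => [->//|->].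
Qed.

Lemma okat_r0 r0 r1 G (d : deco G) v : ine v <> [::] -> okat r0 d v -> okat r1 d v.
Proof. by move=> H; rewrite /okat /ins; case: (ine v) H => [//|a [|b [|c s]]] _ /=. Qed.


Definition start_term G (d : deco G) e := if st d e then tm d e else None.
Definition starts G (d : deco G) := pmap (start_term d) (enum (edge G)).

Lemma starts_local G (d d' : deco G) (s : seq (edge G)) :
  uniq s -> (forall e, e \notin s -> start_term d' e = start_term d e) ->
  exists R, perm_eq (starts d) (pmap (start_term d) s ++ R) /\
            perm_eq (starts d') (pmap (start_term d') s ++ R).
Proof.
move=> us H; pose r := [seq e <- enum (edge G) | e \notin s].
have P : perm_eq (enum (edge G)) (s ++ r).
  apply: uniq_perm (enum_uniq _) _ _.
    rewrite cat_uniq us (filter_uniq _ (enum_uniq _)) andbT /=.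
    by apply/hasPn => e; rewrite mem_filter => /andP[].
  by move=> e; rewrite mem_cat !mem_enum /r mem_filter mem_enum andbT orbN.
exists (pmap (start_term d) r); split; rewrite /starts.
  by rewrite -pmap_cat; apply: perm_pmap.
have <- : pmap (start_term d') r = pmap (start_term d) r.
  have: all (fun e => e \notin s) r by rewrite filter_all.
  by elim: (r) => //= e r' IH /andP[/H -> /IH ->].
by rewrite -pmap_cat; apply: perm_pmap.
Qed.

Lemma mem_starts G (d : deco G) t :
  t \in starts d -> exists e, st d e /\ tm d e = Some t.
Proof.
rewrite mem_pmap => /mapP[e _]; rewrite /start_term; case: ifP => // ? H.
by exists e.
Qed.

(* In the forest with rho-component r and other components ts, one component s
   is replaced by s'; the flag b tells whether it is taken from ts. *)
Definition replace_comp (b : bool) (r : option bt) (ts : seq bt) (s : bt)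
               (r' : option bt) (ts' : seq bt) (s' : bt) : Prop :=
  if b then exists R, [/\ r' = r, perm_eq ts (s :: R) & perm_eq ts' (s' :: R)]
  else [/\ r = Some s, r' = Some s' & perm_eq ts' ts].

Section Ranked.
Variables (G : lgr) (rk : vertex G -> nat).
Hypothesis Hrk : forall e : edge G, rk (src e) < rk (tgt e).
Implicit Types (d : deco G) (a b c e f : edge G).

(* The component of e0 leads down to the last edge, which carries the subterm at
   the given position of the term of e0. *)
Inductive occ d (e0 : edge G) : seq bool -> edge G -> Prop :=
| occ0 : occ d e0 [::] e0
| occP p a c : occ d e0 p a -> tgt a = src c -> ~~ sp d a -> ~~ st d c ->
    tm d c = tm d a -> occ d e0 p c
| occB p a c dir x y : occ d e0 p a -> tgt a = src c -> ~~ sp d a -> ~~ st d c ->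
    tm d a = Some (bnode dir x y) -> tm d c = Some x -> occ d e0 (rcons p dir) c.

Lemma occ_sub d e0 p a : occ d e0 p a -> osub p (tm d e0) = tm d a.
Proof.
elim=> {p a} [//|p a c _ IH _ _ _ ->//|p a c dir x y _ IH _ _ _ Ea Ec].
rewrite Ec; move: IH; rewrite Ea; case: (tm d e0) => [s|]; last by case: p.
by rewrite !osub_Some => /sub_rcons.
Qed.

Lemma occ_rk d e0 p a : occ d e0 p a -> e0 = a \/ rk (tgt e0) <= rk (src a).
Proof.
elim=> {p a} [|p a c _ IH E _ _ _|p a c dir x y _ IH E _ _ _ _]; first by left.
all: right; rewrite -E; have := Hrk a; case: IH => [->//|]; lia.
Qed.

Lemma occ_nil d e0 p a : tm d a = None -> occ d e0 p a -> p = [::].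
Proof.
move=> Na H; have := occ_sub H; rewrite Na => /eqP.
elim: H Na => {p a} [//|p a c H IH _ _ _ -> //|p a c dir x y _ _ _ _ _ _ ->//].
Qed.

Definition upd T (g : edge G -> T) e y f := if f == e then y else g f.

Lemma replace_step r0 d e0 a c Y' Y tm' :
  valid r0 d -> e0 = a \/ rk (tgt e0) <= rk (src a) ->
  tgt a = src c -> ~~ sp d a -> ~~ st d c ->
  (tm d c = tm d a /\ Y' = Y) \/
  (exists dir x y y0, [/\ tm d a = Some (bnode dir x y), tm d c = Some x,
     Y = Some y0 & Y' = Some (bnode dir y0 y)]) ->
  tm' a = Y' ->
  (forall f, tm' f <> tm d f ->
      (f = e0 \/ ~~ st d f /\ rk (tgt e0) <= rk (src f)) /\ (f = a \/ rk (tgt f) <= rk (src a))) ->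
  (forall v, v <> src e0 -> v <> tgt a -> okat r0 (Deco tm' (st d) (sp d)) v) ->
  [/\ upd tm' c Y e0 = tm' e0,
    forall f, upd tm' c Y f <> tm d f ->
      (f = e0 \/ ~~ st d f /\ rk (tgt e0) <= rk (src f)) /\ (f = c \/ rk (tgt f) <= rk (src c))
  & forall v, v <> src e0 -> v <> tgt c ->
      okat r0 (Deco (upd tm' c Y) (st d) (sp d)) v].
Proof.
move=> V rH E spa stc HY Ea ch V'.
have rka := Hrk a; have rkc := Hrk c; have rE : rk (tgt a) = rk (src c) by rewrite E.
have nac : a != c by apply/eqP => Q; move: E rka; rewrite Q => ->; lia.
have ne0c : e0 != c.
  apply/eqP => Q; case: rH => [Q2|]; first by move: nac; rewrite -Q Q2 eqxx.
  rewrite Q; lia.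
rewrite {1}/upd (negbTE ne0c); split=> //.
  rewrite /upd => f; case: eqP => [-> _|_ /ch [Q1 Q2]]; split=> //.
  + by right; split=> //; case: rH => [->|]; lia.
  + by left.
  + by right; case: Q2 => [->|]; lia.
move=> v vs vt; case: (eqVneq v (tgt a)) => [{vs vt}->|va]; last first.
  apply: okat_eq (V' v vs _); last by apply/eqP.
    by rewrite /upd => e /= Q; case: eqP => // Q2; case: vt; rewrite -Q Q2.
  by rewrite /upd => e /= Q; split; auto; case: eqP => [Q2|]; auto; move: va; rewrite E -Q Q2 eqxx.
have oth f : tgt f = tgt a -> f != a -> tm' f = tm d f.
  move=> Ef nf; apply/eqP/negPn/negP => /eqP /ch [_ [Q|]]; first by rewrite Q eqxx in nf.
  by rewrite Ef; lia.
have oth2 f : src f = tgt a -> tm' f = tm d f.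
  move=> Ef; apply/eqP/negPn/negP => /eqP /ch [_ [Q|]].
    by move: Ef rka; rewrite Q => ->; lia.
  by have := Hrk f; rewrite Ef; lia.
have anc f : tgt f = tgt a -> f != c.
  by move=> Ef; apply/eqP => Q; move: Ef rkc; rewrite Q E => ->; lia.
have ai : a \in ine (tgt a) by rewrite mem_ine.
have co : c \in oute (tgt a) by rewrite mem_oute E.
have Ua : upd tm' c Y a = Y' by rewrite /upd (negbTE nac).
have Uc : upd tm' c Y c = Y by rewrite /upd eqxx.
apply/okatP; case/okatP: (V (tgt a)).
+ by move=> b Ei; rewrite Ei in ai.
+ by move=> a' j _ Eo; rewrite Eo in co.
+ by move=> a' _ Eo; rewrite Eo in co.
+ move=> a' c' Ei Eo; move: ai co; rewrite Ei Eo !inE => /eqP ? /eqP ? _ _ Etm; subst a' c'.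
  apply: (@VSub r0 G _ _ a c) => //=; rewrite Ua Uc.
  case: HY => [[_ ->]//|[dir [x [y [y0 [E1 E2 _ _]]]]]].
  by move: Etm; rewrite E1 E2 => -[/esym/bnode_neq].
+ move=> a' b' c' dir x y Ei Po ne _ sb sc Eb Ec E'.
  move: ai; rewrite Ei inE => /eqP ?; subst a'.
  have side f : f != c -> f \in oute (tgt a) -> upd tm' c Y f = tm d f.
    by move=> nf; rewrite mem_oute /upd (negbTE nf) => /eqP /oth2.
  have bo : b' \in oute (tgt a) by rewrite (perm_mem Po) !inE eqxx.
  have co' : c' \in oute (tgt a) by rewrite (perm_mem Po) !inE eqxx orbT.
  have nn (u w : bt) k : bnode k w u <> u.
    by move=> Q; apply: (@bnode_neq n (~~ k) u w); rewrite -[RHS]Q; case: (k).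
  case: HY => [[Etm _]|[dir' [x' [y' [y0 [E1 E2 EY EY']]]]]].
    exfalso; move: co; rewrite (perm_mem Po) !inE => /orP[] /eqP Q; subst.
      by move: Etm; rewrite Eb E' => -[/esym/bnode_neq].
    by move: Etm; rewrite Ec E' => -[/esym]/nn.
  move: E'; rewrite E1 => -[] Q'.
  move: (co); rewrite (perm_mem Po) !inE => /orP[] /eqP Q.
    subst b'; have [Qx] : Some x = Some x' by rewrite -Eb -E2.
    apply: (@VBranch r0 G _ _ a c c' dir' y0 y) => //=.
      by rewrite Uc.
      by rewrite side // eq_sym.
    rewrite Ua EY'; subst x'; case: dir' {EY' E1} Q' ; case: (dir) => -[]; congruence.
  subst c'; have [Qx] : Some y = Some x' by rewrite -Ec -E2.
  apply: (@VBranch r0 G _ _ a c b' dir' y0 x) => //=.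
  + by rewrite (perm_trans Po) // (perm_catC [:: b'] [:: c]).
  + by rewrite eq_sym.
  + by rewrite Uc.
  + by rewrite side.
  rewrite Ua EY'; subst x'; case: dir' {EY' E1} Q' ; case: (dir) => -[]; congruence.
+ move=> a' b' c' Ei Po ne _ stb _ Etm.
  move: ai; rewrite Ei inE => /eqP ?; subst a'.
  move: (co); rewrite (perm_mem Po) !inE => /orP[] /eqP Q; subst; first by rewrite stb in stc.
  apply: (@VPass r0 G _ _ a b' c') => //=; rewrite Ua Uc.
  case: HY => [[_ ->]//|[dir [x [y [y0 [E1 E2 _ _]]]]]].
  by move: Etm; rewrite E1 E2 => -[/esym/bnode_neq].
+ move=> a' b' c' Pi Eo ne spa' Na' spb _ Eb.
  move: (co); rewrite Eo inE => /eqP ?; subst c'.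
  move: (ai); rewrite (perm_mem Pi) !inE => /orP[] /eqP Q; subst; first by rewrite spa' in spa.
  have Ea' : tgt a' = tgt b' by apply/eqP; rewrite -mem_ine (perm_mem Pi) inE eqxx.
  apply: (@VRet r0 G _ _ a' b' c) => //=.
    by rewrite /upd (negbTE (anc _ Ea')) oth.
  rewrite Ua Uc.
  case: HY => [[_ ->]//|[dir [x [y [y0 [E1 E2 _ _]]]]]].
  by move: Eb; rewrite E1 E2 => -[/bnode_neq].
Qed.

(* Only the terms on the path from e0 to a need to change. *)
Lemma replace_along r0 d e0 p a Y :
  valid r0 d -> occ d e0 p a -> p = [::] \/ Y <> None ->
  exists tm', [/\ tm' a = Y, tm' e0 = orep p (tm d e0) Y,
    forall f, tm' f <> tm d f ->
      (f = e0 \/ ~~ st d f /\ rk (tgt e0) <= rk (src f)) /\ (f = a \/ rk (tgt f) <= rk (src a))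
  & forall v, v <> src e0 -> v <> tgt a -> okat r0 (Deco tm' (st d) (sp d)) v].
Proof.
move=> V H; elim: H Y => {p a}.
- move=> Y _; exists (upd (tm d) e0 Y); rewrite /upd; split; rewrite ?eqxx //.
    by move=> f; case: eqP => // ->; split; left.
  move=> v vs vt; apply: okat_eq (V v) => e /= E; case: (e =P e0) => [Q|]; auto.
    by case: vt; rewrite -E Q.
  by case: vs; rewrite -E Q.
- move=> p a c H IH E spa stc Etm Y /IH [tm' [Ea Ee0 ch V']].
  have [|Q1 ? ?] := replace_step V (occ_rk H) E spa stc _ Ea ch V' (Y := Y).
    by left.
  by exists (upd tm' c Y); split=> //; rewrite ?Q1 // /upd eqxx.
- move=> p a c dir x y H IH E spa stc Ea0 Ec0 [y0|]; last by case=> //; case: (p).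
  move=> _; have [|tm' [Ea Ee0 ch V']] := IH (Some (bnode dir y0 y)); first by right.
  have [|Q1 ? ?] := replace_step V (occ_rk H) E spa stc _ Ea ch V' (Y := Some y0).
    by right; exists dir, x, y, y0.
  exists (upd tm' c (Some y0)); split=> //; first by rewrite /upd eqxx.
  rewrite Q1 Ee0; have := occ_sub H; rewrite Ea0; case: (tm d e0) => [s|].
    by rewrite osub_Some !orep_Some => /rep_rcons ->.
  by case: (p).
Qed.

End Ranked.
End Local.

(** * Cutting, merging and exchanging components *)

Section Moves.
Variable n : nat.
Local Notation lgr := (lgraph (label n)).
Local Notation bt := (bt n).
Variables (G : lgr) (rk : vertex G -> nat).
Hypothesis Hrk : forall e : edge G, rk (src e) < rk (tgt e).
Hypothesis Hroot : forall v w : vertex G, ine v = [::] -> ine w = [::] -> v = w.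
Implicit Types (d : deco G) (a b c e f : edge G).

Definition top d e0 := st d e0 || (ine (src e0) == [::]).

Lemma root_out r0 d b :
  valid r0 d -> ine (src b) = [::] ->
  oute (src b) = [:: b] /\ if st d b then r0 = None else tm d b = r0 /\ r0 <> None.
Proof.
move=> V Ei; have bo : b \in oute (src b) by rewrite mem_oute.
case/okatP: (V (src b)); rewrite ?Ei //.
- by move=> b' _ Eo; move: bo; rewrite Eo inE => /eqP ->.
- by move=> a' b' c' /perm_size.
Qed.

Lemma replace_top r0 d e0 p a Y :
  valid r0 d -> top d e0 -> occ d e0 p a -> p = [::] \/ Y <> None ->
  st d e0 \/ Y <> None ->
  exists tm', [/\ tm' a = Y, tm' e0 = orep p (tm d e0) Y,
    forall f, f <> e0 -> st d f -> tm' f = tm d f,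
    forall f, f <> a -> rk (tgt a) <= rk (tgt f) -> tm' f = tm d f
  & forall v, v <> tgt a ->
      okat (if st d e0 then r0 else tm' e0) (Deco tm' (st d) (sp d)) v].
Proof.
move=> V T H HY HY2; have [tm' [Ea Ee ch V']] := replace_along Hrk V H HY.
have neq f : (tm' f <> tm d f -> False) -> tm' f = tm d f.
  by move=> Q; apply/eqP/negPn/negP => /eqP /Q.
exists tm'; split=> //.
- by move=> f nf sf; apply: neq => /ch [[//|[]]]; rewrite sf.
- by move=> f nf rf; apply: neq => /ch [_ [//|]]; have := Hrk a; lia.
have in0 f : tgt f = src e0 -> tm' f = tm d f.
  move=> Ef; apply: neq => /ch [[Q|[_ ?]] _]; have := Hrk f; have := Hrk e0; rewrite Ef ?Q; lia.
have out0 f : src f = src e0 -> f <> e0 -> tm' f = tm d f.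
  by move=> Ef nf; apply: neq => /ch [[Q|[_ Q]] _] //; have := Hrk e0; rewrite -Ef; lia.
move=> v va; case: (eqVneq v (src e0)) => [Ev|/eqP nv].
- case st0: (st d e0).
    apply: okat_eq (V v) => e /= Q; first by split=> //; apply: in0; rewrite Q.
    split=> //; case: (eqVneq e e0) => [->|/eqP ne]; first by left.
    by right; apply: out0 => //; rewrite Q.
  move: T; rewrite /top st0 /= => /eqP Ei.
  have [Eo /=] := root_out V Ei; rewrite st0 => -[E0 N0].
  apply/okatP; rewrite Ev; apply: (@VRoot n _ G _ _ e0) => //=; rewrite st0; split=> //.
  rewrite Ee; case: HY2 => [|NY]; first by rewrite st0.
  by case: (p) => // ? ?; case: (tm d e0) E0 N0 => [x|] <- // _; case: (Y) NY.
- case st0: (st d e0); first exact: V'.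
  move: T; rewrite /top st0 /= => /eqP Ei.
  apply: okat_r0 (V' v nv va) => Ei'; exact: nv (Hroot Ei' Ei).
Qed.

Definition brdata d a b c dir x y :=
  [/\ ine (tgt a) = [:: a], perm_eq (oute (tgt a)) [:: b; c], b != c,
      [/\ ~~ sp d a, ~~ st d b & ~~ st d c]
    & [/\ tm d b = Some x, tm d c = Some y & tm d a = Some (bnode dir x y)]].

Lemma brdata_sym d a b c dir x y :
  brdata d a b c dir x y -> brdata d a c b (~~ dir) y x.
Proof.
case=> ? P ne [? ? ?] [? ? Ea]; split=> //; last by split=> //; rewrite Ea; case: (dir).
  by rewrite (perm_trans P) // (perm_catC [:: b] [:: c]).
by rewrite eq_sym.
Qed.

Inductive hview d a : Prop :=
| HLeaf j of ~~ sp d a & lab (tgt a) = Some (Taxon j) & tm d a = Some (BLeaf j)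
    & oute (tgt a) = [::]
| HStop of sp d a & tm d a = None
| HCont c of ~~ sp d a & src c = tgt a & ~~ st d c & tm d c = tm d a
    & forall c', src c' = tgt a -> ~~ st d c' -> c' = c
| HBranch b c dir x y of brdata d a b c dir x y.

Lemma hviewP r0 d a : valid r0 d -> hview d a.
Proof.
move=> V; have ai : a \in ine (tgt a) by rewrite mem_ine.
have mo c : (c \in oute (tgt a)) = (src c == tgt a) by rewrite mem_oute.
case/okatP: (V (tgt a)).
- by move=> b Ei; rewrite Ei in ai.
- move=> a' j Ei; move: ai; rewrite Ei inE => /eqP <- *.
  by apply: (@HLeaf d a j).
- by move=> a' Ei; move: ai; rewrite Ei inE => /eqP <- *; apply: HStop.
- move=> a' c Ei Eo; move: ai; rewrite Ei inE => /eqP <- *.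
  have Ec := mo c; rewrite Eo inE eqxx in Ec.
  apply: (@HCont d a c) => //; first by apply/eqP.
  by move=> c' /eqP; rewrite -mo Eo inE => /eqP.
- move=> a' b c dir x y Ei Po; move: ai; rewrite Ei inE => /eqP Q *; subst a'.
  by apply: (@HBranch d a b c dir x y).
- move=> a' b c Ei Po ne; move: ai; rewrite Ei inE => /eqP <- sa sb sc E.
  have Ec := mo c; rewrite (perm_mem Po) !inE eqxx orbT in Ec.
  apply: (@HCont d a c) => //; first by apply/eqP.
  move=> c' /eqP; rewrite -mo (perm_mem Po) !inE => /orP[] /eqP -> //.
  by rewrite sb.
- move=> a' b c Pi Eo ne spa Na spb sc E.
  move: ai; rewrite (perm_mem Pi) !inE => /orP[] /eqP Q; subst; first exact: HStop.
  have Ec := mo c; rewrite Eo inE eqxx in Ec.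
  apply: (@HCont d b c) => //; first by apply/eqP.
  by move=> c' /eqP; rewrite -mo Eo inE => /eqP.
Qed.

Inductive uview d e : Prop :=
| UTop of top d e
| UCont a of ~~ st d e & tgt a = src e & ~~ sp d a & tm d e = tm d a
    & forall a', tgt a' = src e -> ~~ sp d a' -> a' = a
| UBranch a c dir x y of tgt a = src e & brdata d a e c dir x y.

Lemma uviewP r0 d e : valid r0 d -> uview d e.
Proof.
move=> V; case T: (top d e); first exact: UTop.
have {T} [se ri] : ~~ st d e /\ ine (src e) <> [::].
  by move: T; rewrite /top; case: (st d e) => //= /eqP.
have eo : e \in oute (src e) by rewrite mem_oute.
have mi a : (a \in ine (src e)) = (tgt a == src e) by rewrite mem_ine.
have ui a a' : ine (src e) = [:: a] -> tgt a' = src e -> ~~ sp d a' -> a' = a.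
  by move=> Ei /eqP; rewrite -mi Ei inE => /eqP.
have ta a : ine (src e) = [:: a] -> tgt a = src e.
  by move=> Ei; apply/eqP; rewrite -mi Ei inE.
case/okatP: (V (src e)).
- by move=> b Ei.
- by move=> a j _ Eo; rewrite Eo in eo.
- by move=> a _ Eo; rewrite Eo in eo.
- move=> a c Ei Eo; move: eo; rewrite Eo inE => /eqP <- *.
  by apply: (@UCont d e a) => //; [apply: ta | move=> a'; apply: ui].
- move=> a b c dir x y Ei Po ne sa sb sc Eb Ec Ea.
  have B : brdata d a b c dir x y by split; rewrite ?(ta _ Ei).
  move: eo; rewrite (perm_mem Po) !inE => /orP[] /eqP Q; subst.
    exact: (@UBranch d b a c dir x y (ta _ Ei) B).
  exact: (@UBranch d c a b _ y x (ta _ Ei) (brdata_sym B)).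
- move=> a b c Ei Po ne sa sb sc Ec.
  move: eo; rewrite (perm_mem Po) !inE => /orP[] /eqP Q; subst; first by rewrite sb in se.
  by apply: (@UCont d c a) => //; [apply: ta | move=> a'; apply: ui].
- move=> a b c Pi Eo ne spa Na spb sc E.
  move: eo; rewrite Eo inE => /eqP Q; subst.
  have tb : tgt b = src c by apply/eqP; rewrite -mi (perm_mem Pi) !inE eqxx orbT.
  apply: (@UCont d c b) => // a' /eqP; rewrite -mi (perm_mem Pi) !inE.
  by case/orP=> /eqP -> //; rewrite spa.
Qed.

Lemma top_exists r0 d e : valid r0 d -> exists e0 p, top d e0 /\ occ d e0 p e.
Proof.
move=> V; have [m le_m] := ubnP (rk (src e)); elim: m => // m IH in e le_m *.
have low a : tgt a = src e -> rk (src a) < m by move=> Q; have := Hrk a; rewrite Q; lia.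
case: (uviewP e V).
- by move=> T; exists e, [::]; split=> //; apply: occ0.
- move=> a se ta sa E _; have [e0 [p [T H]]] := IH a (low _ ta).
  by exists e0, p; split=> //; apply: occP H ta sa se E.
- move=> a c dir x y ta [_ _ _ [sa se _] [Ee _ Ea]].
  have [e0 [p [T H]]] := IH a (low _ ta).
  by exists e0, (rcons p dir); split=> //; apply: occB H ta sa se Ea Ee.
Qed.

Lemma topZ r0 d e0 : valid r0 d -> top d e0 -> tm d e0 = None -> st d e0.
Proof.
move=> V; rewrite /top; case E: (st d e0) => //= /eqP /(root_out V) [_].
by rewrite E => -[-> N] /N.
Qed.

Lemma rkmax v : rk v <= \max_w rk w.
Proof. exact: leq_bigmax. Qed.

Lemma walk r0 d e0 p a dir x y :
  valid r0 d -> occ d e0 p a -> tm d a = Some (bnode dir x y) ->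
  exists a' b c, occ d e0 p a' /\ brdata d a' b c dir x y.
Proof.
move=> V; have [m le_m] := ubnP (\max_w rk w - rk (tgt a)).
elim: m => // m IH in a le_m *; move=> H Ea.
case: (hviewP a V).
- by move=> j _ _; rewrite Ea; case: (dir).
- by move=> _; rewrite Ea.
- move=> c sa sc nc Ec _; apply: (IH c); last by rewrite Ec.
    by have := Hrk c; have := rkmax (tgt c); rewrite sc; lia.
  exact: occP H (esym sc) sa nc Ec.
- move=> b c dir' x' y' B; have inj k u w u' w' :
      @bnode n k u w = bnode k u' w' -> u = u' /\ w = w'.
    by case: k => -[-> ->].
  case: (eqVneq dir dir') => [Q|nd].
    subst dir'; exists a, b, c; split=> //; case: (B) => _ _ _ _ [_ _].
    by rewrite Ea => -[/inj [-> ->]].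
  have Q : dir = ~~ dir' by case: (dir) (dir') nd => -[].
  move: B Ea => /brdata_sym; rewrite -Q => B Ea.
  exists a, c, b; split=> //; case: (B) => _ _ _ _ [_ _].
  by rewrite Ea => -[/inj [-> ->]].
Qed.

Lemma descend r0 d e0 p s0 x :
  valid r0 d -> tm d e0 = Some s0 -> sub p s0 = Some x ->
  exists a, occ d e0 p a /\ tm d a = Some x.
Proof.
move=> V E0; elim/last_ind: p x => [|p dir IH] x.
  by case=> <-; exists e0; split=> //; apply: occ0.
move=> /sub_rcons_inv [y /IH [a [H Ea]]].
have [a' [b [c [H' [Ei Po ne [sa sb sc] [Eb Ec Ea']]]]]] := walk V H Ea.
have tb : tgt a' = src b.
  by apply/esym/eqP; rewrite -mem_oute (perm_mem Po) !inE eqxx.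
by exists b; split=> //; apply: occB H' tb sa sb Ea' Eb.
Qed.

Lemma branch_view r0 d a b dir x y :
  valid r0 d -> tgt a = src b -> ~~ sp d a -> ~~ st d b ->
  tm d a = Some (bnode dir x y) -> tm d b = Some x ->
  exists c, brdata d a b c dir x y.
Proof.
move=> V ta sa sb Ea Eb; case: (hviewP a V).
- by move=> j _ _; rewrite Ea; case: (dir).
- by rewrite (negbTE sa).
- move=> c _ _ _ Ec uc; move: Ec; rewrite -(uc b) // Ea Eb => -[/esym/bnode_neq //].
- move=> b' c' dir' x' y' B; have [_ Po _ _ _] := B.
  have : b \in oute (tgt a) by rewrite mem_oute ta.
  rewrite (perm_mem Po) !inE => /orP[] /eqP Q; subst.
    exists c'; case: B => ? ? ? ? [Eb' Ec' Ea']; split=> //; split=> //.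
    rewrite Ec'; move: Ea' Eb'; rewrite Ea Eb => -[Q] [Q2]; subst x'.
    by move: Q; case: (dir) (dir') => -[] []; congruence.
  exists b'; case: (brdata_sym B) => ? ? ? ? [Eb' Ec' Ea']; split=> //; split=> //.
  rewrite Ec'; move: Ea' Eb'; rewrite Ea Eb => -[Q] [Q2]; subst y'.
  by move: Q; case: (dir) (dir') => -[] []; congruence.
Qed.

Lemma brdata_out d a b c dir x y : brdata d a b c dir x y -> tgt a = src b /\ tgt a = src c.
Proof.
by case=> _ Po _ _ _; split; apply/esym/eqP;
  rewrite -mem_oute (perm_mem Po) !inE eqxx ?orbT.
Qed.

Lemma occ_neq d e0 p a b : occ d e0 p a -> tgt a = src b -> e0 != b.
Proof.
move=> H Q; have := Hrk a; have := Hrk b; rewrite -Q => ? ?; apply/eqP => Q2.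
case: (occ_rk Hrk H) => [Q3|]; last by rewrite Q2; lia.
by move: Q; rewrite -Q3 Q2 => Q; have := Hrk b; rewrite Q; lia.
Qed.

Lemma cut_at r0 d e0 q a b c dir x y s0 :
  valid r0 d -> top d e0 -> occ d e0 q a -> brdata d a b c dir x y ->
  tm d e0 = Some s0 ->
  exists r1 ts1 d', [/\ valid r1 d',
     replace_comp (st d e0) r0 (starts d) s0 r1 ts1 (rep q s0 y),
     perm_eq (starts d') (x :: ts1),
     st d' b
   & sp d' = sp d /\ forall f, rk (tgt a) <= rk (src f) ->
       tm d' f = tm d f /\ (f <> b -> st d' f = st d f)].
Proof.
move=> V T H B E0; have [tb tc] := brdata_out B.
case: B => Ei Po ne [sa sb sc] [Eb Ec Ea].
have [||tm' [Ea' Ee0 ch1 ch2 V']] := replace_top V T H (Y := Some y); try by right.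
have ab : b <> a by move=> Q; have := Hrk b; rewrite -tb Q; lia.
have ac : c <> a by move=> Q; have := Hrk c; rewrite -tc Q; lia.
have Eb' : tm' b = Some x by rewrite ch2 // tb; have := Hrk b; lia.
have Ec' : tm' c = Some y by rewrite ch2 // tc; have := Hrk c; lia.
have e0b := occ_neq H tb.
pose d' := Deco tm' (upd (st d) b true) (sp d).
rewrite E0 orep_Some in Ee0.
have V1 : valid (if st d e0 then r0 else tm' e0) d'.
  move=> v; case: (eqVneq v (tgt a)) => [->|/eqP nv].
    apply/okatP; apply: (@VPass n _ G _ _ a b c) => //=; rewrite /upd ?eqxx //.
      by rewrite eq_sym (negbTE ne).
    by rewrite Ec' Ea'.
  apply: okat_eq (V' v nv) => e //= Q; split; auto; rewrite /upd.
  by case: eqP => // Q2; case: nv; rewrite -Q Q2 tb.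
have [||R [P1 P2]] := @starts_local n G d d' [:: e0; b].
- by rewrite /= inE e0b.
- move=> e; rewrite !inE negb_or => /andP[/eqP n1 n2]; rewrite /start_term /= /upd (negbTE n2).
  by case: ifP => // se; rewrite ch1.
have g0b : start_term d b = None by rewrite /start_term (negbTE sb).
have g1b : start_term d' b = Some x by rewrite /start_term /= /upd eqxx Eb'.
have g0 : start_term d e0 = if st d e0 then Some s0 else None by rewrite /start_term E0.
have g1 : start_term d' e0 = if st d e0 then Some (rep q s0 y) else None.
  by rewrite /start_term /= /upd (negbTE e0b) Ee0.
move: P1 P2; rewrite /= g0b g1b g0 g1 => P1 P2.
exists (if st d e0 then r0 else tm' e0), (if st d e0 then rep q s0 y :: R else R), d'.
split=> //.
- rewrite /replace_comp; case: ifP P1 P2 => st0 /= P1 P2; first by exists R.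
  have := root_out V _; move: T; rewrite /top st0 /= => /eqP Q /(_ _ Q) [_].
  rewrite st0 => -[Q2 _]; split=> //; first by rewrite -Q2.
  by rewrite perm_sym.
- by case: ifP P2 => _ //= P2; apply: perm_trans P2 (perm_swap _ _ _).
- by rewrite /= /upd eqxx.
- split=> // f rf; split.
    rewrite /= ch2 //; last by have := Hrk f; lia.
    by move=> Q; move: rf; rewrite Q; have := Hrk a; lia.
  by rewrite /= /upd => /eqP /negbTE ->.
Qed.

Lemma merge_at r0 d e0 p a g c s t s0 :
  valid r0 d -> top d e0 -> occ d e0 p a ->
  ine (tgt a) = [:: a] -> perm_eq (oute (tgt a)) [:: g; c] -> g != c ->
  ~~ sp d a -> st d g -> ~~ st d c -> tm d c = tm d a ->
  tm d g = Some t -> tm d a = Some s -> tm d e0 = Some s0 ->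
  exists r1 ts0 ts1 d', [/\ valid r1 d', perm_eq (starts d) (t :: ts0),
     replace_comp (st d e0) r0 ts0 s0 r1 ts1 (rep p s0 (BNode s t))
   & perm_eq (starts d') ts1].
Proof.
move=> V T H Ei Po ne sa sg sc Ec Eg Ea E0.
have tg : tgt a = src g by apply/esym/eqP; rewrite -mem_oute (perm_mem Po) !inE eqxx.
have tc : tgt a = src c by apply/esym/eqP; rewrite -mem_oute (perm_mem Po) !inE eqxx orbT.
have [||tm' [Ea' Ee0 ch1 ch2 V']] := replace_top V T H (Y := Some (BNode s t)); try by right.
have ag : g <> a by move=> Q; have := Hrk g; rewrite -tg Q; lia.
have ac : c <> a by move=> Q; have := Hrk c; rewrite -tc Q; lia.
have Eg' : tm' g = Some t by rewrite ch2 // tg; have := Hrk g; lia.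
have Ec' : tm' c = Some s by rewrite ch2 // ?Ec // tc; have := Hrk c; lia.
have e0g := occ_neq H tg.
pose d' := Deco tm' (upd (st d) g false) (sp d).
rewrite E0 orep_Some in Ee0.
have V1 : valid (if st d e0 then r0 else tm' e0) d'.
  move=> v; case: (eqVneq v (tgt a)) => [->|/eqP nv].
    apply/okatP; apply: (@VBranch n _ G _ _ a c g false s t) => //=; rewrite /upd ?eqxx //.
    + by rewrite (perm_trans Po) // (perm_catC [:: g] [:: c]).
    + by rewrite eq_sym.
    + by case: eqP.
  apply: okat_eq (V' v nv) => e //= Q; split; auto; rewrite /upd.
  by case: eqP => // Q2; case: nv; rewrite -Q Q2 tg.
have [||R [P1 P2]] := @starts_local n G d d' [:: g; e0].
- by rewrite /= inE eq_sym e0g.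
- move=> e; rewrite !inE negb_or => /andP[n2 /eqP n1]; rewrite /start_term /= /upd (negbTE n2).
  by case: ifP => // se; rewrite ch1.
have g0b : start_term d g = Some t by rewrite /start_term sg.
have g1b : start_term d' g = None by rewrite /start_term /= /upd eqxx.
have g0 : start_term d e0 = if st d e0 then Some s0 else None by rewrite /start_term E0.
have g1 : start_term d' e0 = if st d e0 then Some (rep p s0 (BNode s t)) else None.
  by rewrite /start_term /= /upd (negbTE e0g) Ee0.
move: P1 P2; rewrite /= g0b g1b g0 g1 => P1 P2.
exists (if st d e0 then r0 else tm' e0), (if st d e0 then s0 :: R else R), (starts d'), d'.
split=> //.
- by case: ifP P1 => _ /=.
- rewrite /replace_comp; case: ifP P1 P2 => st0 /= P1 P2; first by exists R.
  have := root_out V _; move: T; rewrite /top st0 /= => /eqP Q /(_ _ Q) [_].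
  by rewrite st0 => -[Q2 _]; split=> //; rewrite -Q2.
Qed.

Lemma swap_at r0 d e0 a g c :
  valid r0 d -> st d e0 -> occ d e0 [::] a ->
  ine (tgt a) = [:: a] -> perm_eq (oute (tgt a)) [:: g; c] -> g != c ->
  ~~ sp d a -> st d g -> ~~ st d c -> tm d c = tm d a ->
  exists d', [/\ valid r0 d', perm_eq (starts d') (starts d), st d' c, sp d' = sp d
    & tm d' e0 = tm d g /\ st d' e0].
Proof.
move=> V s0 H Ei Po ne sa sg sc Ec.
have tg : tgt a = src g by apply/esym/eqP; rewrite -mem_oute (perm_mem Po) !inE eqxx.
have tc : tgt a = src c by apply/esym/eqP; rewrite -mem_oute (perm_mem Po) !inE eqxx orbT.
have T : top d e0 by rewrite /top s0.
have [||tm' [Ea' Ee0 ch1 ch2 V']] := replace_top V T H (Y := tm d g); try by left.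
rewrite s0 in V'; have E0 := occ_sub H; rewrite /= in E0 Ee0.
have ag : g <> a by move=> Q; have := Hrk g; rewrite -tg Q; lia.
have ac : c <> a by move=> Q; have := Hrk c; rewrite -tc Q; lia.
have Eg' : tm' g = tm d g by rewrite ch2 // tg; have := Hrk g; lia.
have Ec' : tm' c = tm d a by rewrite ch2 // ?Ec // tc; have := Hrk c; lia.
have e0g := occ_neq H tg; have e0c := occ_neq H tc.
pose d' := Deco tm' (upd (upd (st d) g false) c true) (sp d).
exists d'; split=> //; try by rewrite /= /upd ?eqxx ?(negbTE e0g) ?(negbTE e0c).
- move=> v; case: (eqVneq v (tgt a)) => [->|/eqP nv].
    apply/okatP; apply: (@VPass n _ G _ _ a c g) => //=; rewrite /upd ?eqxx ?(negbTE ne) //.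
    + by rewrite (perm_trans Po) // (perm_catC [:: g] [:: c]).
    + by rewrite eq_sym.
    + by rewrite Eg' Ea'.
  apply: okat_eq (V' v nv) => e //= Q; split; auto; rewrite /upd.
  case: eqP => [Q2|_]; first by case: nv; rewrite -Q Q2 tc.
  by case: eqP => // Q2; case: nv; rewrite -Q Q2 tg.
have [||R [P1 P2]] := @starts_local n G d d' [:: g; e0; c].
- by rewrite /= !inE eq_sym negb_or e0g ne e0c.
- move=> e; rewrite !inE !negb_or => /and3P[n2 /eqP n1 n3].
  rewrite /start_term /= /upd (negbTE n2) (negbTE n3).
  by case: ifP => // se; rewrite ch1.
have g0 : start_term d g = tm d g by rewrite /start_term sg.
have g1 : start_term d e0 = tm d a by rewrite /start_term s0.
have g2 : start_term d c = None by rewrite /start_term (negbTE sc).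
have h0 : start_term d' g = None by rewrite /start_term /= /upd (negbTE ne) eqxx.
have h1 : start_term d' e0 = tm d g by rewrite /start_term /= /upd (negbTE e0g) (negbTE e0c) s0.
have h2 : start_term d' c = tm d a by rewrite /start_term /= /upd eqxx.
move: P1 P2; rewrite /= g0 g1 g2 h0 h1 h2 perm_sym => P1 P2.
by apply: perm_trans P2 P1.
Qed.

Lemma detach_root r0 d b :
  valid r0 d -> ine (src b) = [::] -> ~~ st d b ->
  exists s, [/\ r0 = Some s, tm d b = Some s
   & let d' := Deco (tm d) (upd (st d) b true) (sp d) in
     valid None d' /\ perm_eq (starts d') (s :: starts d)].
Proof.
move=> V Ei nb; have [Eo] := root_out V Ei; rewrite (negbTE nb) => -[E0 N0].
case: r0 V E0 N0 => // s V E0 _; exists s; split=> //; split.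
- move=> v; case: (eqVneq v (src b)) => [->|nv].
    by apply/okatP; apply: (@VRoot n _ G _ _ b) => //=; rewrite /upd eqxx.
  have: okat None d v by apply: okat_r0 (V v) => Q; rewrite (Hroot Q Ei) eqxx in nv.
  apply: okat_eq => e //= Q; split; auto; rewrite /upd.
  by case: eqP => // Q2; rewrite -Q Q2 eqxx in nv.
- set d' := Deco _ _ _; have [||R [P1 P2]] := @starts_local n G d d' [:: b] => //.
    by move=> e; rewrite inE => n2; rewrite /start_term /= /upd (negbTE n2).
  have g0 : start_term d b = None by rewrite /start_term (negbTE nb).
  have g1 : start_term d' b = Some s by rewrite /start_term /= /upd eqxx E0.
  move: P1 P2; rewrite /= g0 g1 => P1 P2.
  by rewrite (perm_trans P2) // perm_cons perm_sym.
Qed.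

Lemma attach_root r0 d b t :
  valid r0 d -> ine (src b) = [::] -> st d b -> tm d b = Some t ->
  r0 = None /\ let d' := Deco (tm d) (upd (st d) b false) (sp d) in
     valid (Some t) d' /\ perm_eq (starts d) (t :: starts d').
Proof.
move=> V Ei nb E0; have [Eo] := root_out V Ei; rewrite nb => r0E.
split=> //; split.
- move=> v; case: (eqVneq v (src b)) => [->|nv].
    by apply/okatP; apply: (@VRoot n _ G _ _ b) => //=; rewrite /upd eqxx.
  have: okat (Some t) d v by apply: okat_r0 (V v) => Q; rewrite (Hroot Q Ei) eqxx in nv.
  apply: okat_eq => e //= Q; split; auto; rewrite /upd.
  by case: eqP => // Q2; rewrite -Q Q2 eqxx in nv.
- set d' := Deco _ _ _; have [||R [P1 P2]] := @starts_local n G d d' [:: b] => //.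
    by move=> e; rewrite inE => n2; rewrite /start_term /= /upd (negbTE n2).
  have g0 : start_term d b = Some t by rewrite /start_term nb.
  have g1 : start_term d' b = None by rewrite /start_term /= /upd eqxx.
  move: P1 P2; rewrite /= g0 g1 => P1 P2.
  by rewrite (perm_trans P1) // perm_cons perm_sym.
Qed.

Lemma occ_ext d d' e0 p a :
  occ d e0 p a ->
  (forall f, f = e0 \/ rk (tgt e0) <= rk (src f) ->
     [/\ tm d' f = tm d f, sp d' f = sp d f & f <> e0 -> st d' f = st d f]) ->
  occ d' e0 p a.
Proof.
move=> H E; have K := fun p a H => E a (match @occ_rk n G rk Hrk d e0 p a H with
  | or_introl Q => or_introl (esym Q) | or_intror Q => or_intror Q end).
elim: H => {p a} [|p a c H IH ta sa sc Ec|p a c dir x y H IH ta sa sc Ea Ec].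
- exact: occ0.
- have [Ka Ksa _] := K _ _ H; have [Kc _ Ksc] := K _ _ (occP H ta sa sc Ec).
  apply: (occP IH ta); rewrite ?Ksa ?Ksc ?Ka ?Kc //.
  by apply/eqP; rewrite eq_sym (occ_neq H ta).
- have [Ka Ksa _] := K _ _ H; have [Kc _ Ksc] := K _ _ (occB H ta sa sc Ea Ec).
  apply: (occB (dir := dir) (x := x) (y := y) IH ta); rewrite ?Ksa ?Ksc ?Ka ?Kc //.
  by apply/eqP; rewrite eq_sym (occ_neq H ta).
Qed.

Lemma occ_split d e0 p a : occ d e0 p a -> p = [::] \/
  exists q a1 b dir x y, [/\ occ d e0 q a1, tgt a1 = src b,
    ~~ sp d a1 /\ ~~ st d b, tm d a1 = Some (bnode dir x y) /\ tm d b = Some x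
  & occ d b [::] a].
Proof.
elim=> {p a} [|p a c H IH ta sa sc Ec|p a c dir x y H IH ta sa sc Ea Ec]; first by left.
- case: IH => [->|[q [a1 [b [dir [x [y [H1 ? ? ? H2]]]]]]]]; first by left.
  right; exists q, a1, b, dir, x, y; split=> //.
  exact: occP H2 ta sa sc Ec.
- right; exists p, a, c, dir, x, y; split=> //; exact: occ0.
Qed.

End Moves.

Section Cut.
Variable n : nat.
Local Notation lgr := (lgraph (label n)).
Local Notation bt := (bt n).

Definition real (G : lgr) (r0 : option bt) (ts : seq bt) :=
  exists d : deco G, valid r0 d /\ perm_eq (starts d) ts.

(* The three effects of detaching an edge: none, isolating T_rho, or cutting off
   a subterm x of a component s0. *)
Definition cutrel (r0 : option bt) (ts : seq bt) (r1 : option bt) (ts' : seq bt) :=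
  [\/ r0 = r1 /\ perm_eq ts' ts,
      exists s, [/\ r0 = Some s, r1 = None & perm_eq ts' (s :: ts)]
    | exists k s0 q x y dir ts1, [/\ sub q s0 = Some (bnode dir x y),
        replace_comp k r0 ts s0 r1 ts1 (rep q s0 y) & perm_eq ts' (x :: ts1)]].

Lemma replace_comp_det k (r : option bt) ts ts' (s s1 : bt) r1 ts1 r1' ts1' :
  replace_comp k r ts s r1 ts1 s1 -> replace_comp k r ts' s r1' ts1' s1 -> perm_eq ts ts' ->
  r1 = r1' /\ perm_eq ts1 ts1'.
Proof.
rewrite /replace_comp; case: k => [[R [-> P Q]] [R' [-> P' Q']] PP|[_ -> P] [_ -> P'] PP]; split=> //.
  have : perm_eq (s :: R) (s :: R').
    by rewrite perm_sym in P; rewrite (perm_trans P) // (perm_trans PP).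
  rewrite perm_cons => RR; rewrite (perm_trans Q) // perm_sym (perm_trans Q') //.
  by rewrite perm_cons perm_sym.
by rewrite (perm_trans P) // (perm_trans PP) // perm_sym.
Qed.

Lemma replace_comp_size k (r : option bt) ts (s s1 : bt) r1 ts1 :
  replace_comp k r ts s r1 ts1 s1 -> size ts1 = size ts.
Proof.
by rewrite /replace_comp; case: k => [[R [_ /perm_size -> /perm_size ->]]//|[_ _ /perm_size]].
Qed.

Lemma cutrel_size r0 ts r1 ts' : cutrel r0 ts r1 ts' -> size ts' <= (size ts).+1.
Proof.
case=> [[_ /perm_size ->]//|[s [_ _ /perm_size ->]]//|].
move=> [k [s0 [q [x [y [dir [ts1 [_ C /perm_size ->]]]]]]]] /=.
by rewrite (replace_comp_size C).
Qed.

Variables (G : lgr) (rk : vertex G -> nat).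
Hypothesis Hrk : forall e : edge G, rk (src e) < rk (tgt e).
Hypothesis Hroot : forall v w : vertex G, ine v = [::] -> ine w = [::] -> v = w.

Hypothesis Hre : exists e : edge G, ine (src e) = [::].

Lemma cutrel_real r0 ts r1 ts' :
  real G r0 ts -> cutrel r0 ts r1 ts' -> real G r1 ts'.
Proof.
case=> d [V P]; case=> [[<- Q]|[s [E0 -> Q]]|].
- by exists d; split=> //; rewrite (perm_trans P) // perm_sym.
- case: Hre => b Hb; have nb : ~~ st d b.
    by apply/negP => sb; have [_] := root_out V Hb; rewrite sb E0.
  have [s' [E1 Eb [V' P']]] := detach_root Hroot V Hb nb.
  eexists; split; first exact: V'.
  rewrite (perm_trans P') // perm_sym (perm_trans Q) //.
  by move: E1; rewrite E0 => -[->]; rewrite perm_cons perm_sym.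
move=> [k [s0 [q [x [y [dir [ts1 [E C Q]]]]]]]].
have [e0 [T E0 k0]] : exists e0, [/\ top d e0, tm d e0 = Some s0 & st d e0 = k].
  move: C; rewrite /replace_comp; case: k => [[R [_ Q1 _]]|[rE _ _]].
    have : s0 \in starts d by rewrite (perm_mem P) (perm_mem Q1) inE eqxx.
    by case/mem_starts=> e0 [se Ee]; exists e0; rewrite /top se.
  case: Hre => b Hb; exists b; have [_] := root_out V Hb; rewrite /top Hb rE orbT.
  by case: ifP => // _ [].
have [a [Ha Ea]] := descend Hrk V E0 E.
have [a' [b [c [H B]]]] := walk Hrk V Ha Ea.
have [r1' [ts1' [d' [V' C' P' _ _]]]] := cut_at Hrk Hroot V T H B E0.
rewrite k0 in C'; have [Er Pt] := replace_comp_det C' C P.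
exists d'; split; first by rewrite -Er.
by rewrite (perm_trans P') // perm_sym (perm_trans Q) // perm_cons perm_sym.
Qed.

Lemma make_start r0 (d : deco G) e :
  valid r0 d -> size (ine (src e)) = 1 -> size (oute (src e)) = 2 ->
  exists r1 (d' : deco G), [/\ valid r1 d', cutrel r0 (starts d) r1 (starts d') & st d' e].
Proof.
move=> V si so; case se: (st d e).
  by exists r0, d; split=> //; apply: Or31.
have eo : e \in oute (src e) by rewrite mem_oute.
have mi f : (f \in ine (src e)) = (tgt f == src e) by rewrite mem_ine.
have tops a : tgt a = src e -> exists e0 p, top d e0 /\ occ d e0 p a.
  by move=> _; apply: (top_exists Hrk a V).
have cutcase a c dir x y : tgt a = src e -> brdata d a e c dir x y ->
    exists r1 (d' : deco G), [/\ valid r1 d', cutrel r0 (starts d) r1 (starts d') & st d' e].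
  move=> ta B; have [e0 [p [T H]]] := tops _ ta.
  have [_ _ _ _ [_ _ Ea]] := B.
  have := occ_sub H; rewrite Ea; case E0: (tm d e0) => [s0|]; last by case: (p).
  rewrite osub_Some => Es.
  have [r1 [ts1 [d' [V' C P' s' _]]]] := cut_at Hrk Hroot V T H B E0.
  exists r1, d'; split=> //; apply: Or33.
  by exists (st d e0), s0, p, x, y, dir, ts1.
case/okatP: (V (src e)).
- by move=> b Ei; rewrite Ei in si.
- by move=> a j _ Eo; rewrite Eo in so.
- by move=> a _ Eo; rewrite Eo in so.
- by move=> a c _ Eo; rewrite Eo in so.
- move=> a b c dir x y Ei Po ne sa sb sc Eb Ec Ea.
  have ta : tgt a = src e by apply/eqP; rewrite -mi Ei inE.
  have B : brdata d a b c dir x y by split; rewrite ?ta.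
  move: eo; rewrite (perm_mem Po) !inE => /orP[] /eqP Q; subst.
    exact: cutcase ta B.
  exact: cutcase ta (brdata_sym B).
- move=> a g c Ei Po ne sa sg sc Ec.
  have ta : tgt a = src e by apply/eqP; rewrite -mi Ei inE.
  move: eo; rewrite (perm_mem Po) !inE => /orP[] /eqP Q; subst; first by rewrite sg in se.
  have [e0 [p [T H]]] := tops _ ta; rewrite -ta in Ei Po.
  have sg' : src g = src c.
    by apply/eqP; rewrite -mem_oute -ta (perm_mem Po) !inE eqxx.
  case: (occ_split H) => [p0|[q [a1 [b [dir [x [y [H1 ta1 [sa1 sb] [Ea1 Eb] H2]]]]]]]].
    subst p; case s0: (st d e0).
      have [d' [V' P' s' _ _]] := swap_at Hrk Hroot V s0 H Ei Po ne sa sg sc Ec.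
      by exists r0, d'; split=> //; apply: Or31.
    move: (T); rewrite /top s0 /= => /eqP Hb.
    have [s [E1 Eb]] := detach_root Hroot V Hb (negbT s0); set d1 := Deco _ _ _ => -[V1 P1].
    have e0c : c == e0 = false by apply/negbTE; rewrite eq_sym (occ_neq Hrk H ta).
    have e0g : g == e0 = false.
      by apply/negbTE; rewrite eq_sym (occ_neq Hrk H) // ta sg'.
    have H1 : occ d1 e0 [::] a.
      apply: (occ_ext Hrk H) => f _; split=> //= /eqP nf.
      by rewrite /upd (negbTE nf).
    have [|||d' [V' P' s' _]] := swap_at Hrk Hroot V1 _ H1 Ei Po ne sa _ _ Ec; rewrite /= /upd ?eqxx ?e0g ?e0c //.
    exists None, d'; split=> //; apply: Or32; exists s; split=> //.
    exact: perm_trans P' P1.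
  have [c1 B] := branch_view V ta1 sa1 sb Ea1 Eb.
  have := occ_sub H1; rewrite Ea1; case E0: (tm d e0) => [s0|]; last by case: (q).
  rewrite osub_Some => Es.
  have [r1 [ts1 [d1 [V1 C P1 sb1 [sp1 same]]]]] := cut_at Hrk Hroot V T H1 B E0.
  have rb : rk (src b) < rk (src c).
    rewrite -ta; have := Hrk b; case: (occ_rk Hrk H2) => [->|]; have := Hrk a; lia.
  have H3 : occ d1 b [::] a.
    apply: (occ_ext Hrk H2) => f Hf; rewrite sp1.
    have [] := same f; last by split.
    by rewrite ta1; case: Hf => [->//|]; have := Hrk b; lia.
  have rg f : src f = src c -> tm d1 f = tm d f /\ st d1 f = st d f.
    move=> Q; have [|-> ->] := same f; rewrite ?ta1 ?Q //; first lia.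
    by move=> Q2; rewrite -Q Q2 ltnn in rb.
  have rga : tm d1 a = tm d a.
    have [] := same a => //; rewrite ta1; case: (occ_rk Hrk H2) => [->//|].
    by have := Hrk b; lia.
  have [gm gs] := rg g sg'; have [cm cs] := rg c erefl.
  have [||||d' [V' P' s' _]] := swap_at Hrk Hroot V1 sb1 H3 Ei Po ne; rewrite ?sp1 ?gs ?cs ?cm ?rga //.
  exists r1, d'; split=> //; apply: Or33.
  exists (st d e0), s0, q, x, y, dir, ts1; split=> //; exact: perm_trans P' P1.
- by move=> a b c _ Eo; rewrite Eo in so.
Qed.

Lemma swap_stop r0 (d : deco G) e :
  valid r0 d -> sp d e -> size (ine (src e)) = 1 -> size (oute (src e)) = 2 ->
  exists d' : deco G, [/\ valid r0 d', perm_eq (starts d') (starts d), st d' e & sp d' = sp d].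
Proof.
move=> V spe si so; case se: (st d e); first by exists d.
have Ze : tm d e = None.
  by case: (hviewP e V) => // [j|c|b c dir x y [_ _ _ []]]; rewrite spe.
have eo : e \in oute (src e) by rewrite mem_oute.
case/okatP: (V (src e)).
- by move=> b Ei; rewrite Ei in si.
- by move=> a j _ Eo; rewrite Eo in so.
- by move=> a _ Eo; rewrite Eo in so.
- by move=> a c _ Eo; rewrite Eo in so.
- move=> a b c dir x y Ei Po ne sa sb sc Eb Ec Ea.
  by move: eo; rewrite (perm_mem Po) !inE => /orP[] /eqP Q; subst; congruence.
- move=> a g c Ei Po ne sa sg sc Ec.
  have ta : tgt a = src e by apply/eqP; rewrite -mem_ine Ei inE.
  move: eo; rewrite (perm_mem Po) !inE => /orP[] /eqP Q; subst; first by rewrite sg in se.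
  have [e0 [p [T H]]] := top_exists Hrk a V; rewrite -ta in Ei Po.
  have Na : tm d a = None by rewrite -Ec.
  have p0 := occ_nil Na H; subst p.
  have s0 : st d e0 by apply: (topZ V T); have /= -> := occ_sub H.
  have [d' [? ? ? ? _]] := swap_at Hrk Hroot V s0 H Ei Po ne sa sg sc Ec.
  by exists d'.
- by move=> a b c _ Eo; rewrite Eo in so.
Qed.

Lemma swap_ret r0 (d : deco G) e :
  valid r0 d -> st d e -> size (ine (tgt e)) = 2 ->
  exists d' : deco G, [/\ valid r0 d', perm_eq (starts d') (starts d), st d' e, sp d' e & tm d' e = None].
Proof.
move=> V se si; case spe: (sp d e).
  exists d; split=> //.
  by case: (hviewP e V) => // [j|c|b c dir x y [_ _ _ []]]; rewrite spe.
have ei : e \in ine (tgt e) by rewrite mem_ine.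
case/okatP: (V (tgt e)); try by move=> ? ? Ei; rewrite Ei in si.
- by move=> b Ei; rewrite Ei in si.
- by move=> a Ei; rewrite Ei in si.
- by move=> a b c dir x y Ei; rewrite Ei in si.
- by move=> a b c Ei; rewrite Ei in si.
- move=> a b c Pi Eo ne spa Na spb sc Ec.
  move: ei; rewrite (perm_mem Pi) !inE => /orP[] /eqP Q; subst; first by rewrite spa in spe.
  have ta : tgt a = tgt b by apply/eqP; rewrite -mem_ine (perm_mem Pi) inE eqxx.
  have tc : src c = tgt b by apply/eqP; rewrite -mem_oute Eo inE.
  have [e0 [p [T H]]] := top_exists Hrk a V.
  have p0 := occ_nil Na H; subst p.
  have s0 : st d e0 by apply: (topZ V T); have /= -> := occ_sub H.
  have [||tm' [Ea' Ee0 ch1 ch2 V']] := replace_top Hrk Hroot V T H (Y := tm d b); try by left.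
  rewrite s0 in V'; have E0 := occ_sub H; rewrite /= in E0 Ee0.
  have ab : (a == b) = false by apply/negbTE.
  have e0b : (e0 == b) = false.
    apply/eqP => Q; case: (occ_rk Hrk H) => [Q2|]; first by rewrite -Q Q2 eqxx in ab.
    by rewrite Q -ta; have := Hrk a; lia.
  have cb : (c == b) = false.
    by apply/eqP => Q; have := Hrk b; rewrite -tc Q; lia.
  have Ec' : tm' c = tm d b.
    have rc := Hrk c; rewrite ch2 ?Ec //; last by rewrite ta -tc; lia.
    by move=> Q; have := Hrk a; rewrite ta -tc Q; lia.
  pose d' := Deco (upd tm' b None) (st d) (upd (upd (sp d) a false) b true).
  exists d'; split=> //; try by rewrite /= /upd eqxx.
  + move=> v; case: (eqVneq v (tgt b)) => [->|/eqP nv].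
      apply/okatP; apply: (@VRet n _ G _ _ b a c) => //=; rewrite /upd ?eqxx ?ab ?cb ?Ea' ?Ec' //.
      * by rewrite (perm_trans Pi) // (perm_catC [:: a] [:: b]).
      * by rewrite eq_sym ab.
    apply: okat_eq (V' v _) => [e /= Q|e /= Q|]; last by rewrite ta.
      have eb : (e == b) = false by apply/eqP => Q2; case: nv; rewrite -Q Q2.
      have ea : (e == a) = false by apply/eqP => Q2; case: nv; rewrite -Q Q2.
      by rewrite /upd eb ea.
    by split=> //; rewrite /upd; case: (eqVneq e b) => [->|_]; auto.
  have [||R [P1 P2]] := @starts_local n G d d' [:: e0; b].
  - by rewrite /= inE e0b.
  - move=> e; rewrite !inE negb_or => /andP[/eqP n1 n2]; rewrite /start_term /= /upd (negbTE n2).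
    by case: ifP => // se'; rewrite ch1.
  have g0 : start_term d e0 = None by rewrite /start_term s0 E0.
  have g1 : start_term d b = tm d b by rewrite /start_term se.
  have h0 : start_term d' e0 = tm d b by rewrite /start_term /= /upd e0b s0.
  have h1 : start_term d' b = None by rewrite /start_term /= /upd eqxx se.
  move: P1 P2; rewrite /= g0 g1 h0 h1 perm_sym => P1 P2.
  by apply: perm_trans P2 P1.
Qed.

End Cut.

(** * Subdivisions, grafts and isomorphisms *)

Lemma fin_bij (A B : finType) (f : A -> B) :
  injective f -> (forall y, exists x, f x = y) -> bijective f.
Proof.
move=> fI fS; apply: inj_card_bij fI _.
have sub : {subset B <= codom f} by move=> y _; have [x <-] := fS y; apply: codom_f.
by rewrite -(size_codom f) (leq_trans (subset_leq_card _) (card_size _)) //; apply/subsetP.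
Qed.

Lemma perm_enum_option (T : finType) : perm_eq (enum {: option T}) (None :: map Some (enum T)).
Proof.
apply: uniq_perm; rewrite ?enum_uniq //=.
  rewrite map_inj_uniq ?enum_uniq ?andbT; last by move=> ? ? [].
  by apply/mapP => -[].
move=> [x|]; rewrite mem_enum !inE //=.
by rewrite mem_map ?mem_enum // => ? ? [].
Qed.

Section Graphs.
Variable n : nat.
Local Notation lgr := (lgraph (label n)).
Local Notation bt := (bt n).
Implicit Types G H P : lgr.

Definition iso_maps G H (fV : vertex G -> vertex H) (fE : edge G -> edge H) :=
  [/\ bijective fV, bijective fE, forall e, src (fE e) = fV (src e),
      forall e, tgt (fE e) = fV (tgt e) & forall v, lab (fV v) = lab v].

Lemma iso_refl G : isomorphic G G.
Proof. by exists id, id; split=> //; exists id. Qed.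

Lemma iso_maps_comp G H K fV fE gV gE :
  @iso_maps G H fV fE -> @iso_maps H K gV gE -> iso_maps (gV \o fV) (gE \o fE).
Proof.
move=> [a b c d e] [a' b' c' d' e']; split; rewrite /=.
- exact: bij_comp.
- exact: bij_comp.
- by move=> x; rewrite c' c.
- by move=> x; rewrite d' d.
- by move=> x; rewrite e' e.
Qed.

Lemma iso_maps_inv G H fV fE : @iso_maps G H fV fE ->
  exists gV gE, [/\ iso_maps gV gE, cancel fV gV, cancel gV fV, cancel fE gE & cancel gE fE].
Proof.
move=> [[gV fgV gfV] [gE fgE gfE] Hs Ht Hl]; exists gV, gE; split=> //; split.
- by exists fV.
- by exists fE.
- by move=> e; apply: (can_inj fgV); rewrite gfV -Hs gfE.
- by move=> e; apply: (can_inj fgV); rewrite gfV -Ht gfE.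
- by move=> v; rewrite -Hl gfV.
Qed.

Lemma iso_trans G H K : isomorphic G H -> isomorphic H K -> isomorphic G K.
Proof.
move=> [fV [fE I]] [gV [gE J]]; exists (gV \o fV), (gE \o fE); exact: iso_maps_comp I J.
Qed.

Lemma iso_sym G H : isomorphic G H -> isomorphic H G.
Proof. by move=> [fV [fE /iso_maps_inv [gV [gE [I _ _ _ _]]]]]; exists gV, gE. Qed.

Lemma iso_ine G H fV fE v : @iso_maps G H fV fE -> perm_eq (ine (fV v)) (map fE (ine v)).
Proof.
move=> [/bij_inj fVI fEB Hs Ht Hl]; have fEI := bij_inj fEB.
apply: uniq_perm; rewrite ?map_inj_uniq ?uniq_ine // => e.
have [gE fg gf] := fEB; rewrite -(gf e) mem_map // !mem_ine Ht.
exact: inj_eq.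
Qed.

Lemma iso_oute G H fV fE v : @iso_maps G H fV fE -> perm_eq (oute (fV v)) (map fE (oute v)).
Proof.
move=> [/bij_inj fVI fEB Hs Ht Hl]; have fEI := bij_inj fEB.
apply: uniq_perm; rewrite ?map_inj_uniq ?uniq_oute // => e.
have [gE fg gf] := fEB; rewrite -(gf e) mem_map // !mem_oute Hs.
exact: inj_eq.
Qed.

Definition pull G H (fE : edge G -> edge H) (d : deco H) : deco G :=
  Deco (tm d \o fE) (st d \o fE) (sp d \o fE).

Lemma pull_valid r0 G H fV fE (d : deco H) : @iso_maps G H fV fE -> valid r0 d ->
  valid r0 (pull fE d) /\ perm_eq (starts (pull fE d)) (starts d).
Proof.
move=> I V; have [_ bE _ _ Il] := I; split.
- move=> v; rewrite /okat -Il; apply: ok_perm (V (fV v)).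
    by apply: perm_trans (perm_map _ (iso_ine _ I)) _; rewrite -map_comp.
  by apply: perm_trans (perm_map _ (iso_oute _ I)) _; rewrite -map_comp.
- have [gE fgE gfE] := bE; have fEI := bij_inj bE; rewrite /starts.
  have PE : perm_eq (map fE (enum (edge G))) (enum (edge H)).
    apply: uniq_perm; [by rewrite (map_inj_uniq fEI); apply: enum_uniq|exact: enum_uniq|].
    by move=> e; rewrite -(gfE e) mem_map ?mem_enum.
  rewrite -(permPr (perm_pmap (start_term d) PE)).
  have -> // : forall s, pmap (start_term (pull fE d)) s = pmap (start_term d) (map fE s).
  by elim=> //= e s ->.
Qed.

Lemma real_iso G H r0 ts : isomorphic G H -> real G r0 ts -> real H r0 ts.
Proof.
move=> /iso_sym [fV [fE I]] [d [V P]]; have [V' P'] := pull_valid I V.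
by exists (pull fE d); split=> //; apply: perm_trans P' P.
Qed.

Definition theta G (f e : edge G) : option (edge G) := if e == f then None else Some e.

Lemma theta_inj G (f : edge G) : injective (theta f).
Proof.
by move=> x y; rewrite /theta; case: (x =P f) => [->|_]; case: (y =P f) => [->|_] // [].
Qed.

Lemma sub_ineS G (f : edge G) x :
  perm_eq (ine (Some x : vertex (subdivide f))) (map (theta f) (ine x)).
Proof.
apply: uniq_perm; rewrite ?map_inj_uniq ?uniq_ine //; try exact: theta_inj.
move=> e; rewrite mem_ine; apply/idP/mapP.
- case: e => [e|] /=.
    case: (eqVneq e f) => // ne /eqP [Q]; exists e; first by rewrite mem_ine Q.
    by rewrite /theta (negbTE ne).
  by move/eqP=> [Q]; exists f; rewrite ?mem_ine ?Q // /theta eqxx.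
- case=> e' Hx ->; move: Hx; rewrite mem_ine /theta => /eqP <-.
  by case: (e' =P f) => [->|/eqP /negbTE ne] //=; rewrite ?ne.
Qed.

Lemma sub_outeS G (f : edge G) x :
  perm_eq (oute (Some x : vertex (subdivide f))) (map Some (oute x)).
Proof.
apply: uniq_perm; rewrite ?map_inj_uniq ?uniq_oute //; try by move=> ? ? [].
case=> [e|]; rewrite mem_oute /=.
  by rewrite mem_map ?mem_oute // => ? ? [].
by apply/esym/negbTE/mapP => -[].
Qed.

Lemma sub_ineN G (f : edge G) : ine (None : vertex (subdivide f)) = [:: Some f].
Proof.
apply: perm1; rewrite perm_sym; apply: uniq_perm; rewrite ?uniq_ine //.
by case=> [e|]; rewrite mem_ine inE //= [RHS](inj_eq (@Some_inj _)); case: (e == f).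
Qed.

Lemma sub_outeN G (f : edge G) : oute (None : vertex (subdivide f)) = [:: None].
Proof.
apply: perm1; rewrite perm_sym; apply: uniq_perm; rewrite ?uniq_oute //.
by case=> [e|]; rewrite mem_oute inE.
Qed.

Lemma add_ine G (x y v : vertex G) :
  perm_eq (ine (v : vertex (add_edge x y)))
          ((if v == y then [:: None] else [::]) ++ map Some (ine v)).
Proof.
apply: uniq_perm; rewrite ?uniq_ine //.
  rewrite cat_uniq map_inj_uniq ?uniq_ine ?andbT; last by move=> ? ? [].
  by case: eqP => //= _; rewrite -all_predC; apply/allP => ? /mapP [? _ ->].
case=> [e|]; rewrite mem_ine mem_cat /=.
  by rewrite mem_map ?mem_ine; [case: (v == y) | move=> ? ? []].
rewrite (_ : (None \in map _ _) = false) ?orbF; last by apply/negbTE/mapP => -[].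
by rewrite eq_sym; case: ifP.
Qed.

Lemma add_oute G (x y v : vertex G) :
  perm_eq (oute (v : vertex (add_edge x y)))
          ((if v == x then [:: None] else [::]) ++ map Some (oute v)).
Proof.
apply: uniq_perm; rewrite ?uniq_oute //.
  rewrite cat_uniq map_inj_uniq ?uniq_oute ?andbT; last by move=> ? ? [].
  by case: eqP => //= _; rewrite -all_predC; apply/allP => ? /mapP [? _ ->].
case=> [e|]; rewrite mem_oute mem_cat /=.
  by rewrite mem_map ?mem_oute; [case: (v == x) | move=> ? ? []].
rewrite (_ : (None \in map _ _) = false) ?orbF; last by apply/negbTE/mapP => -[].
by rewrite eq_sym; case: ifP.
Qed.

Definition graft P (f : edge P) (v : vertex P) : lgr := @add_edge _ (subdivide f) None (Some v).

Lemma graft_ineS P f v x :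
  perm_eq (ine (Some x : vertex (@graft P f v)))
    ((if x == v then [:: None] else [::]) ++ map (Some \o theta f) (ine x)).
Proof.
apply: perm_trans (add_ine _ _ _) _; rewrite (inj_eq (@Some_inj _)) perm_cat2l map_comp.
exact: perm_map (sub_ineS _ _).
Qed.

Lemma graft_outeS P f v x :
  perm_eq (oute (Some x : vertex (@graft P f v))) (map (Some \o Some) (oute x)).
Proof.
apply: perm_trans (add_oute _ _ _) _; rewrite /= map_comp.
exact: perm_map (sub_outeS _ _).
Qed.

Lemma graft_ineN P f v : ine (None : vertex (@graft P f v)) = [:: Some (Some f)].
Proof.
by apply: perm1; rewrite perm_sym (perm_trans (add_ine _ _ _)) //= sub_ineN.
Qed.

Lemma graft_outeN P f v : perm_eq (oute (None : vertex (@graft P f v))) [:: None; Some None].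
Proof. by rewrite (perm_trans (add_oute _ _ _)) //= sub_outeN. Qed.

Definition subd G (f : edge G) (d : deco G) : deco (subdivide f) :=
  @Deco n (subdivide f)
    (fun o => if o is Some e then tm d e else tm d f)
    (fun o => if o is Some e then st d e else false)
    (fun o => if o is Some e then (e != f) && sp d e else sp d f).

Definition unsub G (f : edge G) (d : deco (subdivide f)) : deco G :=
  Deco (fun e => tm d (Some e)) (fun e => st d (Some e)) (fun e => sp d (theta f e)).

Lemma subd_okN r0 G (f : edge G) (d : deco G) : okat r0 (subd f d) None.
Proof. by rewrite /okat /ins /outs sub_ineN sub_outeN /= eqxx. Qed.

Lemma subd_okS r0 G (f : edge G) (d : deco G) x : okat r0 d x -> okat r0 (subd f d) (Some x).
Proof.
apply: ok_perm.
  rewrite perm_sym; apply: perm_trans (perm_map _ (sub_ineS _ _)) _.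
  rewrite -map_comp (eq_map (g := fun e => (tm d e, sp d e))) // => e /=.
  by rewrite /theta; case: eqP => [->//|/eqP ne] /=; rewrite ne.
rewrite perm_sym; apply: perm_trans (perm_map _ (sub_outeS _ _)) _.
by rewrite -map_comp (eq_map (g := fun e => (tm d e, st d e))).
Qed.

Lemma subd_valid r0 G (f : edge G) d : valid r0 d -> valid r0 (subd f d).
Proof. by move=> V [x|]; [apply: subd_okS|apply: subd_okN]. Qed.

Lemma unsub_valid r0 G (f : edge G) (d : deco (subdivide f)) :
  valid r0 d -> valid r0 (unsub d) /\ ~~ st d None.
Proof.
move=> V; have := V None; rewrite /okat /ins /outs sub_ineN sub_outeN /= => -[_ sN EN].
split=> // x; apply: ok_perm (V (Some x)).
  apply: perm_trans (perm_map _ (sub_ineS _ _)) _.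
  rewrite -map_comp (eq_map (g := fun e => (tm d (Some e), sp d (theta f e)))) // => e /=.
  by rewrite /theta; case: eqP => [->|//] /=; rewrite EN.
apply: perm_trans (perm_map _ (sub_outeS _ _)) _.
by rewrite -map_comp.
Qed.

Lemma pmap_option (T : finType) (S : eqType) (g : option T -> option S) :
  perm_eq (pmap g (enum {: option T}))
          (seq_of_opt (g None) ++ pmap (g \o Some) (enum T)).
Proof.
apply: perm_trans (perm_pmap _ (perm_enum_option T)) _ => /=.
have -> : pmap g (map Some (enum T)) = pmap (g \o Some) (enum T).
  by elim: (enum T) => //= x s ->.
by case: (g None).
Qed.

Lemma real_subdivide G (f : edge G) r0 ts : real G r0 ts <-> real (subdivide f) r0 ts.
Proof.
split=> -[d [V P]].
- exists (subd f d); split; first exact: subd_valid.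
  apply: perm_trans P; exact: (pmap_option (start_term (subd f d))).
- have [V' s'] := unsub_valid V; exists (unsub d); split=> //.
  apply: perm_trans P; rewrite perm_sym.
  apply: perm_trans (pmap_option (start_term d)) _.
  by rewrite {1}/start_term (negbTE s').
Qed.

(* The conditions on P before an edge with data X into v is added. *)
Definition semi r0 P (v : vertex P) X (d : deco P) := forall x,
  ok r0 (lab x) ((if x == v then [:: X] else [::]) ++ ins d x) (outs d x).

Definition ungraft P f v (d : deco (@graft P f v)) : deco P :=
  Deco (fun z => tm d (Some (Some z))) (fun z => st d (Some (Some z)))
       (fun z => sp d (Some (theta f z))).

Definition graftd P (f : edge P) (v : vertex P) X (d : deco P) : deco (graft f v) :=
  @Deco n (graft f v)
    (fun o => match o with None => X.1 | Some None => tm d f | Some (Some z) => tm d z end)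
    (fun o => match o with None => true | Some None => false | Some (Some z) => st d z end)
    (fun o => match o with None => X.2 | Some None => sp d f
              | Some (Some z) => (z != f) && sp d z end).

Lemma ungraft_semi r0 P f v (d : deco (@graft P f v)) :
  valid r0 d -> st d None ->
  [/\ semi r0 v (tm d None, sp d None) (ungraft d),
      ~~ sp d (Some (Some f)) /\ ~~ st d (Some None),
      tm d (Some None) = tm d (Some (Some f))
    & perm_eq (starts d) (seq_of_opt (tm d None) ++ starts (ungraft d))].
Proof.
move=> V sN; have [sf sl El] : [/\ ~~ sp d (Some (Some f)), ~~ st d (Some None)
     & tm d (Some None) = tm d (Some (Some f))].
  have: ok r0 (lab (None : vertex (graft f v))) [:: (tm d (Some (Some f)), sp d (Some (Some f)))]
         [:: (tm d None, st d None); (tm d (Some None), st d (Some None))].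
    have := V None; rewrite /okat /ins graft_ineN.
    exact: ok_perm (perm_map _ (graft_outeN _ _)).
  rewrite /= sN => -[? ] [[]//|[//]|[_ //]].
split=> //.
- move=> x; apply: ok_perm (V (Some x)).
    apply: perm_trans (perm_map _ (graft_ineS _ _ _)) _.
    rewrite map_cat -map_comp.
    have -> : map (fun e => (tm d e, sp d e)) (if x == v then [:: None] else [::]) =
              if x == v then [:: (tm d None, sp d None)] else [::] by case: eqP.
    rewrite perm_cat2l /ins.
    rewrite (eq_map (g := fun e => (tm (ungraft d) e, sp (ungraft d) e))) // => e /=.
    by rewrite /theta; case: eqP => [->|//] /=; rewrite El.
  apply: perm_trans (perm_map _ (graft_outeS _ _ _)) _.
  by rewrite -map_comp.
- apply: perm_trans (pmap_option (start_term d)) _; rewrite {1}/start_term sN perm_cat2l.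
  apply: perm_trans (pmap_option (start_term d \o Some)) _.
  by rewrite /= {1}/start_term (negbTE sl).
Qed.

Lemma graftd_valid r0 P f v X (d : deco P) :
  semi r0 v X d -> valid r0 (graftd f v X d) /\
  perm_eq (starts (graftd f v X d)) (seq_of_opt X.1 ++ starts d).
Proof.
move=> S; split; last first.
  apply: perm_trans (pmap_option (start_term (graftd f v X d))) _; rewrite perm_cat2l.
  exact: (pmap_option (start_term (graftd f v X d) \o Some)).
case=> [x|]; last first.
  rewrite /okat /ins graft_ineN; apply: ok_perm (perm_refl _) _ _.
    rewrite perm_sym; exact: (perm_map _ (graft_outeN _ _)).
  by rewrite /= eqxx; split=> //; apply: Or32.
apply: ok_perm (S x).
  rewrite perm_sym; apply: perm_trans (perm_map _ (graft_ineS _ _ _)) _.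
  rewrite map_cat -map_comp.
  have -> : map (fun e => (tm (graftd f v X d) e, sp (graftd f v X d) e))
     (if x == v then [:: None] else [::]) = if x == v then [:: X] else [::].
    by case: eqP => //= _; case: (X).
  rewrite perm_cat2l /ins (eq_map (g := fun e => (tm d e, sp d e))) // => e /=.
  by rewrite /theta; case: eqP => [->|/eqP ne] //=; rewrite ne.
rewrite perm_sym; apply: perm_trans (perm_map _ (graft_outeS _ _ _)) _.
by rewrite -map_comp.
Qed.

Lemma add_edge_iso G H fV fE x y x' y' : @iso_maps G H fV fE -> fV x = x' -> fV y = y' ->
  @iso_maps (add_edge x y) (add_edge x' y') fV (omap fE).
Proof.
move=> [bV bE Hs Ht Hl] <- <-; split=> //.
- have [gE a b] := bE; exists (omap gE); case=> //= e; by rewrite ?a ?b.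
- by case=> //= e; rewrite Hs.
- by case=> //= e; rewrite Ht.
Qed.

Lemma subdivide_iso G H fV fE f : @iso_maps G H fV fE ->
  @iso_maps (subdivide f) (subdivide (fE f)) (omap fV) (omap fE).
Proof.
move=> [bV bE Hs Ht Hl]; split=> //.
- have [gV a b] := bV; exists (omap gV); case=> //= e; by rewrite ?a ?b.
- have [gE a b] := bE; exists (omap gE); case=> //= e; by rewrite ?a ?b.
- by case=> //= e; rewrite Hs.
- case=> [e|] /=; last by rewrite Ht.
  by rewrite (inj_eq (bij_inj bE)); case: eqP => //= _; rewrite Ht.
- by case=> //= v; rewrite Hl.
Qed.

Lemma graft_iso G H fV fE f v f' v' : @iso_maps G H fV fE -> fE f = f' -> fV v = v' ->
  @iso_maps (graft f v) (graft f' v') (omap fV) (omap (omap fE)).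
Proof.
move=> /(subdivide_iso f) I <- <-.
exact: (@add_edge_iso (subdivide f) (subdivide (fE f)) _ _ None (Some v) _ _ I).
Qed.

Lemma add_del_iso G (e : edge G) :
  @iso_maps (@add_edge _ (del_edge e) (src e) (tgt e)) G id
    (fun o => if o is Some x then val x else e).
Proof.
split=> //; try by case.
- by exists id.
- apply: fin_bij.
    case=> [x|] [y|] //=; first by move/val_inj ->.
      by move=> Q; have : sval x != e := valP x; rewrite Q eqxx.
    by move=> Q; have : sval y != e := valP y; rewrite -Q eqxx.
  move=> f; case: (eqVneq f e) => [->|ne]; first by exists None.
  by exists (Some (Sub f ne)).
Qed.

Lemma unsuppress_iso G (u : vertex G) (p c : vertex (del_vertex u)) :
  lab u = None -> suppressible p c ->
  exists fV fE, @iso_maps (subdivide (None : edge (suppress p c))) G fV fE /\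
    fV None = u /\ forall x, fV (Some x) = val x.
Proof.
move=> lu []; rewrite indegE outdegE => si so /existsP[a /andP[/eqP sa /eqP ta]] /existsP[b /andP[/eqP sb /eqP tb]].
have Ei e : (tgt e == u) = (e == a).
  have : a \in ine u by rewrite mem_ine ta.
  by rewrite -mem_ine; case: (ine u) si => [|a' []] //= _; rewrite !inE => /eqP ->.
have Eo e : (src e == u) = (e == b).
  have : b \in oute u by rewrite mem_oute sb.
  by rewrite -mem_oute; case: (oute u) so => [|a' []] //= _; rewrite !inE => /eqP ->.
have pu : val p != u by case: (p).
have cu : val c != u by case: (c).
have ab : (a == b) = false by rewrite -Eo sa; apply/negbTE.
exists (fun o : option {x | x != u} => if o is Some x then val x else u),
  (fun o : option (option {e : edge G | (src e != u) && (tgt e != u)}) =>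
     match o with None => b | Some None => a | Some (Some e) => val e end); split=> //; split=> //.
- apply: fin_bij.
    case=> [x|] [y|] //=; first by move/val_inj ->.
      by move=> Q; have : sval x != u := valP x; rewrite Q eqxx.
    by move=> Q; have : sval y != u := valP y; rewrite -Q eqxx.
  move=> v; case: (eqVneq v u) => [->|ne]; first by exists None.
  by exists (Some (Sub v ne)).
- have nval (x : {e : edge G | (src e != u) && (tgt e != u)}) : sval x != a /\ sval x != b.
    by case: x => x /=; rewrite Ei Eo => /andP[].
  apply: fin_bij.
    case=> [[x|]|] [[y|]|] //= Q; try by move/eqP: Q; rewrite ?ab // eq_sym ab.
    + by move/val_inj: Q ->.
    + by have [] := nval x; rewrite Q eqxx.
    + by have [] := nval x; rewrite Q eqxx.
    + by have [] := nval y; rewrite -Q eqxx.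
    + by have [] := nval y; rewrite -Q eqxx.
  move=> e; case: (eqVneq e a) => [->|ea]; first by exists (Some None).
  case: (eqVneq e b) => [->|eb]; first by exists None.
  have H : (src e != u) && (tgt e != u) by rewrite Ei Eo ea eb.
  by exists (Some (Some (Sub e H))).
- by case=> [[x|]|].
- by case=> [[x|]|].
- by case.
Qed.

End Graphs.

(** * Networks *)

Section Nets.
Variable n : nat.
Local Notation lgr := (lgraph (label n)).
Local Notation bt := (bt n).
Implicit Types G H P : lgr.

Definition ranked G := exists rk : vertex G -> nat, forall e, rk (src e) < rk (tgt e).

Lemma adj_edge G (e : edge G) : adj (src e) (tgt e).
Proof. by apply/existsP; exists e; rewrite !eqxx. Qed.

Lemma rk_connect G (rk : vertex G -> nat) x y :
  (forall e, rk (src e) < rk (tgt e)) -> connect (@adj _ G) x y -> rk x <= rk y.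
Proof.
move=> Hrk /connectP[p]; elim: p x => [|z p IH] x /=; first by move=> _ ->.
case/andP=> /existsP[e /andP[/eqP <- /eqP <-]] /IH{}IH /IH.
by move: (Hrk e); lia.
Qed.

Lemma acyclicP G : acyclic G <-> ranked G.
Proof.
split=> [A|[rk Hrk] e]; last first.
  by apply/negP => /(rk_connect Hrk); have := Hrk e; lia.
exists (fun x => #|[set y | connect (@adj _ G) y x]|) => e.
apply: proper_card; apply/properP; split.
  by apply/subsetP => y; rewrite !inE => /connect_trans -> //; apply/connect1/adj_edge.
by exists (tgt e); rewrite !inE ?connect0.
Qed.

Definition label_degrees (l : option (label n)) i o :=
  match l with
  | Some Rho => i = 0 /\ o = 1
  | Some (Taxon _) => i = 1 /\ o = 0
  | None => (i = 1 /\ o = 2) \/ (i = 2 /\ o = 1)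
  end.

Definition net G :=
  [/\ ranked G, forall v : vertex G, label_degrees (lab v) (size (ine v)) (size (oute v)),
      forall l, has_label G l
    & forall (v w : vertex G) l, lab v = Some l -> lab w = Some l -> v = w].

Lemma netP G : network_on_X G <-> net G.
Proof.
split.
- case=> -[A [r [Hr Ur]] T Lb U] Hl; have lr (v : vertex G) : is_root v -> lab v = Some Rho.
    move=> rv; have [w Ew] := Hl Rho; have [rw lw iw] := Lb w.
    have : is_root w.
      move: (T w); case: (is_root w) => //=; case: (is_leaf w) lw => //= [lw _|_ Q].
        by have [i] := lw isT; rewrite Ew.
      by rewrite iw in Ew.
    by move=> /Ur Q; rewrite -(Ur _ rv) Q.
  split=> //; first exact/acyclicP.
    move=> v; rewrite -indegE -outdegE; have [rv lv iv] := Lb v.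
    case/or4P: (T v) => Q.
    + by rewrite lr //; case/andP: Q => /eqP -> /eqP ->.
    + by have [i ->] := lv Q; case/andP: Q => /eqP -> /eqP ->.
    + by rewrite iv ?Q //; case/andP: Q => /eqP -> /eqP ->; left.
    + by rewrite iv ?Q ?orbT //; case/andP: Q => /eqP -> /eqP ->; right.
  move=> v w [|i] Ev Ew; last exact: U Ev Ew.
  have isr (x : vertex G) : lab x = Some Rho -> is_root x.
    move=> Ex; have [rx lx ix] := Lb x.
    move: (T x); case: (is_root x) => //=; case: (is_leaf x) lx => //= [lx _|_ Q].
      by have [i] := lx isT; rewrite Ex.
    by rewrite ix in Ex.
  by rewrite -(Ur _ (isr _ Ev)) -(Ur _ (isr _ Ew)).
- case=> /acyclicP A L Hl U; split=> //.
  have d1 (v : vertex G) : indeg v = size (ine v) by rewrite indegE.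
  have d2 (v : vertex G) : outdeg v = size (oute v) by rewrite outdegE.
  have [r Er] := Hl Rho.
  have ro (v : vertex G) : is_root v = (if lab v is Some Rho then true else false).
    by rewrite /is_root d1 d2; move: (L v); case: (lab v) => [[|i]|] /= ; case; try case; move=> -> ->.
  split=> //.
  + by exists r; split=> [|x]; rewrite ro ?Er //; case E: (lab x) => [[|]|] // _; apply: U Er E.
  + move=> v; rewrite /is_root /is_leaf /is_inner /is_reticulation d1 d2.
    by move: (L v); case: (lab v) => [[|i]|] /= ; case; try case; move=> -> ->.
  + move=> v; rewrite ro /is_leaf /is_inner /is_reticulation d1 d2.
    move: (L v); case: (lab v) => [[|i]|] /= ; case; try case; move=> -> ->;
      by split=> // _; first [by left | by right | by eexists].
  + by move=> v w i; apply: U.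
Qed.

Lemma net_root G (v w : vertex G) : net G -> ine v = [::] -> ine w = [::] -> v = w.
Proof.
move=> [_ L _ U] Ev Ew.
have R (x : vertex G) : ine x = [::] -> lab x = Some Rho.
  by move=> E; move: (L x); rewrite E; case: (lab x) => [[|i]|] //= [] // [].
exact: U (R _ Ev) (R _ Ew).
Qed.

Lemma net_root_lab G (v : vertex G) : net G -> ine v = [::] <-> lab v = Some Rho.
Proof.
move=> [_ L _ U]; have := L v; split=> E; move: (L v); rewrite E.
  by case: (lab v) => [[|i]|] //= [] // [].
by case=> /size0nil.
Qed.

Lemma net_root_edge G : net G -> exists e : edge G, ine (src e) = [::].
Proof.
move=> nG; have [_ L Hl _] := nG; have [r Er] := Hl Rho.
have := L r; rewrite Er => -[_]; case E: (oute r) => [|b []] // _.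
exists b; apply/net_root_lab => //.
have : b \in oute r by rewrite E inE.
by rewrite mem_oute => /eqP ->.
Qed.

Lemma net_iso G H : isomorphic G H -> net G -> net H.
Proof.
move=> [fV [fE I]] [[rk Hrk] L Hl U]; have [gV [gE [J fgV gfV fgE gfE]]] := iso_maps_inv I.
have [_ _ Js Jt Jl] := J; split.
- by exists (rk \o gV) => e /=; rewrite -Js -Jt.
- move=> v; rewrite -(gfV v) (perm_size (iso_ine _ I)) (perm_size (iso_oute _ I)) !size_map.
  by have [_ _ _ _ ->] := I.
- by move=> l; have [v Ev] := Hl l; exists (fV v); have [_ _ _ _ ->] := I.
- by move=> v w l; rewrite -!Jl => Ev Ew; apply: (can_inj gfV); apply: U Ev Ew.
Qed.

Lemma iso_card G H : isomorphic G H -> #|edge G| = #|edge H|.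
Proof. by move=> [fV [fE [_ bE _ _ _]]]; apply: bij_eq_card bE. Qed.

Lemma net_count G : net G -> (#|edge G|).+1 = n.*2 + 3 * nret G.
Proof.
move=> [_ L Hl U].
have sum_in : \sum_(v : vertex G) size (ine v) = #|edge G|.
  rewrite -sum1_card (partition_big (@tgt _ G) predT) //=.
  by apply: eq_bigr => v _; rewrite sum1_card -indegE /indeg cardsE.
have sum_out : \sum_(v : vertex G) size (oute v) = #|edge G|.
  rewrite -sum1_card (partition_big (@src _ G) predT) //=.
  by apply: eq_bigr => v _; rewrite sum1_card -outdegE /outdeg cardsE.
pose isL (v : vertex G) : nat := if lab v is Some (Taxon _) then 1 else 0.
pose isR (v : vertex G) : nat := if lab v is Some Rho then 1 else 0.
pose isI (v : vertex G) : nat := is_inner v.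
pose isB (v : vertex G) : nat := is_reticulation v.
have loc v : size (ine v) = isL v + isI v + (isB v + isB v) /\
             size (oute v) = isR v + (isI v + isI v) + isB v.
  rewrite /isL /isR /isI /isB /is_inner /is_reticulation indegE outdegE.
  by move: (L v); case: (lab v) => [[|i]|] /= ; case; try case; move=> -> ->.
have EB : \sum_v isB v = nret G by rewrite /nret -sum1dep_card [RHS]big_mkcond.
have ER : \sum_v isR v = 1.
  have [r Er] := Hl Rho; rewrite (bigD1 r) //= big1 ?addn0 /isR ?Er // => v nv.
  by case E: (lab v) => [[|]|] //; rewrite (U _ _ _ E Er) eqxx in nv.
have EL : \sum_v isL v = n.
  rewrite -[RHS]card_ord -sum1_card.
  rewrite (eq_bigr (fun v => \sum_(i < n) (if lab v is Some (Taxon j) then i == j else false : nat))); last first.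
    move=> v _; rewrite /isL; case: (lab v) => [[|j]|]; try by rewrite big1.
    by rewrite (bigD1 j) //= eqxx big1 // => i /negbTE ->.
  rewrite exchange_big; apply: eq_bigr => i _ /=.
  have [w Ew] := Hl (Taxon i); rewrite (bigD1 w) //= Ew eqxx big1 // => v nv.
  case E: (lab v) => [[|j]|] //; case: eqP => // Q; subst j.
  by rewrite (U _ _ _ E Ew) eqxx in nv.
move: sum_in sum_out; rewrite (eq_bigr _ (fun v _ => (loc v).1)) (eq_bigr _ (fun v _ => (loc v).2)).
rewrite !big_split /= EB ER EL.
by set I := \sum_v isI v; lia.
Qed.

Lemma net_graft_ranked P f v : net (@graft n P f v) -> ranked P /\ ~~ edge_descendant v f.
Proof.
move=> [[rk Hrk] _ _ _].
have HP (e : edge P) : rk (Some (src e)) < rk (Some (tgt e)).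
  case: (eqVneq e f) => [->|ne].
    have := Hrk (Some (Some f)); have := Hrk (Some None); rewrite /= eqxx; lia.
  by have := Hrk (Some (Some e)); rewrite /= (negbTE ne).
split; first by exists (fun x => rk (Some x)).
apply/negP => /(rk_connect (rk := fun x => rk (Some x))) - /(_ HP).
by have := Hrk (Some (Some f)); have := Hrk None; rewrite /= eqxx; lia.
Qed.

Lemma net_regraft P f0 f v : net (@graft n P f0 v) -> ~~ edge_descendant v f -> net (graft f v).
Proof.
move=> nG nd; have [[rk Hrk] _] := net_graft_ranked nG; have [_ L Hl U] := nG; split.
- pose M := (\max_x rk x).+1.
  pose r x := rk x + (if connect (@adj _ P) v x then M else 0).
  have Hr e : r (src e) < r (tgt e).
    rewrite /r; have := Hrk e; case: ifP => c1; last by lia.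
    by rewrite (connect_trans c1 (connect1 (adj_edge e))); lia.
  have rv : r (src f) < r v.
    rewrite /edge_descendant in nd; rewrite /r (negbTE nd) connect0 /M; have : rk (src f) <= \max_x rk x by exact: leq_bigmax.
    lia.
  exists (fun o => if o is Some x then (r x).*2 else (r (src f)).*2.+1).
  case=> [[e|]|] /=; [|by have := Hr f; lia|by lia].
  by have := Hr e; case: eqP => [->|_]; lia.
- case=> [x|]; last by rewrite graft_ineN (perm_size (graft_outeN _ _)); left.
  have := L (Some x).
  rewrite (perm_size (@graft_ineS n P f0 v x)) (perm_size (@graft_outeS n P f0 v x)).
  rewrite (perm_size (@graft_ineS n P f v x)).
  by rewrite !size_cat !size_map.
- by move=> l; have [[x|] Ex] := Hl l => //; exists (Some x).
- by case=> [x|] [y|] // l Ex Ey; have := U (Some x) (Some y) l Ex Ey.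
Qed.

Lemma net_ungraft G (e : edge G) (f : edge (subdivide e)) :
  net (@graft n (subdivide e) f None) -> net G.
Proof.
move=> nG; have [[rk Hrk] _] := net_graft_ranked nG; have [_ L Hl U] := nG; split.
- exists (fun x => rk (Some x)) => e'; case: (eqVneq e' e) => [->|ne].
    by have := Hrk (Some e); have := Hrk None; rewrite /= eqxx; lia.
  by have := Hrk (Some e'); rewrite /= (negbTE ne).
- move=> x; have := L (Some (Some x)).
  rewrite (perm_size (graft_ineS _ _ _)) (perm_size (graft_outeS _ _ _)) /= !size_map.
  by rewrite (perm_size (sub_ineS _ _)) (perm_size (sub_outeS _ _)) !size_map.
- by move=> l; have [[[x|]|] Ex] := Hl l => //; exists x.
- by move=> x y l Ex Ey; have := U (Some (Some x)) (Some (Some y)) l Ex Ey => -[].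
Qed.

Lemma suppressible_exists G (u : vertex G) :
  ranked G -> size (ine u) = 1 -> size (oute u) = 1 ->
  exists p c : vertex (del_vertex u), suppressible p c.
Proof.
move=> [rk Hrk] si so.
have [a Ea] : exists a, a \in ine u by case: (ine u) si => // x s _; exists x; rewrite mem_head.
have [b Eb] : exists a, a \in oute u by case: (oute u) so => // x s _; exists x; rewrite mem_head.
rewrite mem_ine in Ea; rewrite mem_oute in Eb.
have pu : src a != u by apply/eqP => Q; have := Hrk a; rewrite Q (eqP Ea); lia.
have cu : tgt b != u by apply/eqP => Q; have := Hrk b; rewrite Q (eqP Eb); lia.
exists (Sub (src a) pu), (Sub (tgt b) cu); split; rewrite ?indegE ?outdegE //=.
  by apply/existsP; exists a; rewrite eqxx Ea.
by apply/existsP; exists b; rewrite eqxx Eb.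
Qed.

Lemma add_del_comp_iso G (e : edge G) K (gV : vertex K -> vertex (del_edge e)) gE a b :
  iso_maps gV gE -> gV a = src e -> gV b = tgt e ->
  exists fV fE, @iso_maps n (add_edge a b) G fV fE /\ fE None = e.
Proof.
move=> I Ea Eb; have I2 := add_edge_iso I Ea Eb.
by eexists; eexists; split; first exact:
  (@iso_maps_comp n _ (@add_edge _ (del_edge e) (src e) (tgt e)) G _ _ _ _ I2 (add_del_iso e)).
Qed.

Lemma prune_iso G (e : edge G) (p c : vertex (@del_vertex _ (del_edge e) (src e)))
    (v : vertex (suppress p c)) :
  lab (src e) = None -> suppressible p c -> val v = tgt e ->
  exists fV fE, @iso_maps n (graft (None : edge (suppress p c)) v) G fV fE /\ fE None = e.
Proof.
move=> lu S Ev; have [gV [gE [I [gN gS]]]] := @unsuppress_iso n (del_edge e) (src e) p c lu S.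
exact: (add_del_comp_iso I gN (etrans (gS v) Ev)).
Qed.

Lemma prune_exists G (e : edge G) :
  ranked G -> size (ine (src e)) = 1 -> size (oute (src e)) = 2 ->
  exists (p c : vertex (@del_vertex _ (del_edge e) (src e))) (v : vertex (suppress p c)),
    suppressible p c /\ val v = tgt e.
Proof.
move=> [rk Hrk] si so.
have ne : tgt e != src e by apply/eqP => Q; have := Hrk e; rewrite Q; lia.
have I := add_del_iso e; pose K := @add_edge _ (del_edge e) (src e) (tgt e).
have := perm_size (@iso_ine n K G _ _ (src e) I).
have := perm_size (@iso_oute n K G _ _ (src e) I).
rewrite !size_map si so (perm_size (add_ine _ _ _)) (perm_size (add_oute _ _ _)) eqxx.
rewrite eq_sym (negbTE ne) /= !size_map => so' si'.
have [|||p [c S]] := @suppressible_exists (del_edge e) (src e).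
- by exists rk => x /=.
- by [].
- by case: so'.
- by exists p, c, (Sub (tgt e) ne).
Qed.

Lemma snpr0_graft N N' : net N -> snpr0 N N' ->
  exists P (v : vertex P) f0 f, isomorphic (graft f0 v) N /\ isomorphic (graft f v) N'.
Proof.
move=> [rN L _ _] [e [te nr [p [c [S [v [f [Ev _ I]]]]]]]].
exists (suppress p c), v, None, f.
have lu : lab (src e) = None.
  case: S => si so _ _; move: (L (src e)); case: (lab (src e)) => [[|i]|] //= [Ei Eo].
    by move: nr; rewrite /is_root indegE outdegE Ei Eo.
  have : e \in oute (src e) by rewrite mem_oute.
  by rewrite (size0nil Eo).
have [fV [fE [J _]]] := prune_iso lu S Ev.
exact: conj (ex_intro _ fV (ex_intro _ fE J)) I.
Qed.

Lemma graft_comp_iso G P K (gV : vertex K -> vertex P) gE u (f : edge P) v fV fE (e : edge G) :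
  iso_maps gV gE -> gV u = v -> @iso_maps n (graft f v) G fV fE -> fE None = e ->
  exists f' fV fE, @iso_maps n (@graft n K f' u) G fV fE /\ fE None = e.
Proof.
move=> J Ev I EN; have [hV [hE [_ _ _ ghE hgE]]] := iso_maps_inv J.
have J2 := graft_iso J (hgE f) Ev.
by exists (hE f); eexists; eexists; split; first exact: iso_maps_comp J2 I.
Qed.

Lemma unplus_iso N (e : edge N) (p c : vertex (@del_vertex _ (del_edge e) (src e)))
    (v : vertex (suppress p c)) (q d : vertex (@del_vertex _ (suppress p c) v)) :
  lab (src e) = None -> lab (tgt e) = None ->
  suppressible p c -> val v = tgt e -> suppressible q d ->
  exists (f : edge (subdivide (None : edge (suppress q d)))) fV fE,
    @iso_maps n (@graft n (subdivide (None : edge (suppress q d))) f None) N fV fE /\ fE None = e.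
Proof.
move=> lu lv S Ev S2; have [fV [fE [I EN]]] := prune_iso lu S Ev.
have lv' : lab v = None by move: lv; rewrite -Ev.
have [gV [gE [J [gN _]]]] := @unsuppress_iso n (suppress p c) v q d lv' S2.
exact: (graft_comp_iso J gN I EN).
Qed.

Lemma snpr_minus_graft N N' : net N -> snpr_minus N N' ->
  exists M (e : edge M) (f : edge (subdivide e)),
    isomorphic M N' /\ isomorphic (@graft n (subdivide e) f None) N.
Proof.
move=> [rN L _ _] [e [te rv [p [c [S [v [Ev [q [d [S2 I]]]]]]]]]].
have lv : lab (tgt e) = None.
  move: rv; rewrite /is_reticulation indegE outdegE => /andP[/eqP si /eqP so].
  by move: (L (tgt e)); rewrite si so; case: (lab (tgt e)) => [[|i]|] //= [].
have lu : lab (src e) = None.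
  case: S => si so _ _; move: (L (src e)); case E: (lab (src e)) => [[|i]|] //= [Ei Eo].
    move: si; rewrite indegE => si.
    have := perm_size (@iso_ine n (@add_edge _ (del_edge e) (src e) (tgt e)) N _ _ (src e)
      (add_del_iso e)); rewrite Ei size_map.
    by rewrite (perm_size (add_ine _ _ _)) size_cat size_map si addn1.
  have : e \in oute (src e) by rewrite mem_oute.
  by rewrite (size0nil Eo).
have [f [fV [fE [J _]]]] := unplus_iso lu lv S Ev S2.
exists (suppress q d), None, f; split=> //; by exists fV, fE.
Qed.

Lemma unplus_exists N (e : edge N) : net N ->
  size (ine (src e)) = 1 -> size (oute (src e)) = 2 -> size (ine (tgt e)) = 2 ->
  exists M (e0 : edge M) (f : edge (subdivide e0)),
  exists fV fE, @iso_maps n (@graft n (subdivide e0) f None) N fV fE /\ fE None = e.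
Proof.
move=> nN si so sv; have [rN L _ _] := nN.
have lu : lab (src e) = None.
  by move: (L (src e)); rewrite si so; case: (lab (src e)) => [[|i]|] //= [].
have [lv ov] : lab (tgt e) = None /\ size (oute (tgt e)) = 1.
  by move: (L (tgt e)); rewrite sv; case: (lab (tgt e)) => [[|i]|] //= [] // [].
have [p [c [v [S Ev]]]] := prune_exists rN si so.
have [fV [fE [I EN]]] := prune_iso lu S Ev.
have Etv : fV (Some v) = tgt e by case: I => _ _ _ Ht _; apply/esym; have := Ht None; rewrite EN.
have := perm_size (@iso_ine n (graft (None : edge (suppress p c)) v) N _ _ (Some v) I).
have := perm_size (@iso_oute n (graft (None : edge (suppress p c)) v) N _ _ (Some v) I).
rewrite Etv sv ov !size_map (perm_size (graft_ineS _ _ _)) (perm_size (graft_outeS _ _ _)).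
rewrite eqxx size_cat !size_map /= => sov siv.
have [|||q [d S2]] := @suppressible_exists (suppress p c) v.
- have nG : net (graft (None : edge (suppress p c)) v).
    by apply: net_iso nN; apply: iso_sym; exists fV, fE.
  by have [] := net_graft_ranked nG.
- by case: siv.
- by [].
have [f H] := unplus_iso lu lv S Ev S2.
by exists (suppress q d), None, f.
Qed.

End Nets.

(** * One SNPR operation *)

Section Steps.
Variable n : nat.
Local Notation lgr := (lgraph (label n)).
Local Notation bt := (bt n).
Implicit Types G H P T N M : lgr.

(* An agreement forest with k components besides T_rho. *)
Definition agr T N k := exists r0 ts, [/\ size ts = k, real T r0 ts & real N r0 ts].

Lemma real_perm G r0 ts ts' : perm_eq ts ts' -> real G r0 ts -> real G r0 ts'.
Proof. by move=> P [d [V Q]]; exists d; split=> //; apply: perm_trans Q P. Qed.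

Lemma plus_semi M (e : edge M) r0 (d : deco (subdivide e)) :
  valid r0 d <-> @semi n r0 (subdivide e) None (None, true) d.
Proof.
split=> V [x|]; [exact: (V (Some x))| |exact: (V (Some x))|]; have := V None; rewrite /okat /=.
- by rewrite /ins /outs sub_ineN sub_outeN /= => -[? ? ?]; split=> //; left.
- by rewrite /ins /outs sub_ineN sub_outeN /= => -[? [[_ _ ? ?]|[_ _ //]]].
Qed.

Lemma ungraft_plus M (e : edge M) (f : edge (subdivide e)) r0
    (d : deco (@graft n (subdivide e) f None)) :
  valid r0 d -> st d None -> sp d None -> tm d None = None -> real M r0 (starts d).
Proof.
move=> V sN pN tN; have [S _ _ P] := ungraft_semi V sN; rewrite tN pN /= in S P.
apply/(real_subdivide e); exists (ungraft d); split; first exact/plus_semi.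
by rewrite perm_sym.
Qed.

Lemma net_nret_edges G H : net G -> net H -> #|edge G| = #|edge H| -> nret G = nret H.
Proof. by move=> /net_count + /net_count; lia. Qed.

Lemma card_graft P (f : edge P) v : #|edge (graft f v)| = (#|edge P|).+2.
Proof. by rewrite !card_option. Qed.

Lemma card_plus M (e : edge M) (f : edge (subdivide e)) :
  #|edge (@graft n (subdivide e) f None)| = (#|edge M|).+3.
Proof. by rewrite !card_option. Qed.

Lemma nret_plus M (e : edge M) (f : edge (subdivide e)) N :
  net M -> net N -> isomorphic (@graft n (subdivide e) f None) N -> nret N = (nret M).+1.
Proof.
move=> nM nN I; have := iso_card I; rewrite card_plus.
by move: (net_count nM) (net_count nN); lia.
Qed.

Lemma agr_step T N N' k : net T -> net N -> net N' -> agr T N k -> snpr N N' ->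
  exists k', agr T N' k' /\ k' + nret N' <= (k + nret N).+1.
Proof.
move=> nT nN nN' [r0 [ts [sz realT RN]]].
have [[rkT HrkT] _ _ _] := nT.
case=> [/(snpr0_graft nN)|[e [f [_ I]]]|/(snpr_minus_graft nN)].
- move=> [P [v [f0 [f [I I']]]]]; have nG := net_iso (iso_sym I) nN.
  have [d [V Q]] := real_iso (iso_sym I) RN.
  have [[rk Hrk] _ _ _] := nG.
  have [||r1 [d' [V' C s']]] := make_start Hrk (fun v w => net_root nG) V (e := None).
  + by rewrite graft_ineN.
  + by rewrite (perm_size (graft_outeN _ _)).
  have realT' : real T r1 (starts d').
    apply: (cutrel_real HrkT (fun v w => net_root nT) (net_root_edge nT)) C.
    by apply: real_perm realT; rewrite perm_sym.
  have [S _ _ PS] := ungraft_semi V' s'.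
  have [V2 P2] := graftd_valid f S.
  exists (size (starts d')); split.
    exists r1, (starts d'); split=> //; apply: real_iso I' _.
    by exists (graftd f v (tm d' None, sp d' None) (ungraft d')); split=> //;
      rewrite (perm_trans P2) // perm_sym.
  have -> : nret N' = nret N.
    by apply: net_nret_edges => //; rewrite -(iso_card I) -(iso_card I') !card_graft.
  have := cutrel_size C; rewrite (perm_size Q) sz; lia.
- exists k; split; last by rewrite (nret_plus nN nN' I) addnS.
  exists r0, ts; split=> //; apply: real_iso I _.
  have [d [V Q]] := (real_subdivide e r0 ts).1 RN.
  have [V2 P2] := graftd_valid f ((plus_semi r0 d).1 V).
  by eexists; split; first exact: V2; apply: perm_trans P2 Q.
- move=> [M [e [f [I' I]]]]; have nG := net_iso (iso_sym I) nN.
  have [d [V Q]] := real_iso (iso_sym I) RN.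
  have [[rk Hrk] _ _ _] := nG; have nr := fun v w => @net_root n _ v w nG.
  have [||r1 [d' [V' C s']]] := make_start Hrk nr V (e := None).
  + by rewrite graft_ineN.
  + by rewrite (perm_size (graft_outeN _ _)).
  have [|d2 [V2 P2 s2 p2 t2]] := swap_ret Hrk nr V' s'.
    by rewrite (perm_size (@graft_ineS n (subdivide e) f None None)) sub_ineN.
  have realT' : real T r1 (starts d2).
    have : real T r1 (starts d').
      apply: (cutrel_real HrkT (fun v w => net_root nT) (net_root_edge nT)) C.
      by apply: real_perm realT; rewrite perm_sym.
    by apply: real_perm; rewrite perm_sym.
  exists (size (starts d2)); split.
    by exists r1, (starts d2); split=> //; apply: real_iso I' _; apply: ungraft_plus V2 s2 p2 t2.
  have nM := net_iso (iso_sym I') nN'.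
  have EN := nret_plus nM nN I.
  have -> : nret N' = nret M by apply: net_nret_edges => //; rewrite -(iso_card I').
  rewrite EN (perm_size P2); have := cutrel_size C; rewrite (perm_size Q) sz.
  by move: (size _) (nret M) => z r; lia.
Qed.

Lemma agr_path T d N N' k : net T -> net N -> agr T N k -> snpr_path d N N' ->
  exists k', agr T N' k' /\ k' + nret N' <= k + nret N + d.
Proof.
move=> nT nN A H; elim: H k nN A => {d N N'} [N N' I|d N M N' S nM _ IH] k nN A.
  exists k; split; last first.
    by rewrite addn0 (net_nret_edges nN (net_iso I nN)) ?(iso_card I).
  by have [r0 [ts [? ? R]]] := A; exists r0, ts; split=> //; apply: real_iso I R.
have nM' := (netP M).1 nM.
have [k1 [A1 l1]] := agr_step nT nN nM' A S.
by have [k2 [A2 l2]] := IH k1 nM' A1; exists k2; split=> //; lia.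
Qed.

Lemma root_child_min G (rk : vertex G -> nat) r0 (d : deco G) a x : net G ->
  (forall e, rk (src e) < rk (tgt e)) -> valid r0 d ->
  ine (src a) = [::] -> ine x <> [::] -> rk (tgt a) <= rk x.
Proof.
move=> nG Hrk V Ea; have [m le_m] := ubnP (rk x); elim: m => // m IH in x le_m *.
case E: (ine x) => [//|g s] _.
have tg : tgt g = x by apply/eqP; rewrite -mem_ine E mem_head.
case Eg: (ine (src g)) => [|g' s'].
  have Q := net_root nG Eg Ea; have [Eo _] := root_out V Ea.
  have : g \in oute (src a) by rewrite mem_oute Q.
  by rewrite Eo inE => /eqP Q2; rewrite -tg Q2.
have := Hrk g; have := IH (src g); rewrite Eg -tg; move: le_m; rewrite -tg => ? IHg ?.
by have := IHg ltac:(lia) ltac:(by []); lia.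
Qed.

Lemma net_inner G (v : vertex G) : net G -> ine v <> [::] -> oute v <> [::] ->
  size (ine v) <> 2 -> size (ine v) = 1 /\ size (oute v) = 2.
Proof.
move=> [_ L _ _]; move: (L v); case: (lab v) => [[|i]|] /=.
- by case=> /size0nil ->.
- by case=> _ /size0nil ->.
- by case=> [[-> ->]|[-> _]].
Qed.

Lemma remove_ret N r0 ts : net N -> real N r0 ts -> 0 < nret N ->
  exists M, [/\ net M, snpr_plus M N, real M r0 ts & nret N = (nret M).+1].
Proof.
move=> nN [d [V P]]; rewrite card_gt0 => /set0Pn [w0]; rewrite inE => rw0.
have [[rk Hrk] _ _ _] := nN.
case: (arg_minnP rk rw0) => v rv minv {w0 rw0}.
move: rv; rewrite /is_reticulation indegE outdegE => /andP[/eqP siv /eqP sov].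
have [a [ta spa] [b nab tb]] : exists2 a, tgt a = v /\ sp d a & exists2 b, a != b & tgt b = v.
  case/okatP: (V v); try by (move=> ? ? Ei; rewrite Ei in siv) || (move=> ? Ei; rewrite Ei in siv).
  + by move=> a b c dir x y Ei; rewrite Ei in siv.
  + by move=> a b c Ei; rewrite Ei in siv.
  + move=> a b c Pi _ ne sa _ _ _ _; exists a; first by split=> //; apply/eqP; rewrite -mem_ine (perm_mem Pi) inE eqxx.
    by exists b => //; apply/eqP; rewrite -mem_ine (perm_mem Pi) !inE eqxx orbT.
have rka := Hrk a; have rkb := Hrk b.
have nroot : ine (src a) <> [::].
  move=> Ea; have [Eo _] := root_out V Ea.
  have Eb : ine (src b) <> [::].
    move=> Eb; have Q := net_root nN Eb Ea.
    have : b \in oute (src a) by rewrite mem_oute Q.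
    by rewrite Eo inE eq_sym (negbTE nab).
  by have := root_child_min nN Hrk V Ea Eb; rewrite ta; move: rkb; rewrite tb; lia.
have nout : oute (src a) <> [::].
  by move=> E; have := mem_oute (src a) a; rewrite E eqxx.
have nret2 : size (ine (src a)) <> 2.
  move=> Q; have [_ L _ _] := nN; have : is_reticulation (src a).
    rewrite /is_reticulation indegE outdegE Q.
    by have := L (src a); rewrite Q; case: (lab _) => [[|i]|] //= [] // [] // _ ->.
  by move=> /minv; rewrite -ta; lia.
have [si so] := net_inner nN nroot nout nret2.
have [d' [V' P' s' sp']] := swap_stop Hrk (fun v w => net_root nN) V spa si so.
have Z : tm d' a = None.
  by case: (hviewP a V') => // [j|c|b' c dir x y [_ _ _ []]]; rewrite sp' spa.
have [|M [e0 [f [fV [fE [I EN]]]]]] := unplus_exists nN si so; first by rewrite ta.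
have II : isomorphic (@graft n (subdivide e0) f None) N by exists fV, fE.
have nG := net_iso (iso_sym II) nN; have nM := net_ungraft nG.
have [V2 P2] := pull_valid I V'.
exists M; split=> //.
- by exists e0, f; split=> //; have [] := net_graft_ranked nG.
- have := @ungraft_plus M e0 f r0 (pull fE d') V2; rewrite /= EN s' sp' spa Z.
  move=> /(_ isT isT erefl); apply: real_perm.
  by rewrite (perm_trans P2) // (perm_trans P').
- exact: nret_plus nM nN II.
Qed.

Lemma nret0_ine G (v : vertex G) : net G -> nret G = 0 -> size (ine v) <= 1.
Proof.
move=> [_ L _ _] /eqP; rewrite cards_eq0 => /eqP E.
have := in_set0 v; rewrite -E inE /is_reticulation indegE outdegE.
by move: (L v); case: (lab v) => [[|i]|] /=; case; try case; move=> -> ->.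
Qed.

Lemma no_stop G r0 (d : deco G) e : net G -> nret G = 0 -> valid r0 d -> ~~ sp d e.
Proof.
move=> nG r G0; have ei : e \in ine (tgt e) by rewrite mem_ine.
have le1 := nret0_ine (tgt e) nG r; have [_ L _ _] := nG; have := L (tgt e).
case/okatP: (G0 (tgt e)).
- by move=> b Ei; rewrite Ei in ei.
- by move=> a j Ei; rewrite Ei inE in ei; rewrite (eqP ei).
- by move=> a Ei Eo _ -> _; rewrite Ei Eo /= => -[[]|[]].
- by move=> a c Ei; rewrite Ei inE in ei; rewrite (eqP ei).
- by move=> a b c dir x y Ei; rewrite Ei inE in ei; rewrite (eqP ei).
- by move=> a b c Ei; rewrite Ei inE in ei; rewrite (eqP ei).
- by move=> a b c Pi; rewrite (perm_size Pi) in le1.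
Qed.

Lemma noZ G r0 (d : deco G) e : net G -> nret G = 0 -> valid r0 d -> tm d e <> None.
Proof.
move=> nG r V; have [[rk Hrk] _ _ _] := nG.
have [m le_m] := ubnP (\max_w rk w - rk (tgt e)); elim: m => // m IH in e le_m *.
case: (hviewP e V).
- by move=> j _ _ ->.
- by rewrite (negbTE (no_stop e nG r V)).
- move=> c _ sc _ <- _; apply: IH; have := rkmax rk (tgt c).
  by have := Hrk c; rewrite sc; lia.
- by move=> b c dir x y [_ _ _ _ [_ _ ->]].
Qed.

Lemma connect_last G (x y : vertex G) : connect (@adj _ G) x y ->
  x = y \/ exists g, tgt g = y /\ connect (@adj _ G) x (src g).
Proof.
case/connectP=> p; case/lastP: p => [|p z]; first by move=> _ ->; left.
rewrite rcons_path last_rcons => /andP[Hp /existsP[g /andP[/eqP sg /eqP tg]]] ->.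
right; exists g; split=> //; rewrite sg; apply/connectP; by exists p.
Qed.

End Steps.

(** * Moving a component of a tree *)

Section Move.
Variable n : nat.
Local Notation lgr := (lgraph (label n)).
Local Notation bt := (bt n).
Implicit Types G H P T N M : lgr.

Definition chi P (f0 : edge P) (a : option (option (edge P))) : edge P :=
  if a is Some (Some z) then z else f0.

Lemma occ_ungraft r0 P f0 v (d0 : deco (@graft n P f0 v)) z0 p a :
  valid r0 d0 -> st d0 None -> occ d0 (Some (Some z0)) p a ->
  a <> None /\ occ (ungraft d0) z0 p (chi f0 a).
Proof.
move=> V sN; have [_ [spf stl] El _] := ungraft_semi V sN.
have step (b c : edge (graft f0 v)) : b <> None -> tgt b = src c -> ~~ sp d0 b -> ~~ st d0 c ->
   (c = Some None /\ b = Some (Some f0)) \/ exists y, [/\ c = Some (Some y), tgt (chi f0 b) = src y,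
      ~~ sp (ungraft d0) (chi f0 b), ~~ st (ungraft d0) y & tm (ungraft d0) (chi f0 b) = tm d0 b].
  case: c => [[y|]|]; last by rewrite sN.
    case: b => [[z|]|] //= _.
      case: eqP => // ne [E] sa sc; right; exists y; split=> //=.
      by rewrite /theta; case: eqP.
    by move=> [E] sa sc; right; exists y; split=> //=; rewrite /theta eqxx.
  by case: b => [[z|]|] //= _; case: eqP => // -> _ _ _; left.
elim=> {p a} [|p a c H [Na IH] ta sa sc Ec|p a c dir x y H [Na IH] ta sa sc Ea Ec].
- by split=> //; apply: occ0.
- case: (step a c) => // [[Qc Qa]|[y [Qc tz sz sy Ez]]]; subst c.
    by split=> //; move: IH; rewrite Qa.
  by split=> //; apply: (occP IH tz sz sy); rewrite Ez -Ec.
- case: (step a c) => // [[Qc Qa]|[z [Qc tz sz sy Ez]]]; subst c.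
    by move: Ec; rewrite El -Qa Ea => -[/bnode_neq].
  by split=> //; apply: (occB IH tz sz sy (dir := dir) (x := x) (y := y)); rewrite ?Ez.
Qed.

Lemma occ_graftd P (f : edge P) v X (d : deco P) z0 p z :
  occ d z0 p z -> occ (graftd f v X d) (Some (Some z0)) p (Some (Some z)).
Proof.
have step p' (a : edge P) : occ (graftd f v X d) (Some (Some z0)) p' (Some (Some a)) ->
   ~~ sp d a -> exists a' : edge (graft f v), [/\ occ (graftd f v X d) (Some (Some z0)) p' a',
     tgt a' = Some (tgt a), ~~ sp (graftd f v X d) a' & tm (graftd f v X d) a' = tm d a].
  move=> H sa; case: (eqVneq a f) => [Q|ne].
    subst a; exists (Some None); split=> //.
    by apply: (occP H); rewrite //= eqxx.
  by exists (Some (Some a)); split=> //=; rewrite (negbTE ne).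
elim=> {p z} [|p a c H IH ta sa sc Ec|p a c dir x y H IH ta sa sc Ea Ec].
- exact: occ0.
- have [a' [H' ta' sa' Ea']] := step _ _ IH sa.
  by apply: (occP H' _ sa' _) => //; rewrite ?Ea' // ta' ta.
- have [a' [H' ta' sa' Ea']] := step _ _ IH sa.
  by apply: (occB H' _ sa' _ (dir := dir) (x := x) (y := y)) => //; rewrite ?Ea' // ta' ta.
Qed.

Lemma graft_rootE P f v (x : vertex P) :
  ine (Some x : vertex (@graft n P f v)) = [::] <-> x <> v /\ ine x = [::].
Proof.
split.
- move=> E; have := perm_size (@graft_ineS n P f v x); rewrite E size_cat size_map.
  by case: eqP => //= ne; case: (ine x).
- move=> [/eqP ne E]; have := perm_size (@graft_ineS n P f v x).
  by rewrite E (negbTE ne) => /size0nil.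
Qed.

Lemma graft_root P f v : net (@graft n P f v) ->
  exists z : edge P, src z <> v /\ ine (src z) = [::].
Proof.
move=> nG; have [[[z|]|] E] := net_root_edge nG.
- by exists z; apply: (@graft_rootE P f v (src z)).1.
- by rewrite graft_ineN in E.
- by rewrite graft_ineN in E.
Qed.

(* The start edge [None] is lowest, so nothing else hangs below it and every
   other component can receive it. *)
Lemma regraft_tree P (f0 : edge P) v (d0 : deco (graft f0 v)) (rk0 : vertex (graft f0 v) -> nat)
    N r0 ts (dN : deco N) t :
  net (graft f0 v) -> nret (graft f0 v) = 0 -> net N -> nret N = 0 ->
  valid r0 d0 -> perm_eq (starts d0) ts -> st d0 None -> tm d0 None = Some t ->
  (forall f, rk0 (src f) < rk0 (tgt f)) ->
  (forall f, st d0 f -> rk0 (src f) <= rk0 (src (None : edge (graft f0 v)))) ->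
  valid r0 dN -> perm_eq (starts dN) ts ->
  exists f r1 ts1, [/\ ~~ edge_descendant v f, (size ts1).+1 = size ts,
    real (graft f v) r1 ts1 & real N r1 ts1].
Proof.
move=> n0 ret0 nN retN V0 P0 sN tN Hrk0 max0 VN PN.
have [[rkN HrkN] _ _ _] := nN; have nrN := fun v w => @net_root n N v w nN.
have [S0 [spf stl] El PU] := ungraft_semi V0 sN; rewrite tN /= in PU S0.
have regr f : ~~ edge_descendant v f -> exists rk', (forall e, rk' (src e) < rk' (@tgt _ (graft f v) e)) /\
    net (graft f v).
  by move=> nd; have nF := net_regraft n0 nd; have [[rk' ?] _ _ _] := nF; exists rk'.
have [g [sg tg]] : exists g, st dN g /\ tm dN g = Some t.
  apply: mem_starts; rewrite (perm_mem PN) -(perm_mem P0) (perm_mem PU) mem_head //.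
have nroot (z : edge P) : src z <> v -> ine (src z) = [::] -> ~~ edge_descendant v z.
  move=> ne E; apply/negP => /connect_last [Q|[h [th _]]]; first by rewrite Q in ne.
  by have := mem_ine (src z) h; rewrite E th eqxx.
case Erg: (ine (src g)) => [|ag sg'].
  have [r0N [VN1 PN1]] := attach_root nrN VN Erg sg tg; subst r0.
  have [z [nz Ez]] := graft_root n0; have nd := nroot _ nz Ez.
  have [rk' [Hrk' nF]] := regr z nd; have nrF := fun v w => @net_root n _ v w nF.
  have [V1 P1] := graftd_valid z S0.
  have Ez' : ine (src (Some (Some z) : edge (graft z v))) = [::] by apply/graft_rootE.
  have sz : st (graftd z v (Some t, sp d0 None) (ungraft d0)) (Some (Some z)).
    by have [_] := root_out V1 Ez'; case: ifP => // _ [_].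
  have [|||||||d2 [V2 P2 _ _ [t2 s2]]] := swap_at Hrk' nrF V1 sz (occ0 _ _) (g := None) (c := Some None);
    rewrite /= ?eqxx //.
  + exact: graft_ineN.
  + exact: graft_outeN.
  have [_ [V3 P3]] := attach_root nrF V2 Ez' s2 t2.
  move: P3 V3 PN1 VN1; set d3 := Deco _ _ _; set dN1 := Deco _ _ _ => P3 V3 PN1 VN1.
  exists z, (Some t), (starts dN1); split=> //; last by exists dN1.
    by rewrite -(perm_size PN) (perm_size PN1).
  exists d3; split=> //.
  have : perm_eq (t :: starts d3) (t :: starts dN1).
    rewrite perm_sym in P3; rewrite (perm_trans P3) // (perm_trans P2) // (perm_trans P1) //=.
    rewrite perm_sym in PU; rewrite (perm_trans PU) // (perm_trans P0) // perm_sym.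
    by rewrite perm_sym in PN1; rewrite (perm_trans PN1).
  by rewrite perm_cons.
have [a [c [Eia Po nec [sa sc] Eca]]] : exists a c, [/\ ine (tgt a) = [:: a],
    perm_eq (oute (tgt a)) [:: g; c], g != c, ~~ sp dN a /\ ~~ st dN c & tm dN c = tm dN a].
  have go : g \in oute (src g) by rewrite mem_oute.
  have ta a s : ine (src g) = a :: s -> tgt a = src g.
    by move=> E; apply/eqP; rewrite -mem_ine E mem_head.
  case/okatP: (VN (src g)).
  + by move=> b E; rewrite E in Erg.
  + by move=> b j _ E; rewrite E in go.
  + by move=> b _ E; rewrite E in go.
  + by move=> b c _ E _ nc; move: go; rewrite E inE => /eqP Q; rewrite -Q sg in nc.
  + move=> a b c dir x y Ei Po _ _ nb nc; move: go; rewrite (perm_mem Po) !inE.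
    by case/orP=> /eqP Q; rewrite -Q sg in nb nc.
  + move=> a b c Ei Po ne sa sb nc E; move: go; rewrite (perm_mem Po) !inE.
    case/orP=> /eqP Q; last by rewrite -Q sg in nc.
    by subst b; exists a, c; rewrite (ta _ _ Ei).
  + by move=> a b c _ E _ _ _ _ nc; move: go; rewrite E inE => /eqP Q; rewrite -Q sg in nc.
case Ea: (tm dN a) => [s|]; last by case: (noZ nN retN VN Ea).
have [e0 [p [T0 H]]] := top_exists HrkN a VN.
have := occ_sub H; rewrite Ea; case E0: (tm dN e0) => [s0|]; last by case: (p).
rewrite osub_Some => Es.
have [r1 [ts0 [ts1 [dN' [VN' PN' C PN1]]]]] :=
  merge_at HrkN nrN VN T0 H Eia Po nec sa sg sc Eca tg Ea E0.
have PU' : perm_eq (starts (ungraft d0)) ts0.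
  have : perm_eq (t :: starts (ungraft d0)) (t :: ts0).
    rewrite perm_sym in PU; rewrite (perm_trans PU) // (perm_trans P0) //.
    by rewrite perm_sym in PN; rewrite (perm_trans PN).
  by rewrite perm_cons.
have ndv f : st d0 f -> ~~ connect (@adj _ (graft f0 v)) (Some v) (src f).
  move=> sf; apply/negP => /(rk_connect Hrk0); rewrite leqNgt => /negP; apply.
  exact: leq_ltn_trans (max0 f sf) (Hrk0 None).
have ndr f : ine (src f) = [::] -> ~~ connect (@adj _ (graft f0 v)) (Some v) (src f).
  move=> E; apply/negP => /connect_last [Q|[h [th _]]].
    have : (None : edge (graft f0 v)) \in ine (src f) by rewrite mem_ine; apply/eqP; exact: Q.
    by rewrite E.
  by have := mem_ine (src f) h; rewrite E th eqxx.
have [z0 [tz sz nz rz]] : exists z0, [/\ tm (ungraft d0) z0 = Some s0,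
    st (ungraft d0) z0 = st dN e0,
    ~~ connect (@adj _ (graft f0 v)) (Some v) (src (Some (Some z0) : edge (graft f0 v)))
  & ~~ st dN e0 -> src z0 <> v /\ ine (src z0) = [::]].
  move: C; rewrite /replace_comp; case: (st dN e0) => [[R [_ Q1 _]]|[rE _ _]].
    have : s0 \in starts (ungraft d0) by rewrite (perm_mem PU') (perm_mem Q1) mem_head.
    by case/mem_starts => z0 [sz tz]; exists z0; split=> //; apply: ndv.
  have [z0 [nz Ez]] := graft_root n0.
  have Ez' : ine (src (Some (Some z0) : edge (graft f0 v))) = [::] by apply/graft_rootE.
  have [_] := root_out V0 Ez'; rewrite rE; case: ifP => // sz [tz _].
  by exists z0; split=> //; apply: ndr.
have [a1 [H1 Ea1]] := descend Hrk0 V0 (tz : tm d0 (Some (Some z0)) = Some s0) Es.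
have Q1 : ~~ connect (@adj _ (graft f0 v)) (Some v) (src a1).
  have stepQ (b c' : edge (graft f0 v)) : b <> None -> tgt b = src c' ->
     ~~ connect (@adj _ (graft f0 v)) (Some v) (src b) ->
     ~~ connect (@adj _ (graft f0 v)) (Some v) (src c').
    move=> nb tb nc'; apply/negP => /connect_last.
    have u (h : edge (graft f0 v)) : tgt h = src c' -> h = b.
      move=> th; have := nret0_ine (src c') n0 ret0.
      have : h \in ine (src c') by rewrite mem_ine th.
      have : b \in ine (src c') by rewrite mem_ine tb.
      by case: (ine (src c')) => [|? []] //; rewrite !inE => /eqP -> /eqP ->.
    case=> [Q|[h [/u -> ]]]; last by rewrite (negbTE nc').
    by apply: nb; apply/esym/u; rewrite -Q.
  elim: H1 {Ea1} => {p Es H C a1} [//|p b c' H IH tb _ _ _|p b c' dir x y H IH tb _ _ _ _];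
    by apply: stepQ tb IH; have [] := occ_ungraft V0 sN H.
have [na1 H2] := occ_ungraft V0 sN H1.
have nd : ~~ edge_descendant v (chi f0 a1).
  apply/negP => cn; have lift x y : connect (@adj _ P) x y ->
      connect (@adj _ (graft f0 v)) (Some x) (Some y).
    case/connectP=> q + ->; elim: q x => [|z q IH] x /=; first by rewrite connect0.
    case/andP=> /existsP[h /andP[/eqP <- /eqP <-]] /IH; apply: connect_trans.
    case: (eqVneq h f0) => [->|nh].
      apply: (connect_trans (y := None)); apply: connect1; apply/existsP.
        by exists (Some (Some f0)); rewrite /= !eqxx.
      by exists (Some None); rewrite /= !eqxx.
    by apply/connect1/existsP; exists (Some (Some h)); rewrite /= (negbTE nh) !eqxx.
  move: Q1; case: (a1) na1 cn => [[z|]|] //= _ /lift cn; first by rewrite cn.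
  rewrite (connect_trans cn) //; apply/connect1/existsP.
  by exists (Some (Some f0)); rewrite /= !eqxx.
move: (chi f0 a1) H2 nd => f H2 nd.
have [rk' [Hrk' nF]] := regr f nd; have nrF := fun v w => @net_root n _ v w nF.
have [V1 P1] := graftd_valid f S0.
move: V1 P1 (@occ_graftd P f v (Some t, sp d0 None) _ _ _ _ H2).
set d1 := graftd _ _ _ _ => V1 P1 H3.
have Ef : tm (ungraft d0) f = Some s.
  by have := occ_sub H2; rewrite tz osub_Some Es => ->.
have T1 : top d1 (Some (Some z0)).
  rewrite /top; change (st d1 (Some (Some z0))) with (st (ungraft d0) z0); rewrite sz.
  by case st0: (st dN e0) rz => //= /(_ isT) Q; apply/eqP/graft_rootE.
have [||||||||||r1' [ts0' [ts1' [d2 [V2 P2 C2 PP2]]]]] :=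
  merge_at Hrk' nrF V1 T1 H3 (g := None) (c := Some None) (s := s) (t := t) (s0 := s0);
  rewrite /= ?eqxx //.
+ exact: graft_ineN.
+ exact: graft_outeN.
have PT0 : perm_eq ts0' ts0.
  have : perm_eq (t :: ts0') (t :: ts0).
    rewrite perm_sym in P2; rewrite (perm_trans P2) // (perm_trans P1) //= perm_cons //.
  by rewrite perm_cons.
rewrite (_ : st d1 (Some (Some z0)) = st dN e0) in C2; last exact: sz.
have [Er Pt] := replace_comp_det C2 C PT0.
exists f, r1, ts1; split=> //; last by exists dN'.
  by rewrite (replace_comp_size C) -(perm_size PN) (perm_size PN').
by exists d2; split; [rewrite -Er|apply: perm_trans PP2 Pt].
Qed.

Lemma move_tree T N r0 ts k : net T -> net N -> nret T = 0 -> nret N = 0 ->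
  real T r0 ts -> real N r0 ts -> size ts = k.+1 ->
  exists T' r1 ts1, [/\ net T', nret T' = 0, T' = T \/ snpr T T', size ts1 = k
    & real T' r1 ts1 /\ real N r1 ts1].
Proof.
move=> nT nN rT rN [dT [VT PT]] [dN [VN PN]] sz.
have [[rk Hrk] LT _ _] := nT; have [[rkN HrkN] LN _ _] := nN.
have [e1 se1] : exists e1, st dT e1.
  case: ts PT PN sz => // t ts PT _ _.
  by have [|e1 [? _]] := @mem_starts n T dT t; [rewrite (perm_mem PT) mem_head|exists e1].
case: (arg_maxnP (fun e => rk (src e)) se1) => e se maxe {e1 se1}.
case Et: (tm dT e) => [t|]; last by case: (noZ nT rT VT Et).
have tts : t \in ts.
  by rewrite -(perm_mem PT) mem_pmap; apply/mapP; exists e; rewrite ?mem_enum // /start_term se.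
case Ere: (ine (src e)) => [|a0 s0].
  have [r0N _] := attach_root (fun v w => net_root nT) VT Ere se Et; subst r0.
  have [_ [V1 P1]] := attach_root (fun v w => net_root nT) VT Ere se Et.
  have uniqs f : st dT f -> f = e.
    move=> sf; case Ef: (ine (src f)) => [|g s].
      have Q := net_root nT Ef Ere; have [Eo _] := root_out VT Ere.
      have : f \in oute (src e) by rewrite mem_oute Q.
      by rewrite Eo inE => /eqP.
    have := maxe f sf; have /= := @root_child_min n T rk _ dT e (src f) nT Hrk VT Ere.
    by rewrite Ef => /(_ ltac:(by [])); have := Hrk e; lia.
  move: P1 V1; set d1 := Deco _ _ _ => P1 V1.
  have s1 : starts d1 = [::].
    rewrite /starts; elim: (enum _) => //= f s ->; rewrite /start_term /= /upd.
    by case: (eqVneq f e) => // ne; case: ifP => // /uniqs Q; rewrite Q eqxx in ne.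
  have Pt : perm_eq ts [:: t].
    by rewrite s1 in P1; rewrite perm_sym in PT; apply: perm_trans PT P1.
  have [b Eb] := net_root_edge nN.
  have sb : st dN b.
    by have [_] := root_out VN Eb; case: ifP => // _ [_].
  have Etb : tm dN b = Some t.
    case E: (tm dN b) => [t'|]; last by case: (noZ nN rN VN E).
    have : t' \in starts dN.
      by rewrite mem_pmap; apply/mapP; exists b; rewrite ?mem_enum // /start_term sb.
    by rewrite (perm_mem PN) (perm_mem Pt) inE => /eqP ->.
  have [_ [V2 P2]] := attach_root (fun v w => net_root nN) VN Eb sb Etb.
  have kz : k = 0 by move: (perm_size Pt); rewrite sz => -[].
  exists T, (Some t), [::]; split=> //; [by left|split].
    by exists d1; rewrite s1.
  eexists; split; first exact: V2.
  have : perm_eq (t :: starts (Deco (tm dN) (upd (st dN) b false) (sp dN))) [:: t].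
    by rewrite perm_sym in P2; apply: perm_trans P2 (perm_trans PN Pt).
  by rewrite perm_cons.
have nre : ine (src e) <> [::] by rewrite Ere.
have noe : oute (src e) <> [::].
  by move=> E; have := mem_oute (src e) e; rewrite E eqxx.
have [si so] : size (ine (src e)) = 1 /\ size (oute (src e)) = 2.
  by apply: net_inner => //; have := nret0_ine (src e) nT rT; lia.
have lu : lab (src e) = None.
  by move: (LT (src e)); rewrite si so; case: (lab (src e)) => [[|i]|] //= [].
have [p [c [v [S Ev]]]] := prune_exists (ex_intro _ rk Hrk) si so.
have [fV [fE [I EN]]] := prune_iso lu S Ev.
have mkmove f : ~~ @edge_descendant _ (suppress p c) v f -> snpr T (graft f v).
  move=> nd; apply: Or31; exists e; split.
  - by rewrite /is_tree_vertex /is_inner indegE outdegE si so.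
  - by rewrite /is_root indegE si.
  - by exists p, c; split=> //; exists v, f; split=> //; apply: iso_refl.
have II : isomorphic (graft (None : edge (suppress p c)) v) T by exists fV, fE.
have n0 := net_iso (iso_sym II) nT.
have [V0 P0] := pull_valid I VT.
have [_ _ Is It _] := I.
have r0' : nret (graft (None : edge (suppress p c)) v) = 0.
  by rewrite -rT; apply: net_nret_edges => //; apply: iso_card.
have [|||||||f [r1 [ts1 [nd s1 R1 R2]]]] :=
  @regraft_tree _ _ _ (pull fE dT) (rk \o fV) N r0 ts dN t n0 r0' nN rN V0.
- exact: perm_trans P0 PT.
- by rewrite /= EN.
- by rewrite /= EN.
- by move=> f /=; rewrite -Is -It.
- by move=> f /= sf; rewrite -(Is None) -Is EN; apply: maxe.
- exact: VN.
- exact: PN.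
have n1 := net_regraft n0 nd.
have r1' : nret (graft f v) = 0.
  rewrite -r0'; apply: (net_nret_edges n1 n0); exact: etrans (card_graft _ _) (esym (card_graft _ _)).
have mv := mkmove f nd.
have s1' : size ts1 = k by move: s1; rewrite sz => -[].
exists (graft f v), r1, ts1; exact: And5 n1 r1' (or_intror mv) s1' (conj R1 R2).
Qed.

End Move.

(** * Term graphs and topological embeddings *)

Section TermGraph.
Variable n : nat.
Local Notation lgr := (lgraph (label n)).
Local Notation bt := (bt n).

Fixpoint VT (t : bt) : finType :=
  match t with BLeaf _ => unit | BNode s1 s2 => option (VT s1 + VT s2)%type end.

Fixpoint topT (t : bt) : VT t :=
  match t return VT t with BLeaf _ => tt | BNode s1 s2 => None end.

Fixpoint par (t : bt) : VT t -> option (VT t) :=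
  match t return VT t -> option (VT t) with
  | BLeaf _ => fun _ => None
  | BNode s1 s2 => fun z => match z with
     | None => None
     | Some (inl x) => Some (omap inl (par x))
     | Some (inr y) => Some (omap inr (par y))
     end
  end.

Fixpoint labT (t : bt) : VT t -> option (label n) :=
  match t return VT t -> option (label n) with
  | BLeaf i => fun _ => Some (Taxon i)
  | BNode s1 s2 => fun z => match z with
     | None => None | Some (inl x) => labT x | Some (inr y) => labT y end
  end.

Fixpoint dep (t : bt) : VT t -> nat :=
  match t return VT t -> nat with
  | BLeaf _ => fun _ => 1
  | BNode s1 s2 => fun z => match z with
     | None => 1 | Some (inl x) => (dep x).+1 | Some (inr y) => (dep y).+1 end
  end.

Definition term_graph (l0 : option (label n)) (t : bt) : lgr :=
  @LGraph _ (option (VT t)) (VT t) (@par t) Some (fun o => if o is Some z then labT z else l0).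

Lemma par_top t (x : VT t) : par x = None <-> x = topT t.
Proof.
case: t x => [i []|s1 s2 [[x|x]|]] //=.
Qed.

Lemma dep_par t (x : VT t) : (if par x is Some y then dep y else 0) < dep x.
Proof.
elim: t x => [i []|s1 IH1 s2 IH2 [[x|x]|]] //=.
  by have := IH1 x; case: (par x).
by have := IH2 x; case: (par x).
Qed.

Lemma kids t (z : VT t) :
  (exists2 i, labT z = Some (Taxon i) & forall x : VT t, par x <> Some z) \/
  (labT z = None /\ exists b c, b <> c /\ forall x : VT t, par x = Some z <-> x = b \/ x = c).
Proof.
elim: t z => [i []|s1 IH1 s2 IH2 [[z|z]|]] /=.
- by left; exists i.
- case: (IH1 z) => [[i Ez H]|[Ez [b [c [ne H]]]]].
    left; exists i => // -[[x|x]|] //=; last by case: (par x).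
    by case E: (par x) => [y|] //= [Q]; apply: (H x); rewrite E Q.
  right; split=> //; exists (Some (inl b)), (Some (inl c)); split; first by case.
  move=> [[x|x]|]; split; try by case.
  + case E: (par x) => [y|] //= [Q]; have /H [->|->] : par x = Some z by rewrite E Q.
      by left.
    by right.
  + by move=> Q; have -> : par x = Some z by apply/H; case: Q => [] [->]; [left|right].
  + by case: (par x).
- case: (IH2 z) => [[i Ez H]|[Ez [b [c [ne H]]]]].
    left; exists i => // -[[x|x]|] //=; first by case: (par x).
    by case E: (par x) => [y|] //= [Q]; apply: (H x); rewrite E Q.
  right; split=> //; exists (Some (inr b)), (Some (inr c)); split; first by case.
  move=> [[x|x]|]; split; try by case.
  + by case: (par x).
  + case E: (par x) => [y|] //= [Q]; have /H [->|->] : par x = Some z by rewrite E Q.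
      by left.
    by right.
  + by move=> Q; have -> : par x = Some z by apply/H; case: Q => [] [->]; [left|right].
- right; split=> //; exists (Some (inl (topT s1))), (Some (inr (topT s2))); split=> //.
  move=> [[x|x]|]; split; try by case.
  + by case E: (par x) => [y|] //= _; left; rewrite ((par_top x).1 E).
  + by case=> [[->]|//]; rewrite ((par_top _).2 erefl).
  + by case E: (par x) => [y|] //= _; right; rewrite ((par_top x).1 E).
  + by case=> [//|[->]]; rewrite ((par_top _).2 erefl).
Qed.

Lemma term_graph_ineN l0 t : ine (None : vertex (term_graph l0 t)) = [::].
Proof.
apply/size0nil/eqP; rewrite -leqn0 leqNgt -has_predT; apply/negP => /hasP[e].
by rewrite mem_ine.
Qed.

Lemma term_graph_ineS l0 t (z : VT t) : ine (Some z : vertex (term_graph l0 t)) = [:: z].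
Proof.
apply: perm1; rewrite perm_sym; apply: uniq_perm; rewrite ?uniq_ine // => e.
by rewrite mem_ine inE /= (inj_eq (@Some_inj _)).
Qed.

Lemma term_graph_outeN l0 t : oute (None : vertex (term_graph l0 t)) = [:: topT t].
Proof.
apply: perm1; rewrite perm_sym; apply: uniq_perm; rewrite ?uniq_oute // => e.
by rewrite mem_oute inE /=; apply/eqP/eqP => /par_top.
Qed.

Lemma term_graph_outeS l0 t (z : VT t) :
  (exists2 i, labT z = Some (Taxon i) & oute (Some z : vertex (term_graph l0 t)) = [::]) \/
  (labT z = None /\ exists b c, b != c /\ perm_eq (oute (Some z : vertex (term_graph l0 t))) [:: b; c]).
Proof.
case: (kids z) => [[i Ez H]|[Ez [b [c [/eqP ne H]]]]].
  left; exists i => //; apply/size0nil/eqP; rewrite -leqn0 leqNgt -has_predT.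
  by apply/negP => /hasP[e]; rewrite mem_oute => /eqP /H.
right; split=> //; exists b, c; split=> //; apply: uniq_perm; rewrite ?uniq_oute //.
  by rewrite /= inE ne.
move=> e; rewrite mem_oute !inE; apply/eqP/orP.
  by move/H => [->|->]; rewrite eqxx; [left|right].
by move=> Q; apply/H; case: Q => /eqP ->; [left|right].
Qed.

Lemma term_graph_tree l0 t : l0 = None \/ l0 = Some Rho ->
  (forall (x y : VT t) i, labT x = Some (Taxon i) -> labT y = Some (Taxon i) -> x = y) ->
  phylo_tree (term_graph l0 t).
Proof.
move=> l0E U.
have degN : indeg (None : vertex (term_graph l0 t)) = 0 /\ outdeg (None : vertex (term_graph l0 t)) = 1.
  by rewrite indegE outdegE term_graph_ineN term_graph_outeN.
have degS (z : VT t) : indeg (Some z : vertex (term_graph l0 t)) = 1 /\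
    ((exists2 i, labT z = Some (Taxon i) & outdeg (Some z : vertex (term_graph l0 t)) = 0) \/
     (labT z = None /\ outdeg (Some z : vertex (term_graph l0 t)) = 2)).
  rewrite indegE outdegE term_graph_ineS; split=> //.
  case: (term_graph_outeS l0 z) => [[i Ez ->]|[Ez [b [c [_ /perm_size ->]]]]]; last by right.
  by left; exists i.
split; [split|].
- apply/acyclicP; exists (fun o : option (VT t) => if o is Some z then dep z else 0) => e /=.
  exact: dep_par.
- exists None; split; first by rewrite /is_root degN.1 degN.2.
  by case=> [z|//]; rewrite /is_root (degS z).1.
- case=> [z|]; rewrite /is_root /is_leaf /is_inner ?degN.1 ?degN.2 // (degS z).1.
  by case: (degS z).2 => [[i _ ->]|[_ ->]].
- case=> [z|]; rewrite /is_root /is_leaf /is_inner /is_reticulation ?degN.1 ?degN.2 ?(degS z).1 /=.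
    by case: (degS z).2 => [[i Ez ->]|[Ez ->]]; split=> // _; rewrite Ez //; exists i.
  by split=> // _; case: l0E => ->; [right|left].
- move=> [x|] [y|] i //=; try by case: l0E => ->.
  by move=> Ex Ey; rewrite (U _ _ _ Ex Ey).
- by case=> [z|]; rewrite /is_reticulation ?degN.1 ?(degS z).1.
Qed.

End TermGraph.

Section TopologicalEmbedding.
Variable n : nat.
Local Notation lgr := (lgraph (label n)).

Definition shead (T : Type) (s : seq T) : s <> [::] -> T :=
  match s with [::] => fun H => False_rect T (H erefl) | x :: _ => fun _ => x end.

Definition walkrel (G : lgr) : rel (edge G) := fun e f => tgt e == src f.

Record topo_emb (H G : lgr) (tE : edge H -> seq (edge G)) (tV : vertex H -> vertex G) : Prop := TopoEmb {
  te_path : forall x, exists e q, [/\ tE x = e :: q, src e = tV (src x),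
     path (@walkrel G) e q & tgt (last e q) = tV (tgt x)];
  te_disj : forall x y f, f \in tE x -> f \in tE y -> x = y;
  te_uniq : forall x, uniq (tE x);
  te_lab : forall v l, lab v = Some l -> lab (tV v) = Some l;
  te_in : forall x y f g, f \in tE x -> g \in tE y -> tgt f = tgt g -> f = g;
  te_src : forall v, (forall x, tgt x <> v) ->
     (forall x f, f \in tE x -> tgt f <> tV v) /\ forall w, (forall x, tgt x <> w) -> v = w
}.

Lemma topo_emb_card (H G : lgr) tE tV : @topo_emb H G tE tV -> #|edge H| <= #|edge G|.
Proof.
move=> E; have ne x : tE x <> [::] by have [e [q [-> _ _ _]]] := te_path E x.
have inj : injective (fun x => shead (ne x)).
  have hin x : shead (ne x) \in tE x by case: (tE x) (ne x) => //= e q _; rewrite mem_head.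
  by move=> x y Q; apply: (te_disj E (hin x)); rewrite Q.
exact: leq_card inj.
Qed.

Lemma topo_emb_subdivide (H G : lgr) tE tV x e e' q : @topo_emb H G tE tV -> tE x = e :: e' :: q ->
  @topo_emb (subdivide x) G
    (fun o => match o with None => e' :: q | Some y => if y == x then [:: e] else tE y end)
    (fun o => match o with None => tgt e | Some v => tV v end).
Proof.
move=> E Ex.
have [e1 [q1 [Q Hs Hp Ht]]] := te_path E x; move: Q; rewrite Ex => -[? ?]; subst e1 q1.
have inx : forall o f, f \in (match o with None => e' :: q
    | Some y => if y == x then [:: e] else tE y end) ->
    f \in tE (if o is Some y then y else x).
  case=> [y|] f; last by move=> Q; rewrite Ex in_cons Q orbT.
  by case: eqP => [->|//]; rewrite Ex !inE => ->.
have ux := te_uniq E x; rewrite Ex /= in ux.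
have [eq' _] := andP ux.
split.
- case=> [y|] /=.
    case: (eqVneq y x) => [->|ne]; first by exists e, [::].
    have [e1 [q1 [? ? ? ?]]] := te_path E y; exists e1, q1; split=> //.
  by move: Hp => /= /andP[/eqP We Wq]; exists e', q; split=> //; rewrite We.
- move=> o o' f Hf Hf'; have Q := te_disj E (inx _ _ Hf) (inx _ _ Hf').
  case: o o' Hf Hf' Q => [y|] [y'|] //= Hf Hf' Q; subst.
  + by [].
  + by move: Hf; rewrite eqxx inE => /eqP Q; rewrite Q (negbTE eq') in Hf'.
  + by move: Hf'; rewrite eqxx inE => /eqP Q; rewrite Q (negbTE eq') in Hf.
- case=> [y|]; last by case/andP: ux.
  by case: eqP => // _; apply: te_uniq E _.
- by case=> [v|] l //=; apply: te_lab E _ _.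
- by move=> o o' f g /inx Hf /inx Hg; apply: te_in E _ _ _ _ Hf Hg.
- case=> [v|] Hv; last by case: (Hv (Some x)); rewrite /= eqxx.
  have Hv' y : tgt y <> v.
    move=> Q; case: (eqVneq y x) => [Q2|ne].
      by apply: (Hv None); rewrite /= -Q2 Q.
    by apply: (Hv (Some y)); rewrite /= (negbTE ne) Q.
  have [H1 H2] := te_src E Hv'; split; first by move=> o f /inx; apply: H1.
  case=> [w|] Hw; last by case: (Hw (Some x)); rewrite /= eqxx.
  rewrite (H2 w) // => y Q; case: (eqVneq y x) => [Q2|ne].
    by apply: (Hw None); rewrite /= -Q2 Q.
  by apply: (Hw (Some y)); rewrite /= (negbTE ne) Q.
Qed.

Lemma topo_emb_sub (H G : lgr) tE tV : @topo_emb H G tE tV ->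
  exists S (h : subgraph_emb S G), is_subdivision H S /\
    forall f, (exists x, embE h x = f) <-> exists x, f \in tE x.
Proof.
have [m le_m] := ubnP (#|edge G| - #|edge H|).
have : is_subdivision H H by constructor.
move: {1 4}H => H0; elim: m => // m IH in H tE tV le_m * => HH E.
case: (pickP (fun x => 1 < size (tE x))) => [x|sz].
  case Ex: (tE x) => [|e [|e' q]] // _.
  have E' := topo_emb_subdivide E Ex.
  have [||S [h [HS Hf]]] := IH _ _ _ _ _ E'.
  - by have := topo_emb_card E'; rewrite card_option; move: le_m; lia.
  - exact: subdivision_step.
  exists S, h; split=> // f; split=> [/Hf [[y|]]|[y Hy]].
  + by case: eqP => [_|_ ?]; [rewrite inE => /eqP ->; exists x; rewrite Ex mem_head|exists y].
  + by move=> Q; exists x; rewrite Ex in_cons Q orbT.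
  + apply/Hf; case: (eqVneq y x) Hy => [->|ne] Hy; last by exists (Some y); rewrite (negbTE ne).
    by move: Hy; rewrite Ex in_cons => /orP[/eqP ->|Q]; [exists (Some x); rewrite eqxx mem_head|exists None].
have ne x : tE x <> [::] by have [e [q [-> _ _ _]]] := te_path E x.
have hE x : tE x = [:: shead (ne x)].
  by case: (tE x) (ne x) (sz x) => [|e [|e' q]].
pose hd x := shead (ne x).
have hs x : src (hd x) = tV (src x).
  by have [e [q [Q <- _ _]]] := te_path E x; move: Q; rewrite hE => -[<- _].
have ht x : tgt (hd x) = tV (tgt x).
  by have [e [q [Q _ _ <-]]] := te_path E x; move: Q; rewrite hE => -[<- <-].
have hin x : hd x \in tE x by rewrite hE mem_head.
have hI : injective hd by move=> x y Q; apply: (te_disj E (hin x)); rewrite Q.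
have tgtP (v : vertex H) : (exists x, tgt x = v) \/ forall x, tgt x <> v.
  case: (pickP (fun x => tgt x == v)) => [x /eqP|nx]; first by left; exists x.
  by right=> x /eqP; rewrite nx.
have vI : injective tV.
  move=> v w Q; case: (tgtP v) => [[x Ex]|Hv]; last first.
    have [H1 H2] := te_src E Hv; case: (tgtP w) => [[y Ey]|]; last exact: H2.
    by case: (H1 _ _ (hin y)); rewrite ht Ey.
  case: (tgtP w) => [[y Ey]|Hw].
    rewrite -Ex -Ey; congr tgt; apply: hI; apply: (te_in E (hin x) (hin y)).
    by rewrite !ht Ex Ey.
  by have [H1 _] := te_src E Hw; case: (H1 _ _ (hin x)); rewrite ht Ex.
exists H, (SubgraphEmb vI hI hs ht (te_lab E)); split=> // f; split=> -[x] /=.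
  by move=> <-; exists x; apply: hin.
by rewrite hE inE => /eqP ->; exists x.
Qed.

End TopologicalEmbedding.

(** * Components of a decoration *)

Section Components.
Variable n : nat.
Local Notation lgr := (lgraph (label n)).
Local Notation bt := (bt n).
Variables (G : lgr) (rk : vertex G -> nat).
Hypothesis Hrk : forall e : edge G, rk (src e) < rk (tgt e).
Variables (r0 : option bt) (d : deco G).
Hypothesis V : valid r0 d.
Implicit Types (a b c e f g : edge G).

Definition stp : rel (edge G) := fun e f => [&& tgt e == src f, ~~ sp d e & ~~ st d f].
Local Notation desc := (connect stp).

Lemma desc_first e f : desc e f -> e = f \/ exists2 c, stp e c & desc c f.
Proof.
case/connectP=> -[|c p] /=; first by move=> _ ->; left.
by case/andP=> sc Hp Q; right; exists c => //; apply/connectP; exists p.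
Qed.

Lemma desc_last e f : desc e f -> e = f \/ exists2 a, desc e a & stp a f.
Proof.
case/connectP=> p; case/lastP: p => [|p z]; first by move=> _ ->; left.
rewrite rcons_path last_rcons => /andP[Hp Hs] ->; right.
by exists (last e p) => //; apply/connectP; exists p.
Qed.

Lemma desc_rk e f : desc e f -> e = f \/ rk (tgt e) <= rk (src f).
Proof.
case/connectP=> p; elim: p e => [|c p IH] e /=; first by move=> _ ->; left.
case/andP=> /and3P[/eqP Q _ _] Hp El; right; rewrite Q.
by case: (IH c Hp El) => [->//|]; have := Hrk c; lia.
Qed.

Lemma desc_rk_src e f : desc e f -> rk (src e) <= rk (src f).
Proof. by case/desc_rk => [->//|]; have := Hrk e; lia. Qed.

Lemma stp_uniq a a' f : stp a f -> stp a' f -> a = a'.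
Proof.
move=> /and3P[/eqP ta sa sf] /and3P[/eqP ta' sa' _].
case: (uviewP f V).
- rewrite /top (negbTE sf) => /eqP E; have := mem_ine (src f) a.
  by rewrite E ta eqxx.
- by move=> b _ _ _ _ u; exact: etrans (u a ta sa) (esym (u a' ta' sa')).
- move=> b c dir x y tb [Ei _ _ _ _].
  have u h : tgt h = src f -> h = b.
    by rewrite -tb => Q; apply/eqP; have := mem_ine (tgt b) h; rewrite Ei inE Q eqxx.
  exact: etrans (u a ta) (esym (u a' ta')).
Qed.

Lemma desc_comp b c f : desc b f -> desc c f -> desc b c \/ desc c b.
Proof.
have [m le_m] := ubnP (rk (src f)); elim: m => // m IH in f le_m *.
move=> Hb Hc; case: (desc_last Hb) => [Q|[a Ha Sa]]; first by right; rewrite Q.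
case: (desc_last Hc) => [Q|[a' Ha' Sa']]; first by left; rewrite Q.
have Q := stp_uniq Sa Sa'; subst a'; apply: (IH a) => //.
by case/and3P: Sa => /eqP Q _ _; have := Hrk a; rewrite Q; lia.
Qed.

Lemma desc_top e0 f : top d f -> desc e0 f -> e0 = f.
Proof.
move=> T /desc_last [//|[a _ /and3P[/eqP ta _ sf]]].
move: T; rewrite /top (negbTE sf) => /eqP E; have := mem_ine (src f) a.
by rewrite E ta eqxx.
Qed.

Lemma top_uniq e0 e1 f : top d e0 -> top d e1 -> desc e0 f -> desc e1 f -> e0 = e1.
Proof.
move=> T0 T1 H0 H1; case: (desc_comp H0 H1) => [/(desc_top T1)|/(desc_top T0)] //.
Qed.

Lemma desc_tm e f : desc e f -> (tm d e = None) <-> (tm d f = None).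
Proof.
case/connectP=> p; elim: p e => [|c p IH] e /=; first by move=> _ ->.
case/andP=> /and3P[/eqP tc se sc] Hp El; rewrite -(IH c Hp El).
case: (hviewP e V).
- move=> j _ _ _ Eo; have := mem_oute (tgt e) c; rewrite Eo tc eqxx //.
- by rewrite (negbTE se).
- by move=> c' _ _ _ <- u; rewrite (u c).
- move=> b c' dir x y [_ Po _ _ [Eb Ec Ee]].
  have : c \in oute (tgt e) by rewrite mem_oute tc.
  by rewrite (perm_mem Po) !inE => /orP[] /eqP ->; rewrite Ee ?Eb ?Ec.
Qed.

Definition terminal a := [\/
  exists j, [/\ ~~ sp d a, lab (tgt a) = Some (Taxon j), tm d a = Some (BLeaf j)
     & oute (tgt a) = [::]],
  sp d a /\ tm d a = None
| exists b c dir x y, brdata d a b c dir x y].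

Lemma chain e : exists q, [/\ path (@walkrel n G) e q, uniq (e :: q),
  forall f, f \in e :: q -> desc e f /\ desc f (last e q),
  terminal (last e q) /\ tm d (last e q) = tm d e
  & forall f, desc e f -> f \in e :: q \/ exists2 c, stp (last e q) c & desc c f].
Proof.
have [m le_m] := ubnP (\max_w rk w - rk (tgt e)); elim: m => // m IH in e le_m *.
have fin : terminal e -> exists q, [/\ path (@walkrel n G) e q, uniq (e :: q),
  forall f, f \in e :: q -> desc e f /\ desc f (last e q),
  terminal (last e q) /\ tm d (last e q) = tm d e
  & forall f, desc e f -> f \in e :: q \/ exists2 c, stp (last e q) c & desc c f].
  move=> Te; exists [::]; split=> //= f; first by rewrite inE => /eqP ->.
  by case/desc_first=> [->|]; [left; rewrite mem_head|right].
case: (hviewP e V).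
- by move=> j *; apply: fin; apply: Or31; exists j.
- by move=> *; apply: fin; apply: Or32.
- move=> c se sc nc Ec u.
  have S1 : stp e c by rewrite /stp sc eqxx se nc.
  have [|q [Hp Hu Hd [Ht Hm] Hc]] := IH c.
    by have := Hrk c; have := rkmax rk (tgt c); rewrite sc; lia.
  exists (c :: q); split=> //=.
  + by rewrite /walkrel sc eqxx.
  + rewrite -/(uniq (c :: q)) Hu andbT; apply/negP => /Hd [/desc_rk_src + _].
    by rewrite sc; have := Hrk e; lia.
  + move=> f; rewrite in_cons => /orP[/eqP ->|/Hd [H1 H2]].
      have [_ H2] := Hd c (mem_head _ _); split=> //.
      exact: connect_trans (connect1 S1) H2.
    by split=> //; apply: connect_trans (connect1 S1) H1.
  + by rewrite Hm Ec.
  + move=> f /desc_first [->|[c' S2 H2]]; first by left; rewrite mem_head.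
    have Q : c' = c by case/and3P: S2 => /eqP Q _ sc'; apply: u.
    subst c'; case: (Hc f H2) => [H3|]; last by right.
    by left; rewrite in_cons H3 orbT.
- by move=> b c dir x y B; apply: fin; apply: Or33; exists b, c, dir, x, y.
Qed.

Lemma tree_temb t e : tm d e = Some t -> exists tE : VT t -> seq (edge G), [/\
  forall z, exists f q, [/\ tE z = f :: q,
     src f = (if par z is Some y then tgt (last e (tE y)) else src e) & path (@walkrel n G) f q],
  forall z f, f \in tE z -> desc e f,
  forall f, desc e f -> exists z, f \in tE z,
  (forall x y f, f \in tE x -> f \in tE y -> x = y) /\ forall z, uniq (tE z)
  & forall z l, labT z = Some l -> lab (tgt (last e (tE z))) = Some l].
Proof.
elim: t e => [i|s1 IH1 s2 IH2] e Ee; have [q [Hp Hu Hd [Ht Hm] Hc]] := chain e.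
- case: Ht => [[j [sa la Ea Eo]]|[_ Na]|[b [c [dir [x [y [_ _ _ _ [_ _ Ea]]]]]]]]; last 2 first.
  + by move: Hm; rewrite Na Ee.
  + by move: Hm; rewrite Ea Ee; case: (dir).
  exists (fun=> e :: q); split=> //.
  + by move=> z; exists e, q.
  + by move=> z f /Hd [].
  + move=> f /Hc [Hf|[c /and3P[/eqP tc _ _] _]]; first by exists tt.
    by have := mem_oute (tgt (last e q)) c; rewrite Eo tc eqxx.
  + by split=> // -[] [].
  + by move=> z l /=; rewrite la => <-; move: Hm; rewrite Ea Ee => -[->].
- case: Ht => [[j [_ _ Ea _]]|[_ Na]|].
  + by move: Hm; rewrite Ea Ee.
  + by move: Hm; rewrite Na Ee.
  move=> H0; have [b [c [B Eb Ec]]] : exists b c, [/\ exists dir x y, brdata d (last e q) b c dir x y,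
      tm d b = Some s1 & tm d c = Some s2].
    move: H0 => [b [c [dir [x [y B]]]]]; have [_ _ _ _ [Eb Ec Ea]] := B.
    move: Ea; rewrite Hm Ee; case: dir B => B [] Q1 Q2; subst.
      by exists c, b; split=> //; exists (~~ true), y, x; apply: brdata_sym.
    by exists b, c; split=> //; exists false, x, y.
  move: B => [dir [x [y B]]].
  have [tb tc] := brdata_out B; have [_ Po ne [sa sb sc] _] := B.
  have [tE1 [P1 D1 C1 [J1 U1] L1]] := IH1 b Eb.
  have [tE2 [P2 D2 C2 [J2 U2] L2]] := IH2 c Ec.
  have Sb : stp (last e q) b by rewrite /stp tb eqxx sa sb.
  have Sc : stp (last e q) c by rewrite /stp tc eqxx sa sc.
  have ea : desc e (last e q) by have [] := Hd (last e q) (mem_last _ _).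
  have eb : desc e b := connect_trans ea (connect1 Sb).
  have ec : desc e c := connect_trans ea (connect1 Sc).
  have low f h : f \in e :: q -> desc b h \/ desc c h -> f <> h.
    move=> /Hd [_ Hf] Hh Q; subst h; have rf : rk (src f) < rk (tgt (last e q)).
      exact: leq_ltn_trans (desc_rk_src Hf) (Hrk _).
    by case: Hh => /desc_rk_src; rewrite -?tb -?tc leqNgt rf.
  have bc f : desc b f -> desc c f -> False.
    move=> Hb Hcf; case: (desc_comp Hb Hcf) => /desc_rk [Q|].
    + by rewrite Q eqxx in ne.
    + by rewrite -tc tb leqNgt Hrk.
    + by rewrite Q eqxx in ne.
    + by rewrite -tb tc leqNgt Hrk.
  pose tE (z : VT (BNode s1 s2)) := match z with None => e :: q
     | Some (inl x) => tE1 x | Some (inr y) => tE2 y end.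
  have l1 z : last e (tE1 z) = last b (tE1 z) by have [f [q' [-> _ _]]] := P1 z.
  have l2 z : last e (tE2 z) = last c (tE2 z) by have [f [q' [-> _ _]]] := P2 z.
  exists tE; split.
  + move=> [[z|z]|] /=; last by exists e, q.
      have [f [q' [E1 E2 E3]]] := P1 z; exists f, q'; split=> //.
      by rewrite E2; case: (par z) => [w|] /=; rewrite ?l1 ?tb.
    have [f [q' [E1 E2 E3]]] := P2 z; exists f, q'; split=> //.
    by rewrite E2; case: (par z) => [w|] /=; rewrite ?l2 ?tc.
  + move=> [[z|z]|] f /=; last by move=> /Hd [].
      by move/D1; apply: connect_trans.
    by move/D2; apply: connect_trans.
  + move=> f /Hc [Hf|[c' S' H']]; first by exists None.
    have : c' \in oute (tgt (last e q)) by case/and3P: S' => /eqP Q _ _; rewrite mem_oute Q.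
    rewrite (perm_mem Po) !inE => /orP[] /eqP Q; subst c'.
      by have [z Hz] := C1 _ H'; exists (Some (inl z)).
    by have [z Hz] := C2 _ H'; exists (Some (inr z)).
  + split; last by move=> [[z|z]|] /=; rewrite ?U1 ?U2.
    move=> [[u|u]|] [[w|w]|] f Hf Hg //=.
    * by rewrite (J1 _ _ _ Hf Hg).
    * by case: (bc f (D1 _ _ Hf) (D2 _ _ Hg)).
    * by case: (low f f Hg); auto; left; apply: D1 Hf.
    * by case: (bc f (D1 _ _ Hg) (D2 _ _ Hf)).
    * by rewrite (J2 _ _ _ Hf Hg).
    * by case: (low f f Hg); auto; right; apply: D2 Hf.
    * by case: (low f f Hf); auto; left; apply: D1 Hg.
    * by case: (low f f Hf); auto; right; apply: D2 Hg.
  + move=> [[z|z]|] l //=; first by rewrite l1; apply: L1.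
    by rewrite l2; apply: L2.
Qed.

Lemma desc_src e f : desc e f -> tgt f <> src e.
Proof. by move/desc_rk_src => + Q; have := Hrk f; rewrite Q; lia. Qed.

Lemma comp_emb e t l0 : tm d e = Some t -> (forall l, l0 = Some l -> lab (src e) = Some l) ->
  exists S (h : subgraph_emb S G), is_subdivision (term_graph l0 t) S /\
    forall f, (exists x, embE h x = f) <-> desc e f.
Proof.
move=> Ee Hl; have [tE [P D C [J U] L]] := tree_temb Ee.
pose tV (o : vertex (term_graph l0 t)) := if o is Some z then tgt (last e (tE z)) else src e.
have E : @topo_emb n (term_graph l0 t) G tE tV.
  split=> //.
  - move=> z; have [f [q [E1 E2 E3]]] := P z; exists f, q; split=> //=.
    by rewrite E1.
  - by case=> [z|] l /=; [apply: L|apply: Hl].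
  - move=> x y f g /D Df /D Dg Q.
    have nf : tm d f <> None by rewrite -(desc_tm Df) Ee.
    have ng : tm d g <> None by rewrite -(desc_tm Dg) Ee.
    have fi : f \in ine (tgt g) by rewrite mem_ine Q.
    have gi : g \in ine (tgt g) by rewrite mem_ine.
    have one a : ine (tgt g) = [:: a] -> f = g.
      by move=> Ei; move: fi gi; rewrite Ei !inE => /eqP -> /eqP ->.
    case/okatP: (V (tgt g)); try by move=> ? ? /one.
    + by move=> b Ei; rewrite Ei in gi.
    + by move=> a /one.
    + by move=> ? ? ? ? ? ? /one.
    + by move=> ? ? ? /one.
    + move=> a b c Pi _ _ _ Na _ _ _; move: fi gi; rewrite !(perm_mem Pi) !inE.
      by case/orP=> /eqP Q1; case/orP=> /eqP Q2; subst.
  - case=> [z|] Hv; first by case: (Hv z).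
    by split; [move=> x f /D /desc_src|case=> [z|//] Hw; case: (Hw z)].
have [S [h [HS Hf]]] := topo_emb_sub E; exists S, h; split=> // f.
by rewrite Hf; split=> [[x /D]|/C].
Qed.

Lemma Zchain e f g : tm d e = None -> desc e f -> desc e g -> desc f g \/ desc g f.
Proof.
move=> Ne Hf Hg; have [q [Hp Hu Hd [Ht Hm] Hc]] := chain e.
have stop : sp d (last e q).
  case: Ht => [[j [_ _ Ea _]]|[//]|[b [c [dir [x [y [_ _ _ _ [_ _ Ea]]]]]]]]; move: Hm; rewrite Ea Ne //.
have inq h : desc e h -> desc h (last e q).
  by move=> /Hc [/Hd []//|[c /and3P[_]]]; rewrite stop.
by apply: desc_comp (inq _ Hf) (inq _ Hg).
Qed.

Lemma Zstop e : tm d e = None -> exists2 z, sp d z & desc e z.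
Proof.
move=> Ne; have [q [Hp Hu Hd [Ht Hm] Hc]] := chain e; exists (last e q).
  case: Ht => [[j [_ _ Ea _]]|[//]|[b [c [dir [x [y [_ _ _ _ [_ _ Ea]]]]]]]]; move: Hm; rewrite Ea Ne //.
by have [] := Hd (last e q) (mem_last _ _).
Qed.

Lemma stop_desc z f : sp d z -> desc z f -> z = f.
Proof. by move=> sz /desc_first [//|[c /and3P[_]]]; rewrite sz. Qed.

Lemma dis_emb e : tm d e = None ->
  exists S (h : subgraph_emb S G), is_subdivision (single_edge (label n)) S /\
    forall f, (exists x, embE h x = f) <-> desc e f.
Proof.
move=> Ne; have [q [Hp Hu Hd [Ht Hm] Hc]] := chain e.
have stop : sp d (last e q).
  case: Ht => [[j [_ _ Ea _]]|[//]|[b [c [dir [x [y [_ _ _ _ [_ _ Ea]]]]]]]]; move: Hm; rewrite Ea Ne //.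
have E : @topo_emb n (single_edge _) G (fun=> e :: q)
    (fun k : bool => if k then tgt (last e q) else src e).
  split.
  - by move=> x; exists e, q.
  - by move=> [] [].
  - by [].
  - by [].
  - move=> _ _ f g /Hd [Df _] /Hd [Dg _] Q.
    by case: (Zchain Ne Df Dg) => /desc_rk [//|]; [rewrite Q|rewrite -Q]; rewrite leqNgt Hrk.
  - case=> Hv; first by case: (Hv tt).
    split; last by case=> // Hw; case: (Hw tt).
    by move=> _ f /Hd [/desc_src].
have [S [h [HS Hf]]] := topo_emb_sub E; exists S, h; split=> // f.
rewrite Hf; split=> [[_ /Hd []//]|/Hc [?|[c /and3P[_]]]]; first by exists tt.
by rewrite stop.
Qed.

Lemma occ_desc e0 p f : occ d e0 p f -> desc e0 f.
Proof.
elim=> {p f} [//|p a c _ IH ta sa sc _|p a c dir x y _ IH ta sa sc _ _];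
  by apply: connect_trans IH (connect1 _); rewrite /stp ta eqxx sa sc.
Qed.

End Components.

(** * Forests from decorations *)

Lemma perm_lift (A B : eqType) (f : A -> B) L0 ts :
  perm_eq (map f L0) ts -> exists2 L, perm_eq L0 L & map f L = ts.
Proof.
elim: ts L0 => [|t ts IH] L0 H.
  by exists [::] => //; case: L0 H => // x s /perm_size.
have /mapP[x xL Q] : t \in map f L0 by rewrite (perm_mem H) mem_head.
have P := perm_to_rem xL.
have : perm_eq (t :: map f (rem x L0)) (t :: ts).
  by rewrite Q -/(map f (x :: rem x L0)) -(permPl (perm_map f P)) -Q.
rewrite perm_cons => /IH [L PL EL]; exists (x :: L); last by rewrite /= EL Q.
by rewrite (permPl P) perm_cons.
Qed.

Section Forest.
Variable n : nat.
Local Notation lgr := (lgraph (label n)).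
Local Notation bt := (bt n).
Implicit Types G H S T N : lgr.

Definition iso_rho : lgr :=
  @LGraph (label n) unit void (fun _ => tt) (fun _ => tt) (fun _ => Some Rho).

Definition forest_comp (r0 : option bt) (ts : seq bt) (c : option 'I_(size ts)) : lgr :=
  match c with
  | None => if r0 is Some t then term_graph (Some Rho) t else iso_rho
  | Some i => term_graph None (tnth (in_tuple ts) i)
  end.

Lemma start_index G (d : deco G) ts : perm_eq (starts d) ts ->
  exists s : 'I_(size ts) -> edge G, [/\ injective s,
    forall i, st d (s i) /\ tm d (s i) = Some (tnth (in_tuple ts) i)
  & forall e, st d e -> tm d e <> None -> exists i, s i = e].
Proof.
move=> P; pose L0 := [seq e <- enum (edge G) | start_term d e].
have E0 : map (start_term d) L0 = map Some (starts d).
  by rewrite /starts /L0; elim: (enum _) => [|e s IH] //=; case E: (start_term d e) => [t|] //=; rewrite E IH.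
have [L PL EL] : exists2 L, perm_eq L0 L & map (start_term d) L = map Some ts.
  by apply: perm_lift; rewrite E0; apply: perm_map.
have sz : size L == size ts by rewrite -(size_map (start_term d)) EL size_map.
have uL : uniq L by rewrite -(perm_uniq PL) filter_uniq ?enum_uniq.
have gs i : start_term d (tnth (Tuple sz) i) = Some (tnth (in_tuple ts) i).
  set x0 := tnth (Tuple sz) i; set y0 := tnth (in_tuple ts) i.
  rewrite /x0 /y0 !(tnth_nth x0) !(tnth_nth y0) /=.
  have iL : i < size L by rewrite (eqP sz).
  by rewrite -(nth_map x0 (Some y0)) // EL (nth_map y0).
exists (tnth (Tuple sz)); split.
- exact/tuple_uniqP.
- by move=> i; have := gs i; rewrite /start_term; case: ifP.
- move=> e se ne; have : e \in L.
    by rewrite -(perm_mem PL) mem_filter mem_enum andbT /start_term se; case: (tm d e) ne.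
  move=> eL; have iL : index e L < size ts by rewrite -(eqP sz) index_mem.
  by exists (Ordinal iL); rewrite (tnth_nth e) /= nth_index.
Qed.

Lemma ret_stop G r0 (d : deco G) v : valid r0 d -> is_reticulation v ->
  exists2 z, sp d z & tgt z = v.
Proof.
move=> V; rewrite /is_reticulation indegE => /andP[/eqP si _].
case/okatP: (V v); try by (move=> ? ? Ei; rewrite Ei in si) || (move=> ? Ei; rewrite Ei in si).
+ by move=> a b c dir x y Ei; rewrite Ei in si.
+ by move=> a b c Ei; rewrite Ei in si.
+ move=> a b c Pi _ _ sa _ _ _ _; exists a => //.
  by apply/eqP; rewrite -mem_ine (perm_mem Pi) inE eqxx.
Qed.

Lemma stop_ret G r0 (d : deco G) z : net G -> valid r0 d -> sp d z ->
  tm d z = None /\ is_reticulation (tgt z).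
Proof.
move=> [_ Lk _ _] V sz; split.
  by case: (hviewP z V) => // [j|c|b c dir x y [_ _ _ []]]; rewrite sz.
have zi : z \in ine (tgt z) by rewrite mem_ine.
have := Lk (tgt z); rewrite /is_reticulation indegE outdegE; case/okatP: (V (tgt z)).
- by move=> b Ei; rewrite Ei in zi.
- by move=> a j Ei; move: zi; rewrite Ei inE => /eqP <- _; rewrite sz.
- by move=> a Ei Eo _ -> _; rewrite Ei Eo /= => -[[]|[]].
- by move=> a c Ei; move: zi; rewrite Ei inE => /eqP <- _; rewrite sz.
- by move=> a b c dir x y Ei; move: zi; rewrite Ei inE => /eqP <- _ _; rewrite sz.
- by move=> a b c Ei; move: zi; rewrite Ei inE => /eqP <- _ _; rewrite sz.
- by move=> a b c Pi Eo *; rewrite (perm_size Pi) Eo.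
Qed.

Lemma covering G r0 ts : net G -> real G r0 ts ->
  covering_embeddings (fun c : option 'I_(size ts) + 'I_(nret G) =>
     if c is inl i then forest_comp r0 i else single_edge (label n)) G.
Proof.
move=> nG [d [V P]]; have [[rk Hrk] Lk Hl _] := nG.
have [s [sI sS sE]] := start_index P.
have [b Eb] := net_root_edge nG; have [_ Hb] := root_out V Eb.
pose own (c : option 'I_(size ts) + 'I_(nret G)) (f : edge G) : Prop :=
  match c with
  | inl None => ~~ st d b /\ connect (stp d) b f
  | inl (Some i) => connect (stp d) (s i) f
  | inr j => exists e0 z, [/\ st d e0, sp d z, tgt z = enum_val j, connect (stp d) e0 z
      & connect (stp d) e0 f]
  end.
have tops i : top d (s i) by rewrite /top (sS i).1.
have topb : top d b by rewrite /top Eb orbT.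
have ex c : exists S, exists h : subgraph_emb S G, 
    is_subdivision (if c is inl i then forest_comp r0 i else single_edge (label n)) S /\
    forall f, (exists x, embE h x = f) <-> own c f.
  case: c => [[i|]|j] /=.
  - exact: (comp_emb Hrk V (l0 := None) (sS i).2).
  - case: r0 V Hb {Hrk} (Hrk) => [t|] V Hb Hrk'.
      have [nb tb] : ~~ st d b /\ tm d b = Some t by move: Hb; case: ifP => // _ [].
      have [|S [h [HS Hf]]] := comp_emb Hrk' V (l0 := Some Rho) tb.
        by move=> l [<-]; apply/net_root_lab.
      by exists S, h; split=> // f; rewrite Hf; split=> [|[]].
    have sb : st d b by move: Hb; case: ifP => // _ [].
    have [r Er] := Hl Rho.
    have h : subgraph_emb iso_rho G.
      apply: (@SubgraphEmb _ iso_rho G (fun _ => r) (fun e : void => match e with end)) => //=.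
      + by move=> [] [].
      + by move=> [] l [<-].
    exists iso_rho, h; split; first by constructor.
    by move=> f; split=> [[[]]|[]]; rewrite sb.
  - have vj : is_reticulation (enum_val j) by have := enum_valP j; rewrite inE.
    have [z sz tz] := ret_stop V vj.
    have [Nz _] := stop_ret nG V sz.
    have [e0 [p [T0 H0]]] := top_exists Hrk z V.
    have D0 := occ_desc H0; have N0 : tm d e0 = None by apply/(desc_tm V D0).
    have s0 := topZ V T0 N0.
    have [S [h [HS Hf]]] := dis_emb Hrk V N0.
    exists S, h; split=> // f; rewrite Hf; split=> [Df|]; first by exists e0, z.
    move=> [e1 [z1 [s1 sz1 tz1 D1 Df]]].
    suff -> : e0 = e1 by [].
    have Q : z1 = z.
      have [_ /andP[_ _]] := stop_ret nG V sz1.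
      have zi : z \in ine (enum_val j) by rewrite mem_ine tz.
      have zi1 : z1 \in ine (enum_val j) by rewrite mem_ine tz1.
      case/okatP: (V (enum_val j)).
      + by move=> ? Ei; rewrite Ei in zi.
      + by move=> a ? Ei _ na; move: zi; rewrite Ei inE => /eqP Q; rewrite -Q sz in na.
      + by move=> a Ei; move: zi zi1; rewrite Ei !inE => /eqP -> /eqP ->.
      + by move=> a ? Ei _ na; move: zi; rewrite Ei inE => /eqP Q; rewrite -Q sz in na.
      + by move=> a ? ? ? ? ? Ei _ _ na; move: zi; rewrite Ei inE => /eqP Q; rewrite -Q sz in na.
      + by move=> a ? ? Ei _ _ na; move: zi; rewrite Ei inE => /eqP Q; rewrite -Q sz in na.
      + move=> a a' ? Pi _ _ _ _ na' _ _; move: zi zi1; rewrite !(perm_mem Pi) !inE.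
        by case/orP=> /eqP Q; case/orP=> /eqP Q'; subst; rewrite ?sz ?sz1 in na'.
    by subst z1; apply: (top_uniq Hrk V T0 _ D0 D1); rewrite /top s1.
pose S c := proj1_sig (constructive_indefinite_description _ (ex c)).
pose exh c := proj2_sig (constructive_indefinite_description _ (ex c)).
pose h c : subgraph_emb (S c) G := proj1_sig (constructive_indefinite_description _ (exh c)).
have hP c : is_subdivision (if c is inl i then forest_comp r0 i else single_edge (label n)) (S c) /\
    forall f, (exists x, embE (h c) x = f) <-> own c f.
  exact: (proj2_sig (constructive_indefinite_description _ (exh c))).
exists S, h; split=> [c|c c' x x' Q|f]; first by have [] := hP c.
- have O : own c (embE (h c) x) by apply/(hP c).2; exists x.
  have O' : own c' (embE (h c) x) by apply/(hP c').2; exists x'; rewrite Q.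
  move: (embE (h c) x) O O' => f {Q x x'}.
  have tmZ e0 z : sp d z -> connect (stp d) e0 z -> tm d e0 = None.
    by move=> sz D; apply/(desc_tm V D); have [] := stop_ret nG V sz.
  case: c c' => [[i|]|j] [[i'|]|j'] //=.
  + by move=> D D'; congr (inl (Some _)); apply: sI; apply: (top_uniq Hrk V _ _ D D').
  + move=> D [nb D']; have Q := top_uniq Hrk V (tops i) topb D D'.
    by rewrite -Q (sS i).1 in nb.
  + move=> D [e0 [z [s0 sz _ D0 D']]].
    have T0 : top d e0 by rewrite /top s0.
    have Q := top_uniq Hrk V (tops i) T0 D D'.
    by have := tmZ _ _ sz D0; rewrite -Q (sS i).2.
  + move=> [nb D'] D; have Q := top_uniq Hrk V (tops i') topb D D'.
    by rewrite -Q (sS i').1 in nb.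
  + move=> [nb D] [e0 [z [s0 sz _ D0 D']]].
    have T0 : top d e0 by rewrite /top s0.
    by have Q := top_uniq Hrk V topb T0 D D'; rewrite Q s0 in nb.
  + move=> [e0 [z [s0 sz _ D0 D']]] D.
    have T0 : top d e0 by rewrite /top s0.
    have Q := top_uniq Hrk V (tops i') T0 D D'.
    by have := tmZ _ _ sz D0; rewrite -Q (sS i').2.
  + move=> [e0 [z [s0 sz _ D0 D']]] [nb D].
    have T0 : top d e0 by rewrite /top s0.
    by have Q := top_uniq Hrk V topb T0 D D'; rewrite Q s0 in nb.
  + move=> [e0 [z [s0 sz tz D0 D]]] [e1 [z' [s1 sz' tz' D1 D']]].
    have T0 : top d e0 by rewrite /top s0.
    have T1 : top d e1 by rewrite /top s1.
    have Q := top_uniq Hrk V T0 T1 D D'; subst e1.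
    congr inr; apply: enum_val_inj; rewrite -tz -tz'; congr tgt.
    have N0 := tmZ _ _ sz D0.
    case: (Zchain Hrk V N0 D0 D1) => [/(stop_desc sz)|/(stop_desc sz')] //.
- have [e0 [p [T0 H0]]] := top_exists Hrk f V; have D0 := occ_desc H0.
  suff [c Oc] : exists c, own c f by exists c; apply/(hP c).2.
  case E0: (tm d e0) => [t|]; last first.
    have s0 := topZ V T0 E0; have [z sz Dz] := Zstop Hrk V E0.
    have [_ rz] := stop_ret nG V sz.
    have zA : tgt z \in [set v : vertex G | is_reticulation v] by rewrite inE.
    by exists (inr (enum_rank_in zA (tgt z))), e0, z; split=> //; rewrite enum_rankK_in.
  case s0: (st d e0).
    have [|i Ei] := sE e0 s0; first by rewrite E0.
    by exists (inl (Some i)); rewrite /= Ei.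
  move: T0; rewrite /top s0 /= => /eqP T0; have Q := net_root nG T0 Eb.
  have [Eo _] := root_out V Eb.
  have : e0 \in oute (src b) by rewrite mem_oute Q.
  rewrite Eo inE => /eqP Q2; subst e0.
  by exists (inl None) => /=; rewrite s0.
Qed.

Definition inv1 S := forall v : vertex S, (forall x, src x <> v) -> (exists y, tgt y = v) ->
  exists i, lab v = Some (Taxon i).
Definition inv2 S := forall (v : vertex S) i, lab v = Some (Taxon i) -> exists x, tgt x = v.
Definition inv3 S := forall v : vertex S, (forall x, tgt x <> v) -> lab v = Some Rho.

Lemma sub_tgt S (f : edge S) (v : vertex S) :
  (exists y, tgt y = v) <-> exists y : edge (subdivide f), tgt y = Some v.
Proof.
split=> [[y E]|[[y|] /=]].
- case: (eqVneq y f) => [Q|ne]; first by exists None; rewrite /= -Q E.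
  by exists (Some y); rewrite /= (negbTE ne) E.
- by case: eqP => // _ [E]; exists y.
- by move=> [E]; exists f.
Qed.

Lemma inv_sub H S : is_subdivision H S ->
  [/\ inv1 H -> inv1 S, inv2 H -> inv2 S & inv3 H -> inv3 S].
Proof.
elim=> // {}S f _ [I1 I2 I3]; split.
- move=> /I1 {}I1 [v|] Hv; last by case: (Hv None).
  by move=> /(sub_tgt f v).2 Hy; apply: (I1 v _ Hy) => x Q; apply: (Hv (Some x)); rewrite /= Q.
- by move=> /I2 {}I2 [v|] i //= /I2 /(sub_tgt f v).1.
- move=> /I3 {}I3 [v|] Hv; last by case: (Hv (Some f)); rewrite /= eqxx.
  apply: I3 => x Q; have [|y Ey] := (sub_tgt f v).1; first by exists x.
  exact: Hv Ey.
Qed.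

Lemma sub_lab_to H S : is_subdivision H S ->
  exists i : vertex H -> vertex S, injective i /\ forall v, lab (i v) = lab v.
Proof.
elim=> [|{}S f _ [i [iI iL]]]; first by exists id; split.
by exists (fun v => Some (i v)); split=> // x y [/iI].
Qed.

Lemma sub_lab_from H S : is_subdivision H S ->
  forall (w : vertex S) l, lab w = Some l -> exists v : vertex H, lab v = Some l.
Proof. by elim=> [w l E|{}S f _ IH [w|] l //=]; [exists w|apply: IH]. Qed.

Lemma term_graph_inv3 (t : bt) : inv3 (term_graph (Some Rho) t).
Proof. by move=> [z|] Hv //; case: (Hv z). Qed.

Lemma term_graph_inv12 l0 (t : bt) : l0 = None \/ l0 = Some Rho -> inv1 (term_graph l0 t) /\ inv2 (term_graph l0 t).
Proof.
move=> El; split=> [[z|] Hv|[z|] i /=]; try by [exists z | case: El => ->].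
  case: (kids z) => [[i Ez _]|[_ [b [c [_ K]]]]]; first by exists i.
  by case: (Hv b); apply/K; left.
by case=> y.
Qed.

Lemma tree_iso T (t : bt) : net T -> nret T = 0 -> real T (Some t) [::] ->
  isomorphic (term_graph (Some Rho) t) T.
Proof.
move=> nT rT [d [V P]]; have [[rk Hrk] Lk _ _] := nT.
have ns e : ~~ st d e.
  apply/negP => se; case E: (tm d e) => [x|]; last by case: (noZ nT rT V E).
  have : x \in starts d by rewrite mem_pmap; apply/mapP; exists e; rewrite ?mem_enum // /start_term se.
  by rewrite (perm_mem P).
have [b Eb] := net_root_edge nT; have [Eo Hb] := root_out V Eb; rewrite (negbTE (ns b)) in Hb.
have [|S [h [HS Hf]]] := comp_emb Hrk V (l0 := Some Rho) Hb.1.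
  by move=> l [<-]; apply/net_root_lab.
have sE f : exists x, embE h x = f.
  apply/Hf; have [e0 [p [T0 /occ_desc D0]]] := top_exists Hrk f V.
  move: T0; rewrite /top (negbTE (ns _)) => /eqP T0; have Q := net_root nT T0 Eb.
  have : e0 \in oute (src b) by rewrite mem_oute Q.
  by rewrite Eo inE => /eqP <-.
have [I1 I2 I3] := inv_sub HS; have [J1 J2] := @term_graph_inv12 (Some Rho) t (or_intror erefl).
have J3 := @term_graph_inv3 t.
have I : @iso_maps n S T (embV h) (embE h).
  split.
  - apply: fin_bij (embV_inj (s := h)) _ => v.
    have [[e E]|[e E]] : (exists e, tgt e = v) \/ exists e, src e = v.
      move: (Lk v); case Ei: (ine v) => [|e s]; last first.
        by left; exists e; apply/eqP; rewrite -mem_ine Ei mem_head.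
      case Eo': (oute v) => [|e s]; last first.
        by right; exists e; apply/eqP; rewrite -mem_oute Eo' mem_head.
      by case: (lab v) => [[|i]|] /= [] // [].
    + by have [x Ex] := sE e; exists (tgt x); rewrite -emb_tgt Ex.
    + by have [x Ex] := sE e; exists (src x); rewrite -emb_src Ex.
  - exact: fin_bij (embE_inj (s := h)) sE.
  - exact: emb_src.
  - exact: emb_tgt.
  - move=> v; case El: (lab v) => [l|]; first exact: emb_lab El.
    case El': (lab (embV h v)) => [l|] //; move: (Lk (embV h v)); rewrite El'.
    have [x Ex] : exists x, tgt x = v.
      case: (pickP (fun x => tgt x == v)) => [x /eqP Ex|nx]; first by exists x.
      by rewrite I3 // in El => x /eqP; rewrite nx.
    case: l {El'} => [|i] /= [].
      by move=> /size0nil Ei; have := mem_ine (embV h v) (embE h x); rewrite Ei emb_tgt Ex eqxx.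
    move=> _ /size0nil Ei; have [||i' Ei'] := I1 J1 v; [|by exists x|by rewrite Ei' in El].
    move=> y Ey; have := mem_oute (embV h v) (embE h y).
    by rewrite Ei emb_src Ey eqxx.
move: HS I; move: (embV h) (embE h) => fV fE HS I; clear -HS I Lk.
case: S / HS fV fE I => [fV fE I|S f _ fV fE I]; first by exists fV, fE.
exfalso; have := Lk (fV None).
rewrite (perm_size (iso_ine _ I)) (perm_size (iso_oute _ I)) !size_map sub_ineN sub_outeN /=.
by case: (lab _) => [[|i]|] /= [] // [].
Qed.

Lemma agr_forest T N k : net T -> nret T = 0 -> net N -> agr T N k ->
  exists F : option 'I_k -> lgr, agreement_forest T N F.
Proof.
move=> nT rT nN [r0 [ts [<- RT0 RN]]]; exists (@forest_comp r0 ts).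
have [S [h [HS Hd Hc]]] := covering nT RT0.
have [[rk Hrk] Lk Hl U] := nT.
have noJ (j : 'I_(nret T)) : False by case: j => j; rewrite rT.
have inv (i : option 'I_(size ts)) : inv1 (forest_comp r0 i) /\ inv2 (forest_comp r0 i).
  case: i => [i|] /=; first by apply: term_graph_inv12; left.
  case: r0 {RT0 RN S h HS Hd Hc} => [t|]; first by apply: term_graph_inv12; right.
  by split=> // v Hv [[]].
have lU (t : bt) l0 (i : option 'I_(size ts)) : forest_comp r0 i = term_graph l0 t ->
    forall (x y : VT t) j, labT x = Some (Taxon j) -> labT y = Some (Taxon j) -> x = y.
  move=> E x y j Ex Ey; have := HS (inl i); rewrite /= E => HSi.
  have [io [ioI ioL]] := sub_lab_to HSi.
  have : io (Some x) = io (Some y).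
    apply: (embV_inj (s := h (inl i))); apply: (U _ _ (Taxon j)); apply: emb_lab; by rewrite ioL.
  by move/ioI => -[].
split.
- case: r0 lU {RT0 RN S h HS Hd Hc inv} => [t|] lU /=; last first.
    by left; split; rewrite ?card_unit ?card_void.
  right; split; last by exists None.
  by apply: term_graph_tree; [right|apply: (lU t (Some Rho) None)].
- by move=> i /=; apply: term_graph_tree; [left|apply: (lU _ None (Some i))].
- case=> [|i].
    exists None; split; first by case: (r0) => [t|]; [exists None|exists tt].
    case=> [j|//] [[z|] //=].
    by case: (kids z) => [[i -> _]|[-> _]].
  have [u Eu] := Hl (Taxon i); have := Lk u; rewrite Eu => -[si so].
  have [f Ef] : exists f, ine u = [:: f] by case: (ine u) si => // f [] // _; exists f.
  have tf : tgt f = u by apply/eqP; rewrite -mem_ine Ef mem_head.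
  have [[c|j] [x Ex]] := Hc f; last by case: (noJ j).
  have [I1 I2 _] := inv_sub (HS (inl c)); have [J1 J2] := inv c.
  exists c; split.
    have [||i' Ei'] := I1 J1 (tgt x).
    + move=> y Ey; have := mem_oute u (embE (h (inl c)) y).
      by rewrite (size0nil so) emb_src Ey -emb_tgt Ex tf eqxx.
    + by exists x.
    have := emb_lab (h (inl c)) Ei'; rewrite -emb_tgt Ex tf Eu => -[Q].
    by apply: (sub_lab_from (HS (inl c)) (w := tgt x)); rewrite Ei' Q.
  move=> c' [w Ew]; have [io [_ ioL]] := sub_lab_to (HS (inl c')).
  have [_ I2' _] := inv_sub (HS (inl c')); have [_ J2'] := inv c'.
  have [|y Ey] := I2' J2' (io w) i; first by rewrite ioL.
  have Q : embE (h (inl c')) y = f.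
    have Eu' : embV (h (inl c')) (io w) = u.
      by apply: (U _ _ (Taxon i)) => //; apply: emb_lab; rewrite ioL.
    by apply/eqP; have := mem_ine u (embE (h (inl c')) y); rewrite Ef inE emb_tgt Ey Eu' eqxx.
  by have := Hd (inl c) (inl c') x y; rewrite Ex Q => /(_ erefl) [].
- exists (fun i => S (inl i)), (fun i => h (inl i)); split.
  + by move=> i; apply: (HS (inl i)).
  + by move=> i j e f Q; have [] := Hd _ _ _ _ Q.
  + move=> e; have [[c|j] [x Ex]] := Hc e; last by case: (noJ j).
    by exists c, x.
- exact: covering nN RN.
Qed.

End Forest.

(** * SNPR sequences from agreement *)

Section Paths.
Variable n : nat.
Local Notation lgr := (lgraph (label n)).
Local Notation bt := (bt n).
Implicit Types G H S T N M : lgr.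

Lemma snpr_plus_iso T M N : isomorphic T M -> net N -> snpr_plus M N -> snpr_plus T N.
Proof.
move=> /iso_sym [fV [fE I]] nN [e [f [_ J]]].
have I2 := @graft_iso n _ _ _ _ f None _ _ (subdivide_iso e I) erefl erefl.
have J2 : isomorphic (@graft n (subdivide (fE e)) (omap fE f) None) N.
  apply: iso_trans J; apply: iso_sym; eexists; eexists; exact: I2.
exists (fE e), (omap fE f); split=> //.
by have [] := net_graft_ranked (net_iso (iso_sym J2) nN).
Qed.

Lemma snpr_path_plus T M N j :
  net N -> snpr_path j T M -> snpr_plus M N -> snpr_path j.+1 T N.
Proof.
move=> nN; elim=> {j T M} [T M I|j T M' M S nM' _ IH] P.
  apply: (@snpr_pathS _ _ _ N); last by constructor; apply: iso_refl.
    by apply: Or32; apply: snpr_plus_iso I nN P.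
  exact/netP.
exact: snpr_pathS S nM' (IH P).
Qed.

Lemma agr_path_exists T N k : net T -> nret T = 0 -> net N -> agr T N k ->
  exists2 j, j <= k + nret N & snpr_path j T N.
Proof.
move=> nT rT; move Er: (nret N) => r; elim: r N Er => [|r IH] N rN nN.
  rewrite addn0; elim: k T nT rT => [|k IH] T nT rT [r0 [ts [sz RT0 RN]]].
    have ts0 := size0nil sz; subst ts; exists 0 => //; constructor.
    case: r0 RT0 RN => [t|] RT0 RN.
      exact: iso_trans (iso_sym (tree_iso nT rT RT0)) (tree_iso nN rN RN).
    have [d [V P]] := RT0; have [b Eb] := net_root_edge nT; have [_] := root_out V Eb.
    case: ifP => [sb _|_ [_ //]]; case E: (tm d b) => [x|]; last by case: (noZ nT rT V E).
    have : x \in starts d by rewrite mem_pmap; apply/mapP; exists b; rewrite ?mem_enum // /start_term sb.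
    by rewrite (perm_mem P).
  have [T' [r1 [ts1 [nT' rT' S s1 [R1 R2]]]]] := move_tree nT nN rT rN RT0 RN sz.
  have [|j le_j Pj] := IH T' nT' rT'; first by exists r1, ts1.
  case: S => [Q|S]; first by exists j; [apply: leqW|rewrite -Q].
  by exists j.+1 => //; apply: snpr_pathS S _ Pj; apply/netP.
move=> [r0 [ts [sz RT0 RN]]]; have [|M [nM SM RM Er]] := remove_ret nN RN; first by rewrite rN.
have [||j le_j Pj] := IH M _ nM; first by move: Er; rewrite rN => -[].
  by exists r0, ts.
by exists j.+1; [rewrite addnS ltnS|apply: snpr_path_plus nN Pj SM].
Qed.

Lemma rec_exists (A : Type) (a0 : A) G (rk : vertex G -> nat) (phi : edge G -> (edge G -> A) -> A) :
  (forall e : edge G, rk (src e) < rk (tgt e)) ->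
  (forall e g g', (forall c, src c = tgt e -> g c = g' c) -> phi e g = phi e g') ->
  exists g, forall e, g e = phi e g.
Proof.
move=> Hrk Hphi; pose it m := iter m (fun g e => phi e g) (fun=> a0).
have st m e : \max_w rk w - rk (tgt e) < m -> it m e = it m.+1 e.
  elim: m e => // m IH e le; rewrite /it /=; apply: Hphi => c sc; apply: (IH c).
  have := rkmax rk (tgt c); have := Hrk c; rewrite sc; move: le; lia.
exists (it (\max_w rk w).+1) => e; apply: (st _ e); lia.
Qed.

Lemma pmap_image (I E : finType) (B : eqType) (f : I -> E) (g : E -> option B) (t : I -> B) :
  injective f -> (forall i, g (f i) = Some (t i)) -> (forall e, g e <> None -> exists i, e = f i) ->
  perm_eq (pmap g (enum E)) (map t (enum I)).
Proof.
move=> fI gf ge; pose r := [seq e <- enum E | g e == None].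
have P : perm_eq (enum E) (map f (enum I) ++ r).
  apply: uniq_perm (enum_uniq _) _ _.
    rewrite cat_uniq (map_inj_uniq fI) enum_uniq (filter_uniq _ (enum_uniq _)) andbT /=.
    apply/hasPn => e; rewrite mem_filter => /andP[/eqP Ne _]; apply/mapP => -[i _ Q].
    by move: Ne; rewrite Q gf.
  move=> e; rewrite mem_cat mem_enum /r mem_filter mem_enum andbT; apply/esym.
  case E1: (g e) => [b|]; last by rewrite orbT.
  have [|i ->] := ge e; first by rewrite E1.
  by rewrite map_f ?mem_enum.
apply: perm_trans (perm_pmap _ P) _; rewrite pmap_cat.
have -> : pmap g r = [::].
  have: all (fun e => g e == None) r by rewrite filter_all.
  by elim: (r) => //= e s IH /andP[/eqP -> /IH].
by rewrite cats0; elim: (enum I) => //= i s IH; rewrite gf /= perm_cons.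
Qed.

Lemma real_leaves G : net G -> real G None (map (@BLeaf n) (enum 'I_n)).
Proof.
move=> nG; have [[rk Hrk] Lk Hl U] := nG.
pose sP (e : edge G) := index e (ine (tgt e)) == 1.
pose sT (e : edge G) := (ine (src e) == [::]) || (index e (oute (src e)) == 1).
pose phi (e : edge G) (g : edge G -> option bt) := if sP e then None else
  match lab (tgt e), oute (tgt e) with
  | Some (Taxon i), _ => Some (BLeaf i) | _, b :: _ => g b | _, _ => None end.
have [|g Eg] := @rec_exists _ None G rk phi Hrk.
  move=> e g g' H; rewrite /phi; case: ifP => // _.
  case E: (oute (tgt e)) => [|b s] //; rewrite (H b) //.
  by apply/eqP; rewrite -mem_oute E mem_head.
pose d := Deco g sT sP.
have ti (v : vertex G) a s : ine v = a :: s -> tgt a = v by move=> E; apply/eqP; rewrite -mem_ine E mem_head.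
have so (v : vertex G) a s : oute v = a :: s -> src a = v by move=> E; apply/eqP; rewrite -mem_oute E mem_head.
have V : valid None d.
  move=> v; apply/okatP; move: (Lk v); case El: (lab v) => [[|i]|] /=.
  - case=> /size0nil Ei; case Eo: (oute v) => [|b []] // _.
    by apply: (@VRoot n _ G _ _ b) => //=; rewrite /sT (so _ _ _ Eo) Ei.
  - case; case Ei: (ine v) => [|a []] // _ /size0nil Eo; have ta := ti _ _ _ Ei.
    have na : sP a = false by rewrite /sP ta Ei /= eqxx.
    apply: (@VLeaf n _ G _ _ a i) => //=; first by rewrite na.
    by rewrite Eg /phi na ta El.
  - case; case.
      case Ei: (ine v) => [|a []] // _; have ta := ti _ _ _ Ei.
      case Eo: (oute v) => [|b [|c []]] // _; have sb := so _ _ _ Eo.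
      have ub : b != c by have := uniq_oute v; rewrite Eo /= inE andbT.
      have sc : src c = v by apply/eqP; rewrite -mem_oute Eo !inE eqxx orbT.
      have na : sP a = false by rewrite /sP ta Ei /= eqxx.
      apply: (@VPass n _ G _ _ a c b) => //=.
      + by rewrite Eo (perm_catC [:: b] [:: c]).
      + by rewrite eq_sym.
      + by rewrite na.
      + by rewrite /sT sc Eo /= (negbTE ub) eqxx orbT.
      + by rewrite /sT sb Ei Eo /= eqxx.
      + by rewrite [in RHS]Eg /phi na ta El Eo.
    case Ei: (ine v) => [|a [|b []]] // _; have ta := ti _ _ _ Ei.
    case Eo: (oute v) => [|c []] // _; have sc := so _ _ _ Eo.
    have ub : a != b by have := uniq_ine v; rewrite Ei /= inE andbT.
    have tb : tgt b = v by apply/eqP; rewrite -mem_ine Ei !inE eqxx orbT.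
    have na : sP a = false by rewrite /sP ta Ei /= eqxx.
    have nb : sP b by rewrite /sP tb Ei /= (negbTE ub) eqxx.
    apply: (@VRet n _ G _ _ b a c) => //=.
    + by rewrite Ei (perm_catC [:: a] [:: b]).
    + by rewrite eq_sym.
    + by rewrite Eg /phi nb.
    + by rewrite na.
    + by rewrite /sT sc Ei Eo /= eqxx.
    + by rewrite Eg /phi na ta El Eo.
have nobranch a b c dir x y : ~ brdata d a b c dir x y.
  move=> [Ei Po ne [_ sb sc] _].
  have : sT b || sT c.
    have := uniq_oute (tgt a); have := perm_size Po; move: (perm_mem Po).
    case Eo: (oute (tgt a)) => [|b' [|c' []]] // Pm _ /andP[]; rewrite inE => ub _.
    have sc' : src c' = tgt a by apply/eqP; rewrite -mem_oute Eo !inE eqxx orbT.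
    have tc' : sT c' by rewrite /sT sc' Eo /= (negbTE ub) eqxx orbT.
    by have := Pm c'; rewrite !inE eqxx orbT => /esym/orP[] /eqP <-; rewrite tc' ?orbT.
  by move: sb sc => /= /negbTE -> /negbTE ->.
have leafy e t : g e = Some t -> exists i, t = BLeaf i.
  move=> E; have [q [_ _ _ [Ht Hm] _]] := chain Hrk V e; move: Hm; rewrite (E : tm d e = _).
  case: Ht => [[j [_ _ -> _]] [<-]|[_ ->]|[b [c [dir [x [y /nobranch]]]]]] //.
  by exists j.
have ext i : exists e0, [/\ sT e0, g e0 = Some (BLeaf i) & forall e, sT e -> g e = Some (BLeaf i) -> e = e0].
  have [u Eu] := Hl (Taxon i); have := Lk u; rewrite Eu => -[si _].
  case Ei: (ine u) si => [|f []] // _; have tf := ti _ _ _ Ei.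
  have Ef : g f = Some (BLeaf i).
    by rewrite Eg /phi /sP tf Ei /= eqxx Eu.
  have [e0 [p [T0 H0]]] := top_exists Hrk f V; have D0 := occ_desc H0.
  have s0 : sT e0 by move: T0; rewrite /top /= /sT; case/orP=> // /eqP ->.
  exists e0; split=> //.
    have := occ_sub H0; rewrite /= Ef; case E0: (g e0) => [t|]; last by case: (p).
    have [j Ej] := leafy _ _ E0; subst t; rewrite osub_Some.
    by case: (p) => //= -[->].
  move=> e se Ee; have [q [_ _ Hd [Ht Hm] _]] := chain Hrk V e; move: Hm; rewrite (Ee : tm d e = _).
  case: Ht => [[j [_ lj -> _]] [Q]|[_ ->]|[b [c [dir [x [y /nobranch]]]]]] //.
  subst j; have El := U _ _ _ lj Eu.
  have : last e q \in ine u by rewrite mem_ine El.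
  rewrite Ei inE => /eqP Q; have [De _] := Hd _ (mem_last e q); rewrite Q in De.
  by apply: (top_uniq Hrk V _ T0 De D0); rewrite /top /= se.
pose s i := proj1_sig (constructive_indefinite_description _ (ext i)).
have sP' i : [/\ sT (s i), g (s i) = Some (BLeaf i) & forall e, sT e -> g e = Some (BLeaf i) -> e = s i].
  exact: (proj2_sig (constructive_indefinite_description _ (ext i))).
exists d; split=> //; apply: (pmap_image (f := s)).
- by move=> i j Q; have [_ E1 _] := sP' i; have [_] := sP' j; rewrite -Q E1 => -[].
- by move=> i; rewrite /start_term /=; have [-> -> _] := sP' i.
- move=> e; rewrite /start_term /=; case: ifP => // se; case E: (g e) => [t|] // _.
  have [i Q] := leafy _ _ E; exists i; have [_ _ u] := sP' i.
  by apply: u; rewrite // E Q.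
Qed.

Lemma agr_exists T N : net T -> net N -> exists k, agr T N k.
Proof. by move=> nT nN; eexists; eexists; eexists; split; [|apply: real_leaves|apply: real_leaves]. Qed.

End Paths.

(** * Decorations from forests *)

Section Glue.
Variable n : nat.
Local Notation lgr := (lgraph (label n)).
Local Notation bt := (bt n).
Implicit Types G H S T N M : lgr.

Lemma tree_deco G : phylo_tree G ->
  exists (b : edge G) t (g : edge G -> option bt), [/\ ine (src b) = [::], g b = Some t,
    forall v : vertex G, size (ine v) <= 1
  & forall k : bool, valid (if k then None else Some t) (Deco g (fun e => k && (e == b)) (fun=> false))].
Proof.
move=> [[A [r [Hr Ur]] Ty Lb _] nr]; have [rk Hrk] := (acyclicP G).1 A.
pose phi (e : edge G) (g : edge G -> option bt) :=
  match lab (tgt e), oute (tgt e) with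
  | Some (Taxon i), _ => Some (BLeaf i)
  | _, [:: b; c] => match g b, g c with Some x, Some y => Some (BNode x y) | _, _ => None end
  | _, _ => None end.
have so (v : vertex G) a : a \in oute v -> src a = v by rewrite mem_oute => /eqP.
have ti (v : vertex G) a : a \in ine v -> tgt a = v by rewrite mem_ine => /eqP.
have [|g Eg] := @rec_exists n _ None G rk phi Hrk.
  move=> e g g' H; rewrite /phi; case E: (oute (tgt e)) => [|b [|c []]] //.
  by rewrite (H b) ?(H c) //; apply: so; rewrite E !inE eqxx ?orbT.
have ty (v : vertex G) : [\/ ine v = [::] /\ exists b, oute v = [:: b],
    exists a i, [/\ ine v = [:: a], oute v = [::] & lab v = Some (Taxon i)]
  | exists a b c, [/\ ine v = [:: a], oute v = [:: b; c] & lab v = None]].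
  have [_ L1 L2] := Lb v; case/or4P: (Ty v) => Q.
  - move: Q; rewrite /is_root indegE outdegE => /andP[/eqP/size0nil Ei].
    by case: (oute v) => [|b []] // _; apply: Or31; split=> //; exists b.
  - have [i Ei] := L1 Q; move: Q; rewrite /is_leaf indegE outdegE => /andP[+ /eqP/size0nil Eo].
    by case: (ine v) => [|a []] // _; apply: Or32; exists a, i.
  - have El : lab v = None by rewrite L2 // Q.
    move: Q; rewrite /is_inner indegE outdegE => /andP[].
    case: (ine v) => [|a []] // _; case: (oute v) => [|b [|c []]] // _.
    by apply: Or33; exists a, b, c.
  - by rewrite (negbTE (nr v)) in Q.
have nN e : g e <> None.
  have [m le_m] := ubnP (\max_w rk w - rk (tgt e)); elim: m => // m IH in e le_m *.
  have ei : e \in ine (tgt e) by rewrite mem_ine.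
  rewrite Eg /phi; case: (ty (tgt e)) => [[Ei _]|[a [i [_ _ ->]]]|[a [b [c [_ Eo ->]]]]] //.
    by rewrite Ei in ei.
  have low c' : src c' = tgt e -> g c' <> None.
    move=> sc; apply: IH; have := rkmax rk (tgt c'); have := Hrk c'; rewrite sc.
    by move: le_m; lia.
  rewrite Eo; case Eb: (g b) => [x|]; last by case: (low b) => //; apply: so; rewrite Eo mem_head.
  by case Ec: (g c) => [y|] //; case: (low c) => //; apply: so; rewrite Eo !inE eqxx orbT.
have Er : ine r = [::] by move: Hr; rewrite /is_root indegE => /andP[/eqP/size0nil].
have [b Eb] : exists b, oute r = [:: b].
  by case: (ty r) => [[_ //]|[a [i []]]|[a [b [c []]]]]; rewrite Er.
have sb : src b = r by apply: so; rewrite Eb mem_head.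
case Et: (g b) => [t|]; last by case: (nN b).
exists b, t, g; split=> //; first by rewrite sb.
  by move=> v; case: (ty v) => [[-> _]|[a [i [-> _ _]]]|[a [b' [c [-> _ _]]]]].
move=> k v; apply/okatP.
have nb (a e : edge G) : ine v = [:: a] -> src e = v -> (e == b) = false.
  by move=> Ei se; apply/eqP => Q; move: Ei; rewrite -se Q sb Er.
case: (ty v) => [[Ei [b' Eo]]|[a [i [Ei Eo El]]]|[a [b' [c [Ei Eo El]]]]].
- have Q : r = v.
    apply: Ur; rewrite /is_root indegE outdegE Ei Eo //.
  subst v; move: Eo; rewrite Eb => -[Q]; subst b'.
  by apply: (@VRoot n _ G _ _ b) => //=; rewrite eqxx andbT Et; case: k.
- have ta : tgt a = v by apply: ti; rewrite Ei mem_head.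
  by apply: (@VLeaf n _ G _ _ a i) => //=; rewrite Eg /phi ta El.
- have ta : tgt a = v by apply: ti; rewrite Ei mem_head.
  have sb' : src b' = v by apply: so; rewrite Eo mem_head.
  have sc : src c = v by apply: so; rewrite Eo !inE eqxx orbT.
  have ub : b' != c by have := uniq_oute v; rewrite Eo /= inE andbT.
  case E1: (g b') => [x|]; last by case: (nN b').
  case E2: (g c) => [y|]; last by case: (nN c).
  apply: (@VBranch n _ G _ _ a b' c false x y) => //=; rewrite ?Eo ?(nb _ _ Ei) ?andbF //.
  by rewrite Eg /phi ta El Eo E1 E2.
Qed.

Definition comp_deco r S (d : deco S) := [/\
  forall e : edge S, okat r d (src e) /\ okat r d (tgt e),
  forall v : vertex S, size (ine v) <= 1 & forall e, st d e -> ine (src e) = [::]].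

Lemma sub_ine0 S (f : edge S) x : ine x = [::] -> ine (Some x : vertex (subdivide f)) = [::].
Proof. by move=> E; apply/size0nil; rewrite (perm_size (sub_ineS _ _)) E. Qed.

Lemma cspec_sub r S (f : edge S) (d : deco S) : comp_deco r d -> comp_deco r (subd f d).
Proof.
move=> [O I B]; split.
- case=> [e|] /=; last by split; [apply: subd_okN|apply: subd_okS; have [] := O f].
  split; first by apply: subd_okS; have [] := O e.
  by case: eqP => _; [apply: subd_okN|apply: subd_okS; have [] := O e].
- by case=> [x|]; rewrite ?sub_ineN // (perm_size (sub_ineS _ _)) size_map.
- by case=> [e|] //= /B; apply: sub_ine0.
Qed.

Lemma tree_comp H : phylo_tree H -> exists t, forall (k : bool) S, is_subdivision H S ->
  exists (d : deco S) b, [/\ comp_deco (if k then None else Some t) d,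
    forall e, st d e = k && (e == b), tm d b = Some t, forall e, ~~ sp d e & ine (src b) = [::]].
Proof.
move=> /tree_deco [b0 [t [g [Eb Et si V]]]]; exists t => k S.
elim=> [|{}S f _ [d [b [C sE tE pE iE]]]].
  exists (Deco g (fun e => k && (e == b0)) (fun=> false)), b0; split=> //.
  split=> // [e|e /= /andP[_ /eqP ->] //].
  by split; apply: V.
exists (subd f d), (Some b); split=> //.
- exact: cspec_sub.
- by case=> [e|] /=; [rewrite sE (inj_eq (@Some_inj _))|rewrite andbF].
- by case=> [e|] /=; rewrite ?negb_and ?pE ?orbT.
- exact: sub_ine0.
Qed.

Lemma dis_comp S : is_subdivision (single_edge (label n)) S ->
  exists (d : deco S) z, [/\ comp_deco None d, forall e, sp d e = (e == z) & forall e, tm d e = None].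
Proof.
elim=> [|{}S f _ [d [z [C sE tE]]]].
  have Ei0 : ine (false : vertex (single_edge (label n))) = [::].
    by case E: (ine _) => [|e s] //; have := mem_head e s; rewrite -E mem_ine.
  have Eo1 : oute (true : vertex (single_edge (label n))) = [::].
    by case E: (oute _) => [|e s] //; have := mem_head e s; rewrite -E mem_oute.
  have Eo0 : oute (false : vertex (single_edge (label n))) = [:: tt].
    apply: perm1; rewrite perm_sym; apply: uniq_perm; rewrite ?uniq_oute // => -[].
    by rewrite mem_oute inE.
  have Ei1 : ine (true : vertex (single_edge (label n))) = [:: tt].
    apply: perm1; rewrite perm_sym; apply: uniq_perm; rewrite ?uniq_ine // => -[].
    by rewrite mem_ine inE.
  exists (@Deco n (single_edge (label n)) (fun=> None) (fun=> true) (fun=> true)), tt; split.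
  - split; [|by case; rewrite ?Ei0 ?Ei1|by move=> e _].
    move=> e; split; rewrite /okat /ins /outs ?Ei0 ?Eo0 ?Ei1 ?Eo1 //=.
    by right.
  - by case.
  - by [].
exists (subd f d), (theta f z); split; first exact: cspec_sub.
- case=> [e|] /=; rewrite sE /theta.
    case: (eqVneq z f) => [->|ne]; first by case: eqP.
    by rewrite (inj_eq (@Some_inj _)); case: (eqVneq e z) => [->|_]; rewrite ?ne // andbF.
  by rewrite eq_sym; case: eqP.
- by case=> [e|] /=.
Qed.

Section Gluing.
Variables (G : lgr) (k : nat) (F : option 'I_k -> lgr) (r0 : option bt) (t : 'I_k -> bt).
Local Notation idx := (option 'I_k + 'I_(nret G))%type.
Variables (S : idx -> lgr) (h : forall c, subgraph_emb (S c) G) (D : forall c, deco (S c)).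
Hypothesis nG : net G.
Hypothesis Hd : forall c c' (x : edge (S c)) (x' : edge (S c')),
  embE (h c) x = embE (h c') x' -> c = c'.
Hypothesis Hc : forall e, exists c (x : edge (S c)), embE (h c) x = e.
Hypothesis DC : forall c, comp_deco (if c is inl None then r0 else None) (D c).
Hypothesis D0 : forall e, ~~ st (D (inl None)) e /\ ~~ sp (D (inl None)) e.
Hypothesis D0r : r0 <> None -> exists e : edge (S (inl None)), lab (src e) = Some Rho.
Hypothesis D0l : forall e : edge (S (inl None)), ine (src e) = [::] -> lab (src e) = Some Rho.
Hypothesis DS : forall i, exists b, [/\ forall e, st (D (inl (Some i))) e = (e == b),
  tm (D (inl (Some i))) b = Some (t i) & forall e, ~~ sp (D (inl (Some i))) e].
Hypothesis DE : forall j, exists z, (forall e, sp (D (inr j)) e = (e == z)) /\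
  forall e, tm (D (inr j)) e = None.

Lemma glue_deco : exists d : deco G, forall c (x : edge (S c)),
  [/\ tm d (embE (h c) x) = tm (D c) x, st d (embE (h c) x) = st (D c) x
    & sp d (embE (h c) x) = sp (D c) x].
Proof.
have ex e : exists v : option bt * bool * bool, exists c (x : edge (S c)), embE (h c) x = e /\
    v = (tm (D c) x, st (D c) x, sp (D c) x).
  by have [c [x E]] := Hc e; eexists; exists c, x.
pose v e := proj1_sig (constructive_indefinite_description _ (ex e)).
exists (Deco (fun e => (v e).1.1) (fun e => (v e).1.2) (fun e => (v e).2)) => c x /=.
have := proj2_sig (constructive_indefinite_description _ (ex (embE (h c) x))).
rewrite -/(v _) => -[c' [x' [E ->]]] /=; have Q := Hd E; subst c'.
by rewrite (embE_inj E).
Qed.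

Variable d : deco G.
Hypothesis Ed : forall c (x : edge (S c)),
  [/\ tm d (embE (h c) x) = tm (D c) x, st d (embE (h c) x) = st (D c) x
    & sp d (embE (h c) x) = sp (D c) x].

Let gin c (x : edge (S c)) v : tgt x = v -> embE (h c) x \in ine (embV (h c) v).
Proof. by move=> E; rewrite mem_ine emb_tgt E. Qed.
Let gout c (x : edge (S c)) v : src x = v -> embE (h c) x \in oute (embV (h c) v).
Proof. by move=> E; rewrite mem_oute emb_src E. Qed.
Let vin c (x : edge (S c)) : ine (tgt x) = [:: x].
Proof.
have [_ I _] := DC c; have := I (tgt x); have : x \in ine (tgt x) by rewrite mem_ine.
by case: (ine (tgt x)) => [|a []] //; rewrite inE => /eqP ->.
Qed.

(* The head of an edge of a component, seen inside that component. *)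
Inductive cview c (x : edge (S c)) : Prop :=
| CLeaf i of ~~ sp (D c) x & lab (tgt x) = Some (Taxon i) & tm (D c) x = Some (BLeaf i)
| CSink of sp (D c) x & tm (D c) x = None
| CSub w of ~~ sp (D c) x & oute (tgt x) = [:: w] & ~~ st (D c) w & tm (D c) w = tm (D c) x
| CBranch w w' dir u u' of ~~ sp (D c) x & src w = tgt x & src w' = tgt x & w != w'
    & ~~ st (D c) w & ~~ st (D c) w' & tm (D c) w = Some u & tm (D c) w' = Some u'
    & tm (D c) x = Some (bnode dir u u').

Let cviewP c (x : edge (S c)) : cview x.
Proof.
have [O _ B] := DC c; have [_ /okatP] := O x; have Ei := vin x.
have so w : w \in oute (tgt x) -> src w = tgt x by rewrite mem_oute => /eqP.
case.
- by move=> b; rewrite Ei.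
- move=> a i; rewrite Ei => -[<-] _ *; exact: (@CLeaf _ _ i).
- by move=> a; rewrite Ei => -[<-] _ *; apply: CSink.
- by move=> a w; rewrite Ei => -[<-] *; apply: (@CSub _ _ w).
- move=> a w w' dir u u'; rewrite Ei => -[<-] Po *; apply: (@CBranch _ _ w w' dir u u') => //;
    by apply: so; rewrite (perm_mem Po) !inE eqxx ?orbT.
- move=> a w w'; rewrite Ei => -[<-] Po _ _ sw _ _; exfalso.
  have Q : src w = tgt x by apply: so; rewrite (perm_mem Po) mem_head.
  by have := B w sw; rewrite Q Ei.
- by move=> a b w Pi; have := perm_size Pi; rewrite Ei.
Qed.

Let sinkE c (x : edge (S c)) : sp (D c) x -> exists j, c = inr j.
Proof.
case: c x => [[i|]|j] x sx; last by exists j.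
- by have [b [_ _ /(_ x)]] := DS i; rewrite sx.
- by have [_] := D0 x; rewrite sx.
Qed.

Let labN c (v : vertex (S c)) l : lab (embV (h c) v) = None -> lab v <> Some l.
Proof. by move=> E /(emb_lab (h c)); rewrite E. Qed.

Let ret_sink v : is_reticulation v ->
  exists j (x : edge (S (inr j))), sp (D (inr j)) x /\ tgt (embE (h (inr j)) x) = v.
Proof.
rewrite /is_reticulation indegE outdegE => /andP[/eqP si /eqP so].
have lv : lab v = None.
  by have [_ L _ _] := nG; move: (L v); rewrite si so; case: (lab v) => [[|i]|] //= [].
have [a [b [nab ta tb]]] : exists a b, [/\ a != b, tgt a = v & tgt b = v].
  have := uniq_ine v; case Ei: (ine v) si => [|a [|b []]] // _; rewrite /= inE andbT => ne.
  by exists a, b; split=> //; apply/eqP; rewrite -mem_ine Ei !inE eqxx ?orbT.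
have [c0 Eo] : exists c0, oute v = [:: c0] by case: (oute v) so => [|c0 []] // _; exists c0.
have [c [x Ex]] := Hc a; have [c' [x' Ex']] := Hc b.
have out c1 (x1 : edge (S c1)) : tgt (embE (h c1) x1) = v -> sp (D c1) x1 \/
    exists2 w, src w = tgt x1 & embE (h c1) w = c0.
  move=> tx; have lx l : lab (tgt x1) <> Some l by apply: labN; rewrite -emb_tgt tx.
  have ow w : src w = tgt x1 -> embE (h c1) w = c0.
    by move=> sw; have := gout sw; rewrite -emb_tgt tx Eo inE => /eqP.
  case: (cviewP x1).
  - by move=> i _ /lx.
  - by left.
  - move=> w _ Ew _ _; right; exists w; [|apply: ow]; apply/eqP; by rewrite -mem_oute Ew mem_head.
  - by move=> w *; right; exists w => //; apply: ow.
case: (out c x) => [|sx|[w sw Ew]]; first by rewrite Ex.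
  by have [j Ej] := sinkE sx; subst c; exists j, x; rewrite Ex.
case: (out c' x') => [|sx|[w' sw' Ew']]; first by rewrite Ex'.
  by have [j Ej] := sinkE sx; subst c'; exists j, x'; rewrite Ex'.
have E : embE (h c) w = embE (h c') w' by rewrite Ew Ew'.
have Q := Hd E; subst c'; have Qw := embE_inj E; subst w'.
have : x' \in ine (tgt x) by rewrite mem_ine -sw' sw.
by rewrite vin inE => /eqP Q; rewrite -Ex -Ex' Q eqxx in nab.
Qed.

Let sink_ret : exists sg : 'I_(nret G) -> vertex G, [/\ injective sg, forall j, is_reticulation (sg j)
  & forall j (x : edge (S (inr j))), sp (D (inr j)) x -> tgt (embE (h (inr j)) x) = sg j].
Proof.
pose z j := proj1_sig (constructive_indefinite_description _ (DE j)).
have zP j : (forall e, sp (D (inr j)) e = (e == z j)) /\ forall e, tm (D (inr j)) e = None.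
  exact: (proj2_sig (constructive_indefinite_description _ (DE j))).
pose sg j := tgt (embE (h (inr j)) (z j)).
pose A := [set v : vertex G | is_reticulation v].
have sub : A \subset sg @: [set: 'I_(nret G)].
  apply/subsetP => v; rewrite inE => /ret_sink [j [x [sx <-]]].
  by apply/imsetP; exists j => //; rewrite /sg -(_ : x = z j) //; apply/eqP; rewrite -(zP j).1.
have cA : #|sg @: [set: 'I_(nret G)]| = #|A|.
  apply/eqP; rewrite eqn_leq; apply/andP; split; last exact: subset_leq_card.
  by rewrite (leq_trans (leq_imset_card _ _)) // cardsT card_ord.
have EA : sg @: [set: 'I_(nret G)] = A.
  by apply/esym/eqP; rewrite eqEcard sub cA leqnn.
exists sg; split.
- have : {in [set: 'I_(nret G)] &, injective sg}.
    by apply/imset_injP; rewrite cA cardsT card_ord.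
  by move=> I i j; apply: I; rewrite inE.
- move=> j; have : sg j \in A by rewrite -EA imset_f.
  by rewrite inE.
- by move=> j x; rewrite (zP j).1 => /eqP ->.
Qed.

Let start_at c (x : edge (S c)) : ine (src x) = [::] -> lab (src x) <> Some Rho -> st (D c) x.
Proof.
have [O _ _] := DC c; have [/okatP + _] := O x.
have xo : x \in oute (src x) by rewrite mem_oute.
move=> W Ei nl; case: W; rewrite ?Ei //.
- move=> b _ Eo; move: xo; rewrite Eo inE => /eqP <-.
  case: ifP => // _ [_]; case: c x Ei nl {O Eo b} => [[i|]|j] x Ei nl //.
  by case: nl; apply: D0l.
- by move=> a b c1 Pi; have := perm_size Pi.
Qed.

Lemma glue_valid : valid r0 d.
Proof.
have [sg [sgI sgR sgE]] := sink_ret; have [_ Lk Hl U] := nG.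
have nosink c (x : edge (S c)) v : tgt (embE (h c) x) = v -> ~~ is_reticulation v -> sp (D c) x = false.
  move=> tx nv; apply/negbTE/negP => sx; have [j Ej] := sinkE sx; subst c.
  by move: nv; rewrite -tx (sgE j x sx) sgR.
move=> v; apply/okatP; move: (Lk v); case El: (lab v) => [[|i]|] /=.
- case=> /size0nil Ei; case Eo: (oute v) => [|b []] // _.
  apply: (@VRoot n _ G _ _ b) => //.
  have isol c (x : edge (S c)) : c <> inl None -> embE (h c) x = b -> r0 = None.
    move=> nc Ex; case E0: r0 => [t0|] //; have [|e Ee] := D0r; first by rewrite E0.
    have Q : embV (h (inl None)) (src e) = v by apply: (U _ _ Rho) => //; apply: emb_lab.
    have := gout (erefl (src e)); rewrite Q Eo inE => /eqP Q2.
    by case: nc; apply: Hd (etrans Ex (esym Q2)).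
  have [c [x Ex]] := Hc b; have [Et Es _] := Ed x; rewrite Ex in Et Es; rewrite Et Es.
  have sb : src b = v by apply/eqP; rewrite -mem_oute Eo mem_head.
  have vx : embV (h c) (src x) = v by rewrite -emb_src Ex.
  have ix : ine (src x) = [::].
    case E: (ine (src x)) => [|y s] //; have ty : tgt y = src x.
      by apply/eqP; rewrite -mem_ine E mem_head.
    by have := gin ty; rewrite vx Ei.
  have [O _ _] := DC c; have [/okatP + _] := O x.
  have xo : x \in oute (src x) by rewrite mem_oute.
  move=> W; case: W; rewrite ?ix //; last by move=> a b' c1 Pi; have := perm_size Pi.
  move=> b' _ Eo'; move: xo; rewrite Eo' inE => /eqP <-.
  case: c x Ex Et Es vx ix {O Eo' b'} => [[i|]|j] x Ex Et Es vx ix //; case: ifP => // _; try by case.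
    by move=> _; apply: (isol (inl (Some i)) x).
  by move=> _; apply: (isol (inr j) x).
- case; case Ei: (ine v) => [|a []] // _ /size0nil Eo.
  have ta : tgt a = v by apply/eqP; rewrite -mem_ine Ei mem_head.
  have nv : ~~ is_reticulation v by rewrite /is_reticulation indegE Ei.
  have [c [x Ex]] := Hc a; have [Et _ Ep] := Ed x; rewrite Ex in Et Ep.
  have tx : tgt (embE (h c) x) = v by rewrite Ex.
  have vx : embV (h c) (tgt x) = v by rewrite -emb_tgt.
  have no w : src w <> tgt x by move=> sw; have := gout sw; rewrite vx Eo.
  case: (cviewP x).
  + move=> j _ lj tj; have := emb_lab (h c) lj; rewrite vx El => -[Q]; subst j.
    by apply: (@VLeaf n _ G _ _ a i) => //; rewrite ?Ep ?(nosink _ _ _ tx) // Et.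
  + by rewrite (nosink _ _ _ tx).
  + by move=> w _ Ew; case: (no w); apply/eqP; rewrite -mem_oute Ew mem_head.
  + by move=> w w' dir u u' _ sw; case: (no w).
- case; case.
    case Ei: (ine v) => [|a []] // _ so.
    have ta : tgt a = v by apply/eqP; rewrite -mem_ine Ei mem_head.
    have nv : ~~ is_reticulation v by rewrite /is_reticulation indegE Ei.
    have [c [x Ex]] := Hc a; have [Et _ Ep] := Ed x; rewrite Ex in Et Ep.
    have tx : tgt (embE (h c) x) = v by rewrite Ex.
    have vx : embV (h c) (tgt x) = v by rewrite -emb_tgt.
    have spa : ~~ sp d a by rewrite Ep (nosink _ _ _ tx).
    have ow w : src w = tgt x -> embE (h c) w \in oute v by move=> sw; have := gout sw; rewrite vx.
    case: (cviewP x).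
    + by move=> j _ lj _; have := emb_lab (h c) lj; rewrite vx El.
    + by rewrite (nosink _ _ _ tx).
    + move=> w _ Ew sw tw.
      have swx : src w = tgt x by apply/eqP; rewrite -mem_oute Ew mem_head.
      have [g0 [ng Pg]] : exists g0, g0 != embE (h c) w /\ perm_eq (oute v) [:: g0; embE (h c) w].
        have := ow _ swx; have := uniq_oute v.
        case: (oute v) so => [|p [|q []]] // _; rewrite /= inE andbT => ne.
        rewrite !inE => /orP[] /eqP ->.
          by exists q; rewrite eq_sym (perm_catC [:: p] [:: q]).
        by exists p.
      have [c' [x' Ex']] := Hc g0.
      have sg0 : src g0 = v by apply/eqP; rewrite -mem_oute (perm_mem Pg) mem_head.
      have vx' : embV (h c') (src x') = v by rewrite -emb_src Ex'.
      have ix' : ine (src x') = [::].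
        case E: (ine (src x')) => [|y s] //; have ty : tgt y = src x'.
          by apply/eqP; rewrite -mem_ine E mem_head.
        have := gin ty; rewrite vx' Ei inE => /eqP Ey; have E2 := etrans Ey (esym Ex).
        have Q := Hd E2; subst c'; have Qy := embE_inj E2; subst y.
        have : x' \in oute (tgt x) by rewrite mem_oute ty.
        by rewrite Ew inE => /eqP Q; rewrite -Ex' Q eqxx in ng.
      have sx' : st (D c') x'.
        by apply: start_at => //; apply: labN; rewrite vx'.
      have [_ Es' _] := Ed x'; rewrite Ex' in Es'.
      have [Ew1 Ew2 _] := Ed w.
      by apply: (@VPass n _ G _ _ a g0 (embE (h c) w)) => //; rewrite ?Es' ?Ew2 ?Ew1 ?Et.
    + move=> w w' dir u u' _ sw sw' nw stw stw' tw tw' tx'.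
      have [Ew1 Ew2 _] := Ed w; have [Ew1' Ew2' _] := Ed w'.
      have nn : embE (h c) w != embE (h c) w' by rewrite (inj_eq (@embE_inj _ _ _ (h c))).
      apply: (@VBranch n _ G _ _ a (embE (h c) w) (embE (h c) w') dir u u') => //; rewrite ?Ew2 ?Ew2' ?Ew1 ?Ew1' ?Et //.
      have := ow _ sw; have := ow _ sw'; have := uniq_oute v.
      case: (oute v) so => [|p [|q []]] // _ _; rewrite !inE.
      case/orP=> /eqP E1; case/orP=> /eqP E2; rewrite E1 E2 ?eqxx // in nn *.
      by rewrite (perm_catC [:: p] [:: q]).
  move=> si so; have rv : is_reticulation v by rewrite /is_reticulation indegE outdegE si so.
  have [j [z [sz tz]]] := ret_sink rv.
  have [c0 Eo] : exists c0, oute v = [:: c0] by case: (oute v) so => [|c0 []] // _; exists c0.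
  have [b [nb Pi]] : exists b, embE (h (inr j)) z != b /\ perm_eq (ine v) [:: embE (h (inr j)) z; b].
    have : embE (h (inr j)) z \in ine v by rewrite mem_ine tz.
    have := uniq_ine v; case: (ine v) si => [|p [|q []]] // _; rewrite /= inE andbT => ne.
    rewrite !inE => /orP[] /eqP ->; first by exists q.
    by exists p; rewrite eq_sym (perm_catC [:: p] [:: q]).
  have [c [x Ex]] := Hc b; have [Et _ Ep] := Ed x; rewrite Ex in Et Ep.
  have tb : tgt b = v by apply/eqP; rewrite -mem_ine (perm_mem Pi) !inE eqxx orbT.
  have vx : embV (h c) (tgt x) = v by rewrite -emb_tgt Ex.
  have ow w : src w = tgt x -> embE (h c) w = c0.
    by move=> sw; have := gout sw; rewrite vx Eo inE => /eqP.
  have [Ez1 _ Ez2] := Ed z.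
  have [z0 [spz Nz]] := DE j.
  case: (cviewP x).
  + by move=> i _ li _; have := emb_lab (h c) li; rewrite vx El.
  + move=> sx _; have [j' Ej'] := sinkE sx; subst c.
    have Q : j' = j by apply: sgI; rewrite -(sgE _ _ sx) -(sgE _ _ sz) Ex tb tz.
    subst j'; move: sx sz; rewrite !spz => /eqP Q1 /eqP Q2.
    by rewrite -Ex Q1 Q2 eqxx in nb.
  + move=> w px Ew sw tw.
    have swx : src w = tgt x by apply/eqP; rewrite -mem_oute Ew mem_head.
    have Ew0 := ow _ swx; have [Ew1 Ew2 _] := Ed w; rewrite Ew0 in Ew1 Ew2.
    by apply: (@VRet n _ G _ _ (embE (h (inr j)) z) b c0) => //; rewrite ?Ez2 ?Ez1 ?Nz ?Ep ?Et ?Ew1 ?Ew2.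
  + move=> w w' dir u u' _ sw sw' nw _ _ _ _ _; have Q := etrans (ow _ sw) (esym (ow _ sw')).
    by rewrite (embE_inj Q) eqxx in nw.
Qed.

Lemma glue_real : real G r0 (map t (enum 'I_k)).
Proof.
exists d; split; first exact: glue_valid.
pose b i := proj1_sig (constructive_indefinite_description _ (DS i)).
have bP i : [/\ forall e, st (D (inl (Some i))) e = (e == b i),
  tm (D (inl (Some i))) (b i) = Some (t i) & forall e, ~~ sp (D (inl (Some i))) e].
  exact: (proj2_sig (constructive_indefinite_description _ (DS i))).
apply: (pmap_image (f := fun i => embE (h (inl (Some i))) (b i))).
- by move=> i j /Hd [].
- by move=> i; have [E1 E2 _] := Ed (b i); have [E3 E4 _] := bP i; rewrite /start_term E1 E2 E3 eqxx E4.
- move=> e; have [c [x <-]] := Hc e; have [E1 E2 _] := Ed x; rewrite /start_term E1 E2.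
  case: c x {E1 E2} => [[i|]|j] x.
  + have [-> _ _] := bP i; case: eqP => // -> _; by exists i.
  + by have [/negbTE -> _] := D0 x.
  + by have [z [_ ->]] := DE j; case: ifP.
Qed.

End Gluing.

End Glue.

(** * The agreement distance *)

Section Agreement.
Variable n : nat.
Local Notation lgr := (lgraph (label n)).
Local Notation bt := (bt n).
Implicit Types G H S T N M : lgr.

Lemma sub_no_edge H S : is_subdivision H S -> (edge H -> False) -> edge S -> False.
Proof. by elim=> // {}S f _ IH /IH /(_ f). Qed.

Definition tree_comp_deco H (t : bt) := forall (k : bool) S, is_subdivision H S ->
  exists (d : deco S) b, [/\ comp_deco (if k then None else Some t) d,
    forall e, st d e = k && (e == b), tm d b = Some t, forall e, ~~ sp d e & ine (src b) = [::]].

Definition rho_comp H (r0 : option bt) :=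
  (edge H -> False) /\ r0 = None \/ exists t, [/\ r0 = Some t, inv3 H & tree_comp_deco H t].

Lemma forest_real G k (F : option 'I_k -> lgr) r0 t : net G ->
  covering_embeddings (fun c : option 'I_k + 'I_(nret G) =>
     if c is inl i then F i else single_edge (label n)) G ->
  rho_comp (F None) r0 -> (forall i, tree_comp_deco (F (Some i)) (t i)) ->
  real G r0 (map t (enum 'I_k)).
Proof.
move=> nG [S [h [HS Hd Hc]]] HF0 HF.
pose K c : deco (S c) -> Prop := match c return deco (S c) -> Prop with
  | inl None => fun d => [/\ comp_deco r0 d, forall e, ~~ st d e /\ ~~ sp d e,
      r0 <> None -> exists e : edge (S (inl None)), lab (src e) = Some Rho
    & forall e : edge (S (inl None)), ine (src e) = [::] -> lab (src e) = Some Rho]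
  | inl (Some i) => fun d => comp_deco None d /\ exists b, [/\ forall e, st d e = (e == b),
      tm d b = Some (t i) & forall e, ~~ sp d e]
  | inr j => fun d => comp_deco None d /\ exists z, (forall e, sp d e = (e == z)) /\
      forall e, tm d e = None
  end.
have ex c : exists d, K c d.
  case: c => [[i|]|j] /=.
  - have [d [b [C sE tE pE _]]] := HF i true _ (HS (inl (Some i))).
    by exists d; split=> //; exists b.
  - have HS0 := HS (inl None); rewrite /= in HS0.
    case: HF0 => [[nE r0E]|[t0 [r0E I3 TC]]]; subst r0.
      have nS := sub_no_edge HS0 nE.
      exists (Deco (fun=> None) (fun=> false) (fun=> false)); split=> [|//|//|e].
        split=> [e|v|//]; first by case: (nS e).
        by case: (ine v) => [|e s] //; case: (nS e).
      by case: (nS e).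
    have [d [b [C sE tE pE ib]]] := TC false _ HS0.
    have [_ _ I3'] := inv_sub HS0; have {}I3' := I3' I3.
    have lr (e : edge (S (inl None))) : ine (src e) = [::] -> lab (src e) = Some Rho.
      by move=> Ei; apply: I3' => x Q; have := mem_ine (src e) x; rewrite Ei Q eqxx.
    exists d; split=> //; first by move=> e; rewrite sE pE.
    by move=> _; exists b; apply: lr.
  - by have [d [z [C sE tE]]] := dis_comp (HS (inr j)); exists d; split=> //; exists z.
pose D c := proj1_sig (constructive_indefinite_description _ (ex c)).
have KD c : K c (D c) by exact: (proj2_sig (constructive_indefinite_description _ (ex c))).
have [C0 D0 D0r D0l] := KD (inl None).
have DC c : comp_deco (if c is inl None then r0 else None) (D c).
  by case: c => [[i|]|j]; [have [] := KD (inl (Some i))|exact: C0|have [] := KD (inr j)].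
have DS i : exists b, [/\ forall e, st (D (inl (Some i))) e = (e == b),
    tm (D (inl (Some i))) b = Some (t i) & forall e, ~~ sp (D (inl (Some i))) e].
  by have [] := KD (inl (Some i)).
have DE j : exists z, (forall e, sp (D (inr j)) e = (e == z)) /\
    forall e, tm (D (inr j)) e = None by have [] := KD (inr j).
have [d Ed] := glue_deco D Hd Hc.
exact: (glue_real nG Hd Hc DC D0 D0r D0l DS DE Ed).
Qed.

Lemma rho_inv3 H : phylo_tree H -> has_label H Rho -> inv3 H.
Proof.
move=> [[_ [r [Hr Ur]] Ty Lb _] nr] [w Ew] v Hv.
have ii (x : vertex H) : ine x <> [::] -> indeg x <> 0 by rewrite indegE => N /size0nil.
have rw : is_root w.
  have [_ L1 L2] := Lb w; case/or4P: (Ty w) => // Q.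
  - by have [i] := L1 Q; rewrite Ew.
  - by rewrite L2 ?Q // in Ew.
  - by rewrite L2 ?Q ?orbT // in Ew.
have iv : indeg v = 0.
  rewrite indegE; case E: (ine v) => [|e s] //; case: (Hv e).
  by apply/eqP; rewrite -mem_ine E mem_head.
have rv : is_root v.
  by move: (Ty v); rewrite /is_leaf /is_inner /is_reticulation iv /= !orbF.
by rewrite -(Ur _ rv) (Ur _ rw).
Qed.

Lemma forest_agr T N k (F : option 'I_k -> lgr) : net T -> nret T = 0 -> net N ->
  agreement_forest T N F -> agr T N k.
Proof.
move=> nT rT nN [HF0 HF _ CT CN].
have ext i : exists t, tree_comp_deco (F (Some i)) t by have [t] := tree_comp (HF i); exists t.
pose t i := proj1_sig (constructive_indefinite_description _ (ext i)).
have tP i : tree_comp_deco (F (Some i)) (t i).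
  exact: (proj2_sig (constructive_indefinite_description _ (ext i))).
have [r0 R0] : exists r0, rho_comp (F None) r0.
  case: HF0 => [[_ c0 _]|[HF0 HR]].
    by exists None; left; split=> // e; have := card0_eq c0 e.
  have [t0 T0] := tree_comp HF0; exists (Some t0); right; exists t0.
  by split=> //; apply: rho_inv3.
exists r0, (map t (enum 'I_k)); split; first by rewrite size_map size_enum_ord.
- have noJ (j : 'I_(nret T)) : False by case: j => j; rewrite rT.
  apply: (forest_real nT _ R0 tP); have [S [h [HS Hd Hc]]] := CT.
  pose S' (c : option 'I_k + 'I_(nret T)) :=
    match c with inl i => S i | inr _ => single_edge (label n) end.
  pose h' c := match c return subgraph_emb (S' c) T with
    inl i => h i | inr j => False_rect _ (noJ j) end.
  exists S', h'; split.
  + by case=> [i|j]; [apply: HS|case: (noJ j)].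
  + move=> [i|j] [i'|j'] e f; try by case: (noJ j).
      by move/Hd ->.
    by case: (noJ j').
  + by move=> e; have [i [x Ex]] := Hc e; exists (inl i), x.
- exact: (forest_real nN CN R0 tP).
Qed.

Lemma agr_refl T : phylo_tree T -> agr T T 0.
Proof.
move=> /tree_deco [b [t [g [_ _ _ V]]]].
have R : real T (Some t) [::].
  exists (Deco g (fun e => false && (e == b)) (fun=> false)); split; first exact: (V false).
  by rewrite /starts; elim: (enum _).
by exists (Some t), [::].
Qed.

End Agreement.

Lemma minimum_exists (P : nat -> Prop) k : P k -> exists m, is_minimum P m.
Proof.
have [m le_m] := ubnP k; elim: m => // m IH in k le_m *; move=> Pk.
case: (classic (exists2 j, P j & j < k)) => [[j Pj lt_j]|no].
  by apply: (IH j) => //; apply: leq_trans lt_j _.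
by exists k; split=> // j Pj; rewrite leqNgt; apply/negP => lt_j; apply: no; exists j.
Qed.

Theorem theorem4p3 (n : nat) (T N : lgraph (label n))
    (hT : tree_on_X T) (hN : network_on_X N) :
  exists d : nat, is_d_SNPR T N d /\ is_m T N d.
Proof.
have [[tT1 noret] lT] := hT; have tT : phylo_tree T by split.
have nT : net T by apply/netP; split.
have nN : net N by apply/netP.
have rT : nret T = 0.
  by apply/eqP; rewrite cards_eq0 -subset0; apply/subsetP => v; rewrite inE (negbTE (noret v)).
have [k0 A0] := agr_exists nT nN.
have [k [Ak min_k]] := minimum_exists A0.
have lower j : snpr_path j T N -> k + nret N <= j.
  move=> Pj; have [k' [A' le_k']] := agr_path nT nT (agr_refl tT) Pj.
  by rewrite rT !add0n in le_k'; apply: leq_trans le_k'; rewrite leq_add2r min_k.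
have [j le_j Pj] := agr_path_exists nT rT nN Ak.
have Ej : j = k + nret N by apply/eqP; rewrite eqn_leq le_j lower.
exists (k + nret N); split; first by split=> //; rewrite -Ej.
exists k; split=> //; split; first exact: agr_forest.
by move=> j' [F HF]; apply: min_k; apply: forest_agr HF.
Qed.
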